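(* Let $p>2$, $f\ge2$, $q=p^f$, $k=(k_0,\dots,k_{f-1})$ with $r_i=k_i-2\ge q$ for all $i$, and suppose $r=\sum_ir_ip^i\equiv a_hp^h\pmod{q-1}$ for some $0\le h\le f-1$ and $a_h\in\{1,2,\dots,p-1\}$. Assume $p\nmid r_{h+1}$ (index taken mod $f$), that $p\mid r_h$ if $a_h=1$, and that $a_p$ lies in a finite extension of $\mathbb{Q}_{p^f}$ with $v(a_p)\in(\frac12,1)$. Then the natural surjection $\mathrm{ind}_{KZ}^G(Q_{f-1}/Q_{f-2})\twoheadrightarrow F_s$ vanishes on $T(\mathrm{ind}_{KZ}^G(Q_{f-1}/Q_{f-2}))$, i.e. it factors through $T$.
   Context: Setting: $\mathbb{Q}_{p^f}$ unramified of degree $f$ over $\mathbb{Q}_p$, ring of integers $\mathbb{Z}_{p^f}$, residue field $\mathbb F_q$, Teichmüller lifts $[\lambda]$; $G=\mathrm{GL}_2(\mathbb{Q}_{p^f})$, $K=\mathrm{GL}_2(\mathbb{Z}_{p^f})$, $Z$ the center, $\Gamma=\mathrm{GL}_2(\mathbb F_q)$, $v(p)=1$. For a ring $R$, $V(R)=\bigotimes_{i=0}^{f-1}\mathrm{Sym}^{r_i}R^2$ is modeled on polynomials homogeneous of degree $r_i$ in $(X_i,Y_i)$; $\begin{pmatrix}a&b\\c&d\end{pmatrix}\in K$ acts by $v\mapsto v(a^{\sigma^i}X_i+c^{\sigma^i}Y_i,b^{\sigma^i}X_i+d^{\sigma^i}Y_i)$ ($\sigma$ Frobenius), $p\in Z$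 acts trivially. $[g,v]$ is the function supported on $KZg^{-1}$ with $g'\mapsto g'g\cdot v$. Hecke operator: $T([g,v])=\sum_{\lambda\in\mathbb F_q}[g\begin{pmatrix}p&[\lambda]\\0&1\end{pmatrix},v(X_i,(-[\lambda])^{p^i}X_i+pY_i)]+[g\begin{pmatrix}1&0\\0&p\end{pmatrix},v(pX_i,Y_i)]$; on the induction of a mod $p$ weight $\bigotimes\mathrm{Sym}^{s_i}\bar{\mathbb F}_p^2\otimes\det^m$ it is $T([g,v])=\sum_\lambda[g\begin{pmatrix}p&[\lambda]\\0&1\end{pmatrix},v(X_i,(-\lambda)^{p^i}X_i)]+[g\begin{pmatrix}1&0\\0&p\end{pmatrix},v(0,Y_i)]$. For $a_p$ in a finite extension $E$ (ring of integers $\mathcal O_E$, residue field $k_E$): $\Theta_{k,a_p}$ is the image of $\mathrm{ind}_{KZ}^GV(\mathcal O_E)$ in $\mathrm{ind}_{KZ}^GV(E)/(T-a_p)$, $\bar\Theta_{k,a_p}=\Theta_{k,a_p}\otimes k_E$, with natural surjection $\mathrm{ind}_{KZ}^GV_r\twoheadrightarrow\bar\Theta_{k,a_p}$, $V_r=V(\bar{\mathbb F}_p)$. Let $\theta_i=X_iY_{i-1}^p-Y_iX_{i-1}^p$ (indices mod $f$), $V_r^*$ the subspace of $V_r$ of elements $\sum_i\theta_iP_i$, $X_r$ the $\Gamma$-submodule generated by $\prod_iX_i^{r_i}$, $Q=V_r/(V_r^*+X_r)$; the surjection factors through $\mathrm{ind}_{KZ}^GQ\twoheadrightarrow\bar\Theta_{k,a_p}$.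 Let $Q_0=0$, $Q_1=\mathrm{soc}(Q)$, $Q_{i+1}/Q_i=\mathrm{soc}(Q/Q_i)$ be the socle filtration (with $Q_f=Q$ as in the paper), $F_i$ the image of $\mathrm{ind}_{KZ}^GQ_i$ in $\bar\Theta_{k,a_p}$, and $F_s=F_{f-1}/F_{f-2}$; the map in the claim is the induced surjection. *)

(* Defs.v *)
From HB Require Import structures.
From mathcomp Require Import all_boot all_order all_algebra all_field.
From mathcomp Require Import ring_quotient boolp functions freeg mpoly.

Set Implicit Arguments.
Unset Strict Implicit.
Unset Printing Implicit Defensive.

Import Order.TTheory GRing.Theory Num.Theory.
Local Open Scope ring_scope.
Local Open Scope quotient_scope.

Section Quotient.
Context (A : nzRingType) (M : lmodType A).

Definition lspan (S : M -> Prop) (x : M) : Prop :=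
  forall N : M -> Prop, N 0 ->
    (forall (a : A) (u v : M), N u -> N v -> N (a *: u + v)) ->
    (forall u, S u -> N u) -> N x.

Definition lspanb (S : M -> Prop) : {pred M} := [pred x | `[< lspan S x >]].

Fact lspanb_zmod_closed (S : M -> Prop) : zmod_closed (lspanb S).
Proof.
split=> [|x y]; rewrite !inE; first by apply/asboolP => N N0 _ _.
move=> /asboolP Sx /asboolP Sy; apply/asboolP => N N0 Nl SN.
by rewrite addrC -scaleN1r; apply: (Nl); [exact: (Sy N)|exact: (Sx N)].
Qed.

HB.instance Definition _ (S : M -> Prop) :=
  GRing.isZmodClosed.Build M (lspanb S) (lspanb_zmod_closed S).

(* M / S.  The type makes sense for every predicate S: it is the quotient by
   the submodule generated by S, that is, by S when S is a submodule. *)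
Definition quot (S : M -> Prop) : Type := {ideal_quot (lspanb S)}.

HB.instance Definition _ (S : M -> Prop) := GRing.Zmodule.on (quot S).
HB.instance Definition _ (S : M -> Prop) := Quotient.on (quot S).

Definition quot_pi (S : M -> Prop) (x : M) : quot S := \pi_(quot S) x.

Definition quot_scale (S : M -> Prop) (a : A) (x : quot S) : quot S :=
  quot_pi S (a *: repr x).

Fact quot_scaleE S a x : quot_scale a (quot_pi S x) = quot_pi S (a *: x).
Proof.
apply/eqP; rewrite /quot_scale /quot_pi.
rewrite -(Quotient.idealrBE (lspanb S)) -scalerBr.
have : repr (\pi_(quot S) x) - x \in lspanb S.
  by rewrite Quotient.idealrBE; apply/eqP; exact: reprK.
rewrite !inE => /asboolP h; apply/asboolP => N N0 Nl SN.
by rewrite -[_ *: _]addr0; apply: (Nl) => //; exact: (h N).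
Qed.

Fact quot_piK S (x : quot S) : quot_pi S (repr x) = x.
Proof. exact: reprK. Qed.

Fact quot_piD S x y : quot_pi S (x + y) = quot_pi S x + quot_pi S y.
Proof. exact: (raddfD (\pi_{ideal_quot (lspanb S)})). Qed.

Fact quot_scaleA S (a b : A) (x : quot S) :
  quot_scale a (quot_scale b x) = quot_scale (a * b) x.
Proof. by rewrite -[x]quot_piK !quot_scaleE scalerA. Qed.

Fact quot_scale1 S : left_id 1 (@quot_scale S).
Proof. by move=> x; rewrite -[x]quot_piK quot_scaleE scale1r. Qed.

Fact quot_scaleDr S : right_distributive (@quot_scale S) +%R.
Proof.
by move=> a x y; rewrite -[x]quot_piK -[y]quot_piK -quot_piD !quot_scaleE
  scalerDr quot_piD.
Qed.

Fact quot_scaleDl S (x : quot S) :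
  {morph (@quot_scale S)^~ x : a b / a + b}.
Proof.
by move=> a b; rewrite -[x]quot_piK !quot_scaleE scalerDl quot_piD.
Qed.

HB.instance Definition _ (S : M -> Prop) :=
  GRing.Zmodule_isLmodule.Build A (quot S)
    (@quot_scaleA S) (@quot_scale1 S) (@quot_scaleDr S) (@quot_scaleDl S).

Definition quot_im (S N : M -> Prop) (y : quot S) : Prop :=
  exists2 x, N x & y = quot_pi S x.

End Quotient.

Section Representations.
Context (k : finFieldType) (A : fieldType) (M : lmodType A).
Implicit Types (rho : 'M[k]_2 -> M -> M) (N S : M -> Prop).

Definition subrep rho S : Prop :=
  [/\ S 0, (forall (a : A) (u v : M), S u -> S v -> S (a *: u + v))
    & (forall g u, g \in unitmx -> S u -> S (rho g u))].

Definition generated_subrep rho (x v : M) : Prop :=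
  forall S, subrep rho S -> S x -> S v.

Definition simple_subrep rho S : Prop :=
  [/\ subrep rho S, (exists2 x, S x & x != 0)
    & (forall S', subrep rho S' -> (forall x, S' x -> S x) ->
        (forall x, S' x -> x = 0) \/ (forall x, S x -> S' x))].

Definition socle rho N (x : M) : Prop :=
  exists s : seq M, x = \sum_(u <- s) u /\
    (forall u, u \in s -> exists S,
       [/\ simple_subrep rho S, (forall y, S y -> N y) & S u]).

End Representations.

Definition quot_act (k : finFieldType) (A : fieldType) (M : lmodType A)
    (S : M -> Prop) (rho : 'M[k]_2 -> M -> M) (g : 'M[k]_2) (x : quot S) :
    quot S :=
  quot_pi S (rho g (repr x)).

Fixpoint socle_filtration (k : finFieldType) (A : fieldType) (M : lmodType A)
    (rho : 'M[k]_2 -> M -> M) (N : M -> Prop) (i : nat) : M -> Prop :=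
  match i with
  | 0%N => fun x => x = 0
  | i'.+1 => fun x =>
      let S := socle_filtration rho N i' in
      N x /\ socle (quot_act (S := S) rho) (quot_im (S := S) N) (quot_pi S x)
  end.

(* Valuations take the value v x on nonzero x; v 0 is irrelevant. *)
Definition is_valuation (L : fieldType) (v : L -> rat) : Prop :=
  (forall x y, x != 0 -> y != 0 -> v (x * y) = v x + v y) /\
  (forall x y, x != 0 -> y != 0 -> x + y != 0 ->
     Num.min (v x) (v y) <= v (x + y)).

Definition vge (L : fieldType) (v : L -> rat) (c : rat) (x : L) : bool :=
  (x == 0) || (c <= v x).

Definition integer_of (L : fieldType) (v : L -> rat) : pred L := vge v 0.

(* Q_p as the completion of the rationals; density and v p = 1 force v to be
   the p-adic valuation. *)
Definition is_Qp (p : nat) (L : fieldType) (v : L -> rat) : Prop :=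
  [/\ is_valuation v,
      (p%:R : L) != 0 /\ v p%:R = 1,
      (forall (x : L) (N : nat), exists a : rat, vge v N%:R (x - ratr a))
    & (forall u : nat -> L,
        (forall N : nat, exists n0 : nat, forall m n : nat,
            (n0 <= m)%N -> (n0 <= n)%N -> vge v N%:R (u m - u n)) ->
        exists l : L, forall N : nat, exists n0 : nat, forall n : nat,
            (n0 <= n)%N -> vge v N%:R (u n - l))].

(* red induces a field embedding of the residue field of (L, v) into kappa;
   the values of red outside the ring of integers are irrelevant. *)
Definition is_residue_map (L kappa : fieldType) (v : L -> rat)
    (red : L -> kappa) : Prop :=
  [/\ red 1 = 1,
      (forall x y, integer_of v x -> integer_of v y ->
         red (x + y) = red x + red y),
      (forall x y, integer_of v x -> integer_of v y ->
         red (x * y) = red x * red y)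
    & (forall x, integer_of v x -> (red x = 0 <-> (x = 0 \/ 0 < v x)))].

Record padic_data (p f : nat) := PadicData {
  Qp : fieldType;
  vQp : Qp -> rat;
  QpP : is_Qp p vQp;
  (* F is the unramified extension of degree f. *)
  F : fieldExtType Qp;
  vF : F -> rat;
  vF_valuation : is_valuation vF;
  vF_extends : forall x : Qp, x != 0 -> vF x%:A = vQp x;
  F_degree : \dim {:F} = f;
  F_unramified : forall x : F, x != 0 -> vF x \is a Num.int;
  kF : finFieldType;
  card_kF : #|kF| = (p ^ f)%N;
  redF : F -> kF;
  redFP : is_residue_map vF redF;
  teich : kF -> F;
  teichP : forall l : kF,
    [/\ integer_of vF (teich l), redF (teich l) = l
      & teich l ^+ (p ^ f) = teich l];
  frob : {rmorphism F -> F};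
  frobP : forall x : F, integer_of vF x -> vge vF 1 (frob x - x ^+ p);
  E : fieldExtType F;
  vE : E -> rat;
  vE_valuation : is_valuation vE;
  vE_extends : forall x : F, x != 0 -> vE x%:A = vF x;
  (* Fbar is an algebraic closure of the prime field; k_E is the image of the
     ring of integers of E under redE. *)
  Fbar : closedFieldType;
  Fbar_char : p \in [pchar Fbar];
  Fbar_algebraic : forall x : Fbar, exists2 n : nat, (0 < n)%N & x ^+ (p ^ n) = x;
  redE : E -> Fbar;
  redEP : is_residue_map vE redE;
  iota_kF : {rmorphism kF -> Fbar};
  iota_kFP : forall x : F, integer_of vF x -> iota_kF (redF x) = redE x%:A
}.

Section Polynomials.
Context (f : nat) (R : comNzRingType).
Local Notation poly2 := {mpoly R[(f + f)%N]}.

Definition Xv (i : 'I_f) : poly2 := 'X_(lshift f i).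
Definition Yv (i : 'I_f) : poly2 := 'X_(rshift f i).

Definition substXY (PX PY : 'I_f -> poly2) (v : poly2) : poly2 :=
  v \mPo [tuple match fintype.split j with inl i => PX i | inr i => PY i end
         | j < (f + f)%N].

Definition V (r : 'I_f -> nat) (v : poly2) : Prop :=
  forall m : 'X_{1..(f + f)%N}, m \in msupp v ->
    forall i : 'I_f, (m (lshift f i) + m (rshift f i))%N = r i.

(* The matrix g acts in the variables X_i, Y_i through the image of its entries
   under e i. *)
Definition poly_act (L : Type) (e : 'I_f -> L -> R) (g : 'M[L]_2) : poly2 -> poly2 :=
  substXY (fun i => e i (g 0 0) *: Xv i + e i (g 1 0) *: Yv i)
          (fun i => e i (g 0 1) *: Xv i + e i (g 1 1) *: Yv i).

Definition theta (p : nat) (i : 'I_f) : poly2 :=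
  Xv i * Yv (ord_pred i) ^+ p - Yv i * Xv (ord_pred i) ^+ p.

Definition Vstar (p : nat) (r : 'I_f -> nat) (v : poly2) : Prop :=
  V r v /\ exists P : 'I_f -> poly2, v = \sum_i theta p i * P i.

End Polynomials.

Section Induction.
Context (p f : nat) (D : padic_data p f).
Local Notation G := 'M[F D]_2.

Definition inK (g : G) : bool :=
  [&& [forall i, forall j, integer_of (@vF _ _ D) (g i j)],
      \det g != 0 & vF (\det g) == 0].

Context (A : nzRingType) (M : lmodType A).
(* act g is only relevant for g in K; p in Z acts trivially, and KZ is the union
   of the p ^ n K, n an integer. *)
Context (act : G -> M -> M).

(* If g = p ^ n h with h in K, then h = Kpart g. *)
Definition Kpart (g : G) : G :=
  ((p%:R : F D) ^ (- Num.floor (vF (\det g) / 2%:R))) *: g.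

Definition bracket (g : G) (v : M) : G -> M :=
  fun x => if inK (Kpart (x *m g)) then act (Kpart (x *m g)) v else 0.

(* Functions on GL_2(F) are extended by 0 to all matrices. *)
Definition ind (N : M -> Prop) (phi : G -> M) : Prop :=
  [/\ (forall g, g \notin unitmx -> phi g = 0),
      (forall (n : int) (h g : G), inK h -> g \in unitmx ->
         phi ((p%:R : F D) ^ n *: (h *m g)) = act h (phi g)),
      (forall g, N (phi g))
    & (exists s : seq G, forall g, phi g != 0 ->
         exists (x : G) (n : int) (h : G),
           [/\ x \in s, inK h & g = (p%:R : F D) ^ n *: (h *m x)])].

Definition mx2 (a b c d : F D) : G :=
  \matrix_(i, j) (if i == 0 then if j == 0 then a else b
                  else if j == 0 then c else d).

Definition hecke_bracket (B : kF D -> M -> M) (C : M -> M) (g : G) (v : M) :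
    G -> M :=
  \sum_(l : kF D) bracket (g *m mx2 p%:R (teich l) 0 1) (B l v)
    + bracket (g *m mx2 1 0 0 p%:R) (C v).

(* hecke N B C phi psi means T phi = psi, where T is the additive extension of
   hecke_bracket B C to the induction of N. *)
Definition hecke (N : M -> Prop) (B : kF D -> M -> M) (C : M -> M)
    (phi psi : G -> M) : Prop :=
  exists s : seq (G * M),
    [/\ (forall x, x \in s -> x.1 \in unitmx /\ N x.2),
        phi = \sum_(x <- s) bracket x.1 x.2
      & psi = \sum_(x <- s) hecke_bracket B C x.1 x.2].

End Induction.

Section Weights.
Context (p f : nat) (D : padic_data p f).
Local Notation G := 'M[F D]_2.
Local Notation Gamma := 'M[kF D]_2.
Local Notation polyF := {mpoly (Fbar D)[(f + f)%N]}.

Definition inflate (U : Type) (rho : Gamma -> U -> U) (g : G) : U -> U :=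
  rho (map_mx (@redF _ _ D) g).

Definition Vr_act : Gamma -> polyF -> polyF :=
  poly_act (fun (i : 'I_f) (x : kF D) => iota_kF D x ^+ (p ^ i)).

Definition weight_act (m : nat) (g : Gamma) (v : polyF) : polyF :=
  iota_kF D (\det g) ^+ m *: Vr_act g v.

Definition weight_hecke (s : 'I_f -> nat) (m : nat) :
    (G -> polyF) -> (G -> polyF) -> Prop :=
  hecke (inflate (weight_act m)) (V s)
    (fun l => substXY (@Xv f _)
       (fun i => (- iota_kF D l) ^+ (p ^ i) *: Xv (Fbar D) i))
    (substXY (fun=> 0) (@Yv f _)).

Context (U : lmodType (Fbar D)) (rho : Gamma -> U -> U).

(* A decomposition of W as an internal direct sum of images of weights
   (Sym^{s_0} (x) ... (x) Sym^{s_(f-1)}) (x) det^m, 0 <= s_i <= p - 1. *)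
Record weight_decomposition (W : U -> Prop) := WeightDecomposition {
  wd_size : nat;
  wd_s : 'I_wd_size -> 'I_f -> nat;
  wd_m : 'I_wd_size -> nat;
  wd_map : 'I_wd_size -> polyF -> U;
  wd_s_le : forall j i, (wd_s j i <= p.-1)%N;
  wd_linear : forall j (a : Fbar D) (u v : polyF),
    V (wd_s j) u -> V (wd_s j) v ->
    wd_map j (a *: u + v) = a *: wd_map j u + wd_map j v;
  wd_equivariant : forall j g u, g \in unitmx -> V (wd_s j) u ->
    wd_map j (weight_act (wd_m j) g u) = rho g (wd_map j u);
  wd_in : forall j u, V (wd_s j) u -> W (wd_map j u);
  wd_onto : forall w, W w -> exists2 u : 'I_wd_size -> polyF,
    (forall j, V (wd_s j) (u j)) & w = \sum_j wd_map j (u j);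
  wd_direct : forall u : 'I_wd_size -> polyF, (forall j, V (wd_s j) (u j)) ->
    \sum_j wd_map j (u j) = 0 -> forall j, u j = 0
}.

(* T phi = psi on the induction of the semisimple representation W, T acting
   on the induction of each weight of the decomposition. *)
Definition semisimple_hecke (W : U -> Prop) (dec : weight_decomposition W)
    (phi psi : G -> U) : Prop :=
  exists phi_ psi_ : 'I_(wd_size dec) -> G -> polyF,
    [/\ (forall j, ind (inflate (weight_act (wd_m j))) (V (wd_s j))
                       (phi_ j)),
        (forall j, weight_hecke (wd_s j) (wd_m j) (phi_ j) (psi_ j)),
        (forall g, phi g = \sum_j wd_map j (phi_ j g))
      & (forall g, psi g = \sum_j wd_map j (psi_ j g))].

End Weights.

Section Theta.
Context (p f : nat) (D : padic_data p f) (r : 'I_f -> nat) (ap : E D).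
Local Notation G := 'M[F D]_2.
Local Notation polyE := {mpoly (E D)[(f + f)%N]}.
Local Notation polyF := {mpoly (Fbar D)[(f + f)%N]}.

Definition VE_act : G -> polyE -> polyE :=
  poly_act (fun (i : 'I_f) (x : F D) => (iter i (frob D) x)%:A : E D).

Definition VE_hecke : (G -> polyE) -> (G -> polyE) -> Prop :=
  hecke VE_act (V r)
    (fun l => substXY (@Xv f _)
       (fun i => (- (teich l)%:A) ^+ (p ^ i) *: Xv (E D) i + p%:R *: Yv (E D) i))
    (substXY (fun i => p%:R *: Xv (E D) i) (@Yv f _)).

Definition VO (v : polyE) : Prop :=
  V r v /\ forall m : 'X_{1..(f + f)%N}, integer_of (@vE _ _ D) v@_m.

Definition T_minus_ap (chi : G -> polyE) : Prop :=
  exists phi psi : G -> polyE,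
    [/\ ind VE_act (V r) phi, VE_hecke phi psi & chi = psi - ap *: phi].

(* The quotient of ind V(E) by the image of T - a_p is a subspace of this one. *)
Definition Pi : lmodType (E D) := quot T_minus_ap.

Definition Theta : Pi -> Prop := quot_im (ind VE_act VO).

(* Theta (x) Fbar over the integers of E: free module on symbols << x >> modulo
   the relations of the tensor product.  The type Theta_bar also contains
   spurious free generators << x >> for x not in Theta; the tensor product is
   the span of the elements tensor x c with x in Theta. *)
Definition tensor_relation (u : {freeg Pi / Fbar D}) : Prop :=
  (exists x y, [/\ Theta x, Theta y & u = << x + y >> - << x >> - << y >>]) \/
  (exists (a : E D) (x : Pi),
     [/\ integer_of (@vE _ _ D) a, Theta x
       & u = << a *: x >> - redE a *: << x >>]).

Definition Theta_bar : lmodType (Fbar D) := quot tensor_relation.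

Definition tensor (x : Pi) (c : Fbar D) : Theta_bar :=
  quot_pi tensor_relation (c *: << x >>).

Definition reduce (phi : G -> polyE) : G -> polyF :=
  fun g => map_mpoly (@redE _ _ D) (phi g).

(* Graph of the natural map ind V_r -> Theta_bar, the Fbar-linear extension of
   (phi mod m_E) |-> class of phi, phi in ind V(O_E). *)
Definition nat_Vr (psi : G -> polyF) (t : Theta_bar) : Prop :=
  exists s : seq (Fbar D * (G -> polyE)),
    [/\ (forall x, x \in s -> ind VE_act VO x.2),
        psi = \sum_(x <- s) x.1 *: reduce x.2
      & t = \sum_(x <- s) tensor (quot_pi T_minus_ap x.2) x.1].

Definition Xr : polyF -> Prop :=
  generated_subrep (@Vr_act _ _ D) (\prod_i Xv (Fbar D) i ^+ r i).

Definition Vstar_plus_Xr (v : polyF) : Prop :=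
  exists v1 v2, [/\ Vstar p r v1, Xr v2 & v = v1 + v2].

(* Q is the subspace Qrep of the quotient Qamb of the space of all
   polynomials. *)
Definition Qamb : lmodType (Fbar D) := quot Vstar_plus_Xr.
Definition Q_act : 'M[kF D]_2 -> Qamb -> Qamb :=
  quot_act (S := Vstar_plus_Xr) (@Vr_act _ _ D).
Definition Qrep : Qamb -> Prop := quot_im (S := Vstar_plus_Xr) (V r).

Definition Qsoc (i : nat) : Qamb -> Prop := socle_filtration Q_act Qrep i.

(* Graph of the natural map ind Q -> Theta_bar. *)
Definition nat_Q (phi : G -> Qamb) (t : Theta_bar) : Prop :=
  exists psi : G -> polyF,
    [/\ ind (inflate (@Vr_act _ _ D)) (V r) psi,
        (forall g, phi g = quot_pi Vstar_plus_Xr (psi g))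
      & nat_Vr psi t].

Definition Ffil (i : nat) (t : Theta_bar) : Prop :=
  exists2 phi, ind (inflate Q_act) (Qsoc i) phi & nat_Q phi t.

(* Q_(i+1) / Q_i, inside Qamb / Q_i *)
Definition Qgr_act (i : nat) : 'M[kF D]_2 -> quot (Qsoc i) -> quot (Qsoc i) :=
  quot_act (S := Qsoc i) Q_act.
Definition Qgr (i : nat) : quot (Qsoc i) -> Prop :=
  quot_im (S := Qsoc i) (Qsoc i.+1).

(* Graph of the natural map ind (Q_(i+1) / Q_i) -> F_(i+1) / F_i. *)
Definition nat_gr (i : nat) (phi : G -> quot (Qsoc i)) (y : quot (Ffil i)) :
    Prop :=
  exists (phi' : G -> Qamb) (t : Theta_bar),
    [/\ ind (inflate Q_act) (Qsoc i.+1) phi',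
        (forall g, phi g = quot_pi (Qsoc i) (phi' g)),
        nat_Q phi' t
      & y = quot_pi (Ffil i) t].

End Theta.

Arguments Qsoc {p f} D r i _.
Arguments Qgr_act {p f} D r i _ _.
Arguments Qgr {p f} D r i _.
Arguments Ffil {p f} D r ap i _.
Arguments nat_gr {p f} D r ap i _ _.

(* Main.v *)
Require Import Defs.
From mathcomp Require Import all_boot all_order all_algebra all_field.
From mathcomp Require Import ring_quotient boolp functions freeg mpoly.
From mathcomp Require Import zify ring.

(** Elements of V_r are studied through their values [ev v x y] at X_i = x^(p^i),
    Y_i = y^(p^i), for x, y in F_q: the kernel of [ev] on V_r is V_r^*, and the socle
    filtration of Q becomes the filtration by the spaces H_k of functions that are
    homogeneous of degree a_h p^k in x^eps, y^eps with eps = p^(h+f-k).  Each step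
    is uniserial, because binomial coefficients C(a_h p^k - 1, j) are prime to p.
    In a weight Sym^s (x) det^m inside Q_(f-1)/Q_(f-2), torus weights and unipotent
    invariance force X^s to be a multiple of the class of X^(r - e_(h+1)) Y_(h+1),
    and every X^(s-b) Y^b to be one monomial of H_(f-1), say of index t + 1.

    Put A = a_h p^(f-1), [k_l] = (1 [l]; 0 1), alpha = (1 0; 0 p),
    P = sum_l [l]^(eps (q - A + t)) prod_i ([l]^(p^i) X_i + Y_i)^(r_i) and
    Delta = Y^r - X_h^(q-1) Y_h^(r_h-q+1) prod_(i <> h) Y_i^(r_i).  The function
      [g, P / p] + sum_l (a_p / p) [l]^(eps (q - A + t)) [g k_l alpha^-1, Delta]
    has an integral image under T - a_p as v(a_p) > 1/2, and modulo Q_(f-2) the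
    reduction of this image is, up to the unit r_(h+1), the image under T of
    [g, X^(s-b) Y^b].  So T of the weight has a lift with zero image in the
    reduction of Theta. *)

Set Implicit Arguments.
Unset Strict Implicit.
Unset Printing Implicit Defensive.

Import Order.TTheory GRing.Theory Num.Theory.
Local Open Scope ring_scope.

(** * Digits, binomial coefficients and power sums *)

Section Digits.
Local Open Scope nat_scope.

(** What shapes the construction is that a_p / p is not integral. Since P is the sum of the [l]^m
    k_l Y^r, with m the exponent of [l], the term a_p [g, P / p] is a combination of the
    [g k_l, Y^r] with coefficients (a_p / p) [l]^m; it has to be cancelled, not bounded. Each such
    bracket is the alpha-term of T [g k_l alpha^-1, Y^r]. Taking Delta in place of Y^r changes this
    alpha-term only by a multiple of p^(q-1) and makes the other terms of T divisible by p, because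
    L^q - X_h^(q-1) L is divisible by p when L = s X_h + p Y_h with s^q = s modulo p. What remains
    is a_p (a_p / p) Delta. The exponent m is tuned so that, in the other terms of T [g, P / p], the
    sum over l turns order zero in p into a multiple of C(A, t + 1), divisible by p as p divides A
    but not t + 1, and order one at i = h + 1 into a multiple of r_(h+1) C(A - 1, t), a unit. The
    remaining terms of order one have level f - 2, except i = h when a_h = 1, and there p | r_h
    makes the term vanish. *)

Lemma sum_digits_lt p n (b : nat -> nat) : (forall i, i < n -> b i < p) ->
  \sum_(i < n) b i * p ^ i < p ^ n.
Proof.
elim: n => [|n IHn] hb; first by rewrite big_ord0.
rewrite big_ord_recr /= expnS.
have h1 := IHn (fun i hi => hb i (ltnW hi)).
apply: (@leq_trans ((b n).+1 * p ^ n)); last by rewrite leq_mul2r hb ?orbT.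
by rewrite mulSn ltn_add2r.
Qed.

Lemma sum_digits_inj p n (b c : nat -> nat) :
  (forall i, i < n -> b i < p) -> (forall i, i < n -> c i < p) ->
  \sum_(i < n) b i * p ^ i = \sum_(i < n) c i * p ^ i ->
  forall i, i < n -> b i = c i.
Proof.
elim: n => [|n IHn] hb hc //; rewrite !big_ord_recr /= => e i hi.
have hb' j : j < n -> b j < p by move=> hj; apply: hb; lia.
have hc' j : j < n -> c j < p by move=> hj; apply: hc; lia.
have lb := sum_digits_lt hb'; have lc := sum_digits_lt hc'.
have ebc : b n = c n.
  have aux s d : s < p ^ n -> (s + d * p ^ n) %/ p ^ n = d.
    by move=> hs; rewrite addnC divnMDl ?(leq_ltn_trans _ hs) // divn_small // addn0.
  by rewrite -(aux _ (b n) lb) e aux.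
move: e; rewrite ebc => /addIn /(IHn hb' hc') es.
by move: hi; rewrite ltnS leq_eqVlt => /orP[/eqP -> //|]; exact: es.
Qed.

(** If i has valuation below n, so does the difference, with the same value. Otherwise i / p^n and a
    - i / p^n both lie strictly between 0 and p, and both valuations are n. *)
Lemma logn_subl p a n i : prime p -> a < p -> 0 < i < a * p ^ n ->
  logn p (a * p ^ n - i) = logn p i.
Proof.
move=> pp lap /andP[i0 ilt].
have p0 := prime_gt0 pp.
have [l [i' ndv ei]] : exists l, exists2 i', ~~ (p %| i') & i = i' * p ^ l.
  have [m cm e] := pfactor_coprime pp i0.
  by exists (logn p i), m => //; rewrite -prime_coprime.
rewrite ei in i0 ilt *.
have i'0 : 0 < i' by case: (posnP i') i0 => [->|//]; rewrite mul0n.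
case: (ltnP l n) => hl.
  have -> : a * p ^ n - i' * p ^ l = (a * p ^ (n - l) - i') * p ^ l.
    by rewrite mulnBl -mulnA -expnD subnK // ltnW.
  have lt' : i' < a * p ^ (n - l).
    move: ilt; rewrite -{1}(subnK (ltnW hl)) expnD mulnA.
    by rewrite ltn_pmul2r // expn_gt0 p0.
  rewrite !lognM ?expn_gt0 ?p0 //; last by rewrite subn_gt0.
  have lg0 m : ~~ (p %| m) -> logn p m = 0.
    by move=> h; rewrite lognE (negPf h) !andbF.
  congr (_ + _); rewrite !lg0 // (dvdn_subr (ltnW lt')) //.
  by rewrite dvdn_mull // dvdn_exp // subn_gt0.
have e : p ^ l = p ^ (l - n) * p ^ n by rewrite -expnD subnK.
have lt1 : i' * p ^ (l - n) < a.
  by move: ilt; rewrite e mulnA ltn_pmul2r // expn_gt0 p0.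
have pl : 0 < p ^ (l - n) by rewrite expn_gt0 p0.
have -> : a * p ^ n - i' * p ^ l = (a - i' * p ^ (l - n)) * p ^ n.
  by rewrite mulnBl e mulnA.
rewrite e mulnA.
have aux m : 0 < m -> m < p -> logn p (m * p ^ n) = n.
  move=> m0 mp; rewrite lognM ?expn_gt0 ?p0 // pfactorK // lognE pp m0 /=.
  by case: ifP => // /dvdn_leq; rewrite m0 => /(_ isT); lia.
by rewrite !aux //; nia.
Qed.

(** Consecutive coefficients have ratio (a p^n - (u + 1)) / (u + 1), of valuation 0 by
    [logn_subl]. *)
Lemma prime_ndvd_bin p a n u : prime p -> a < p -> u < a * p ^ n ->
  ~~ (p %| 'C((a * p ^ n).-1, u)).
Proof.
move=> pp lap; elim: u => [|u IHu] hu.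
  by rewrite bin0 dvdn1; case: eqP pp => // ->.
have {}IHu := IHu (ltnW hu).
have A0 : 0 < a * p ^ n by lia.
have bp : forall v, v < a * p ^ n -> 0 < 'C((a * p ^ n).-1, v).
  by move=> v hv; rewrite bin_gt0; lia.
have := mul_bin_left (a * p ^ n).-1 u.
have -> : (a * p ^ n).-1 - u = a * p ^ n - u.+1 by lia.
move=> /(congr1 (logn p)).
rewrite lognM ?bp // lognM ?subn_gt0 ?bp //; last exact: ltnW.
rewrite logn_subl // => /eqP; rewrite eqn_add2l => /eqP e.
rewrite -(expn1 p) pfactor_dvdn ?bp // e -pfactor_dvdn ?bp ?expn1 //.
exact: ltnW.
Qed.

(** From u C(A, u) = A C(A - 1, u - 1). *)
Lemma prime_dvd_bin_pred p A u : prime p -> p %| A -> ~~ (p %| u) ->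
  p %| 'C(A, u).
Proof.
move=> pp pA pu; case: u pu => [|u pu]; first by rewrite dvdn0.
case: A pA => [|A] pA; first by rewrite bin0n.
have := mul_bin_diag A.+1 u; rewrite /= => e.
have : p %| u.+1 * 'C(A.+1, u.+1) by rewrite -e dvdn_mulr.
by rewrite Euclid_dvdM // (negPf pu).
Qed.

End Digits.

Section PowerSums.
Context (K : finFieldType) (L : fieldType) (iota : {rmorphism K -> L}).
Local Notation q1 := #|K|.-1.

Lemma card_pred_gt0 : (0 < q1)%N.
Proof. by have := finNzRing_gt1 K; case: #|K| => [|[]]. Qed.

Lemma expf_card_pred (x : K) : x != 0 -> x ^+ q1 = 1.
Proof.
move=> x0; apply: (mulfI x0); rewrite mulr1 -exprS prednK ?expf_card //.
exact: ltnW (finNzRing_gt1 K).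
Qed.

Lemma iota_exp_modn (x : K) m n : (0 < m)%N -> (0 < n)%N ->
  m = n %[mod q1] -> iota x ^+ m = iota x ^+ n.
Proof.
move=> m0 n0 e; have [->|x0] := eqVneq x 0.
  by case: m n m0 n0 {e} => [|m] [|n] // _ _; rewrite rmorph0 !expr0n.
have ix : iota x ^+ q1 = 1 by rewrite -rmorphXn /= expf_card_pred // rmorph1.
by rewrite (divn_eq m q1) (divn_eq n q1) !exprD ![(_ * q1)%N]mulnC !exprM ix !expr1n e.
Qed.

(** With s the residue of n - m modulo q - 1, the polynomial X^s - 1 vanishes at all q - 1 units,
    which exceeds its degree unless s = 0. *)
Lemma exp_eq_modn m n : (forall x : K, x != 0 -> iota x ^+ m = iota x ^+ n) ->
  m = n %[mod q1].
Proof.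
wlog le : m n / (m <= n)%N => [hw h|h].
  by case: (leqP m n) => [/hw|/ltnW/hw e]; [exact|rewrite e // => x /h].
have h' (x : K) : x != 0 -> x ^+ ((n - m) %% q1) = 1.
  move=> x0; have := h x x0; rewrite -!rmorphXn /= => /fmorph_inj e.
  have : x ^+ (n - m) = 1.
    apply: (mulfI (expf_neq0 m x0)); rewrite mulr1 -exprD subnKC //.
  by rewrite {1}(divn_eq (n - m) q1) exprD mulnC exprM expf_card_pred // expr1n mul1r.
suff d : (q1 %| n - m)%N by apply/eqP; rewrite eq_sym eqn_mod_dvd.
rewrite /dvdn; case: posnP => // s0.
have sq : ((n - m) %% q1 < q1)%N by rewrite ltn_mod card_pred_gt0.
set s := ((n - m) %% q1)%N in h' s0 sq.
have P0 : ('X^s - 1 : {poly K}) != 0.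
  by rewrite -size_poly_gt0 size_XnsubC.
have /(max_poly_roots P0) : all (root ('X^s - 1 : {poly K})) (enum (predC1 (0 : K))).
  apply/allP => x; rewrite mem_enum => x0.
  by rewrite /root !hornerE h' // subrr.
rewrite enum_uniq size_XnsubC // => /(_ isT); rewrite -cardE cardC1.
by rewrite ltnS leqNgt sq.
Qed.

(** As n > 0, the term at 0 vanishes. If q - 1 divides n, what is left is q - 1 = -1; otherwise the
    sum is fixed by multiplication with some c^n different from 1. *)
Lemma iota_powsum n : (0 < n)%N ->
  \sum_(x : K) iota x ^+ n = - (q1 %| n)%:R.
Proof.
move=> n0; case: (boolP (q1 %| n)%N) => d /=.
  rewrite (bigD1 0) //= rmorph0 expr0n -[_ == _]negbK -lt0n n0 /= add0r.
  rewrite (eq_bigr (fun=> 1)); last first.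
    move=> x x0; rewrite -(divnK d) mulnC exprM -rmorphXn /= expf_card_pred //.
    by rewrite rmorph1 expr1n.
  have cK : (#|K|%:R : K) = 0.
    have [r pr pc] := finPcharP K.
    have e : #|K| = (r ^ logn r #|K|)%N := card_pprimeChar pc.
    case: (posnP (logn r #|K|)) => l0.
      by have := finNzRing_gt1 K; rewrite e l0.
    by rewrite e -(prednK l0) expnS natrM (pcharf0 pc) mul0r.
  rewrite sumr_const cardC1.
  apply/eqP; rewrite -subr_eq0 opprK -mulrSr prednK; last exact: ltnW (finNzRing_gt1 K).
  by rewrite -(rmorph1 iota) -rmorphMn /= cK rmorph0.
rewrite oppr0.
have [c c0 cn] : exists2 c : K, c != 0 & iota c ^+ n != 1.
  case: (pselect (exists2 c : K, c != 0 & iota c ^+ n != 1)) => // H.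
  have : (n = 0 %[mod q1])%N.
    apply: exp_eq_modn => x x0; rewrite expr0; apply/eqP/negPn/negP => hx.
    by apply: H; exists x.
  by rewrite mod0n => e; move: d; rewrite /dvdn e.
set S := \sum_x _.
have : iota c ^+ n * S = S.
  rewrite /S mulr_sumr [RHS](reindex_inj (mulfI c0)) /=.
  by apply: eq_bigr => x _; rewrite rmorphM exprMn.
move/eqP; rewrite -subr_eq0 -{2}[S]mul1r -mulrBl mulf_eq0 subr_eq0 (negPf cn) /=.
by move/eqP.
Qed.

End PowerSums.

(** * Multihomogeneous polynomials *)

Section MultiHomogeneous.
Context (f : nat) (R : comNzRingType).
Local Notation poly2 := {mpoly R[(f + f)%N]}.
Implicit Types (r s b : 'I_f -> nat) (u v : poly2).

Definition unit_deg (i j : 'I_f) : nat := (j == i)%N.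

Lemma V_ext r s v : r =1 s -> V r v -> V s v.
Proof. by move=> e h m hm i; rewrite -e; exact: h. Qed.

Lemma V_zero r : V r (0 : poly2).
Proof. by move=> m; rewrite msupp0. Qed.

Lemma V_lin r (a : R) u v : V r u -> V r v -> V r (a *: u + v).
Proof.
move=> hu hv m /msuppD_le; rewrite mem_cat => /orP[/msuppZ_le|]; [exact: hu|exact: hv].
Qed.

Lemma V_add r u v : V r u -> V r v -> V r (u + v).
Proof. by rewrite -{2}[u]scale1r; exact: V_lin. Qed.

Lemma V_scale r (a : R) u : V r u -> V r (a *: u).
Proof. by move=> hu; rewrite -[_ *: _]addr0; apply: V_lin => //; exact: V_zero. Qed.

Lemma V_opp r u : V r u -> V r (- u).
Proof. by rewrite -scaleN1r; exact: V_scale. Qed.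

Lemma V_sub r u v : V r u -> V r v -> V r (u - v).
Proof. by move=> hu hv; apply: V_add => //; exact: V_opp. Qed.

Lemma V_sum r (I : Type) (s : seq I) (P : pred I) (F : I -> poly2) :
  (forall i, P i -> V r (F i)) -> V r (\sum_(i <- s | P i) F i).
Proof.
by move=> h; apply: (big_ind (V r)); [exact: V_zero|exact: V_add|exact: h].
Qed.

Lemma V_mul r s u v : V r u -> V s v -> V (fun i => r i + s i)%N (u * v).
Proof.
move=> hu hv m /msuppM_le /allpairsP[[m1 m2] /= [h1 h2 ->]] i.
by rewrite !mnmDE -(hu _ h1 i) -(hv _ h2 i); lia.
Qed.

Lemma V_one : V (fun=> 0%N) (1 : poly2).
Proof. by move=> m; rewrite msupp1 inE => /eqP -> i; rewrite !mnm0E. Qed.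

Lemma V_exp r u n : V r u -> V (fun i => n * r i)%N (u ^+ n).
Proof.
move=> hu; elim: n => [|n IHn]; first by apply: V_ext V_one.
by rewrite exprS; apply: V_ext (V_mul hu IHn) => i; rewrite mulSn.
Qed.

Lemma V_prod (I : Type) (s : seq I) (d : I -> 'I_f -> nat) (F : I -> poly2) :
  (forall i, V (d i) (F i)) ->
  V (fun j => \sum_(i <- s) d i j)%N (\prod_(i <- s) F i).
Proof.
move=> h; elim: s => [|i s IHs].
  by rewrite big_nil; apply: V_ext V_one => j; rewrite big_nil.
by rewrite big_cons; apply: V_ext (V_mul (h i) IHs) => j; rewrite big_cons.
Qed.

Lemma V_Xv i : V (unit_deg i) (Xv R i).
Proof.
move=> m; rewrite msuppX inE => /eqP -> j; rewrite !mnm1E /unit_deg.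
by rewrite (inj_eq (@lshift_inj _ _)) eq_lrshift addn0 eq_sym.
Qed.

Lemma V_Yv i : V (unit_deg i) (Yv R i).
Proof.
move=> m; rewrite msuppX inE => /eqP -> j; rewrite !mnm1E /unit_deg.
by rewrite (inj_eq (@rshift_inj _ _)) eq_rlshift add0n eq_sym.
Qed.

Lemma V_linear_form i (a c : R) : V (unit_deg i) (a *: Xv R i + c *: Yv R i).
Proof. by apply: V_lin; [exact: V_Xv|apply: V_scale; exact: V_Yv]. Qed.

(** Exponents are recorded by those of the second form alone: X^r is b = 0 and Y^r is b = r. The
    subtraction is truncated, so homogeneity of degree r asks for b <= r. *)
Definition gmono r b (A B : 'I_f -> poly2) : poly2 :=
  \prod_i (A i ^+ (r i - b i) * B i ^+ b i).
Definition mono r b : poly2 := gmono r b (@Xv f R) (@Yv f R).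

Lemma V_gmono r b A B : (forall i, (b i <= r i)%N) ->
  (forall i, V (unit_deg i) (A i)) -> (forall i, V (unit_deg i) (B i)) ->
  V r (gmono r b A B).
Proof.
move=> le hA hB.
have h i : V (fun j => r i * unit_deg i j)%N (A i ^+ (r i - b i) * B i ^+ b i).
  have := V_mul (V_exp (n := (r i - b i)%N) (hA i)) (V_exp (n := b i) (hB i)).
  apply: V_ext => j.
  by rewrite -mulnDl subnK.
have := V_prod (s := index_enum 'I_f) h; apply: V_ext => j.
rewrite (bigD1 j) //= /unit_deg eqxx muln1 big1 ?addn0 //.
by move=> i /negPf hi; rewrite eq_sym hi muln0.
Qed.

Lemma V_mono r b : (forall i, (b i <= r i)%N) -> V r (mono r b).
Proof. by move=> le; apply: V_gmono => // i; [exact: V_Xv|exact: V_Yv]. Qed.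

Lemma mono_ext r b c : b =1 c -> mono r b = mono r c.
Proof. by move=> e; apply: eq_bigr => i _; rewrite e. Qed.

Lemma V_expand r v : V r v ->
  v = \sum_(m <- msupp v) v@_m *: mono r (fun i => m (rshift f i)).
Proof.
move=> hv; rewrite {1}[v]mpolyE !big_seq; apply: eq_bigr => m hm; congr (_ *: _).
rewrite mpolyXE_id big_split_ord /= -big_split /=; apply: eq_bigr => i _.
by rewrite -(hv m hm i) addnK.
Qed.

Lemma V_ind r (P : poly2 -> Prop) :
  P 0 -> (forall a u v, P u -> P v -> P (a *: u + v)) ->
  (forall b, (forall i, (b i <= r i)%N) -> P (mono r b)) ->
  forall v, V r v -> P v.
Proof.
move=> P0 Pl Pm v hv; rewrite (V_expand hv) big_seq.
apply: (big_ind P) => // [u w hu hw|m hm].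
  by rewrite -[u]scale1r; exact: Pl.
rewrite -[_ *: _]addr0; apply: Pl => //; apply: Pm => i.
by rewrite -(hv m hm i) leq_addl.
Qed.

Section Subst.
Context (PX PY : 'I_f -> poly2).
Local Notation sub := (substXY PX PY).

Lemma substXY_lin (a : R) u v : sub (a *: u + v) = a *: sub u + sub v.
Proof. by rewrite /substXY comp_mpolyD comp_mpolyZ. Qed.

Lemma substXY0 : sub 0 = 0.
Proof. exact: comp_mpoly0. Qed.

Lemma substXYZ (a : R) u : sub (a *: u) = a *: sub u.
Proof. exact: comp_mpolyZ. Qed.

Lemma substXYD u v : sub (u + v) = sub u + sub v.
Proof. exact: comp_mpolyD. Qed.

Lemma substXYB u v : sub (u - v) = sub u - sub v.
Proof. exact: comp_mpolyB. Qed.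

Lemma substXY_sum (I : Type) (s : seq I) (P : pred I) (F : I -> poly2) :
  sub (\sum_(i <- s | P i) F i) = \sum_(i <- s | P i) sub (F i).
Proof. exact: (raddf_sum (comp_mpoly _)). Qed.

Lemma substXYM u v : sub (u * v) = sub u * sub v.
Proof. exact: (rmorphM (comp_mpoly _)). Qed.

Lemma substXY_exp u n : sub (u ^+ n) = sub u ^+ n.
Proof. exact: (rmorphXn (comp_mpoly _)). Qed.

Lemma substXY_prod (I : Type) (s : seq I) (P : pred I) (F : I -> poly2) :
  sub (\prod_(i <- s | P i) F i) = \prod_(i <- s | P i) sub (F i).
Proof. exact: (rmorph_prod (comp_mpoly _)). Qed.

Lemma substXY_Xv i : sub (Xv R i) = PX i.
Proof.
rewrite /substXY /Xv comp_mpolyXU -tnth_nth tnth_mktuple.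
by case: splitP => j e; [congr PX; apply: val_inj|move: e (ltn_ord i) => /= ->; lia].
Qed.

Lemma substXY_Yv i : sub (Yv R i) = PY i.
Proof.
rewrite /substXY /Yv comp_mpolyXU -tnth_nth tnth_mktuple.
case: splitP => j /= e; first by move: (ltn_ord j); rewrite -e; lia.
by congr PY; apply: val_inj => /=; lia.
Qed.

Lemma substXY_gmono r b A B :
  sub (gmono r b A B) = gmono r b (fun i => sub (A i)) (fun i => sub (B i)).
Proof.
by rewrite substXY_prod; apply: eq_bigr => i _; rewrite substXYM !substXY_exp.
Qed.

Lemma substXY_mono r b : sub (mono r b) = gmono r b PX PY.
Proof.
rewrite substXY_gmono; apply: eq_bigr => i _.
by rewrite substXY_Xv substXY_Yv.
Qed.

Lemma V_substXY r v : (forall i, V (unit_deg i) (PX i)) ->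
  (forall i, V (unit_deg i) (PY i)) -> V r v -> V r (sub v).
Proof.
move=> hX hY; move: v; apply: V_ind; first by rewrite substXY0; exact: V_zero.
  by move=> a u v hu hv; rewrite substXY_lin; exact: V_lin.
by move=> b hb; rewrite substXY_mono; exact: V_gmono.
Qed.

Lemma substXYE v : sub v =
  \sum_(m <- msupp v)
     v@_m *: \prod_i (PX i ^+ m (lshift f i) * PY i ^+ m (rshift f i)).
Proof.
rewrite {1}[v]mpolyE substXY_sum; apply: eq_bigr => m _; rewrite substXYZ.
congr (_ *: _); rewrite mpolyXE_id big_split_ord /= -big_split /= substXY_prod.
by apply: eq_bigr => i _; rewrite substXYM !substXY_exp substXY_Xv substXY_Yv.
Qed.

End Subst.

Lemma eq_substXY PX PY QX QY v : PX =1 QX -> PY =1 QY ->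
  substXY PX PY v = substXY QX QY v.
Proof.
move=> eX eY; rewrite !substXYE; apply: eq_bigr => m _; congr (_ *: _).
by apply: eq_bigr => i _; rewrite eX eY.
Qed.

Lemma substXY_comp PX PY QX QY v : substXY PX PY (substXY QX QY v) =
  substXY (fun i => substXY PX PY (QX i)) (fun i => substXY PX PY (QY i)) v.
Proof.
rewrite (substXYE QX) substXY_sum substXYE; apply: eq_bigr => m _.
rewrite substXYZ substXY_prod; congr (_ *: _); apply: eq_bigr => i _.
by rewrite substXYM !substXY_exp.
Qed.

Section Action.
Context (L : pzRingType) (e : 'I_f -> L -> R).
Implicit Types (g : 'M[L]_2).

Lemma V_poly_act r g v : V r v -> V r (poly_act e g v).
Proof. by apply: V_substXY => i; exact: V_linear_form. Qed.

(* Only the entries of g1 and g2 matter, so that e may be a residue map. *)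
Lemma poly_actM g1 g2 v :
  (forall i j l, e i ((g1 *m g2) j l) =
     e i (g1 j 0) * e i (g2 0 l) + e i (g1 j 1) * e i (g2 1 l)) ->
  poly_act e (g1 *m g2) v = poly_act e g1 (poly_act e g2 v).
Proof.
move=> he; rewrite /poly_act substXY_comp; apply: eq_substXY => i;
  by rewrite substXYD !substXYZ substXY_Xv substXY_Yv !he !scalerDr !scalerDl
    !scalerA addrACA ![e i (g2 _ _) * _]mulrC.
Qed.

End Action.
End MultiHomogeneous.

Lemma mulmx2E (L : pzRingType) (g1 g2 : 'M[L]_2) j l :
  (g1 *m g2) j l = g1 j 0 * g2 0 l + g1 j 1 * g2 1 l.
Proof. by rewrite mxE big_ord_recl big_ord1; congr (_ + g1 _ _ * g2 _ _); apply: val_inj. Qed.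

(** * Evaluation at the points of F_q *)

Section Evaluation.
Context (p f : nat) (K : finFieldType) (L : fieldType).
Context (iota : {rmorphism K -> L}).
Local Notation poly2 := {mpoly L[(f + f)%N]}.
Implicit Types (u v : poly2) (x y : K) (r b : 'I_f -> nat).

(** The exponent of x that the product of the X_i^(b_i) acquires under X_i = x^(p^i). *)
Definition total b : nat := \sum_(i < f) b i * p ^ i.

Definition ev v x y : L :=
  v.@[fun j => match fintype.split j with
               | inl i => iota x ^+ (p ^ i) | inr i => iota y ^+ (p ^ i) end].

Lemma ev_lin (a : L) u v x y : ev (a *: u + v) x y = a * ev u x y + ev v x y.
Proof. by rewrite /ev mevalD mevalZ. Qed.

Lemma ev0 x y : ev 0 x y = 0. Proof. exact: meval0. Qed.

Lemma evD u v x y : ev (u + v) x y = ev u x y + ev v x y.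
Proof. exact: mevalD. Qed.

Lemma evB u v x y : ev (u - v) x y = ev u x y - ev v x y.
Proof. exact: mevalB. Qed.

Lemma evZ a u x y : ev (a *: u) x y = a * ev u x y.
Proof. exact: mevalZ. Qed.

Lemma ev_sum (I : Type) (s : seq I) (P : pred I) (F : I -> poly2) x y :
  ev (\sum_(i <- s | P i) F i) x y = \sum_(i <- s | P i) ev (F i) x y.
Proof. exact: (raddf_sum (meval _)). Qed.

Lemma evM u v x y : ev (u * v) x y = ev u x y * ev v x y.
Proof. exact: mevalM. Qed.

Lemma evX u n x y : ev (u ^+ n) x y = ev u x y ^+ n.
Proof. exact: (rmorphXn (meval _)). Qed.

Lemma ev_Xv i x y : ev (Xv L i) x y = iota x ^+ (p ^ i).
Proof.
rewrite /ev /Xv mevalXU; case: splitP => j /= e.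
  by rewrite e.
by move: (ltn_ord i); rewrite e; lia.
Qed.

Lemma ev_Yv i x y : ev (Yv L i) x y = iota y ^+ (p ^ i).
Proof.
rewrite /ev /Yv mevalXU; case: splitP => j /= e.
  by move: (ltn_ord j); rewrite -e; lia.
by have -> : i = j :> nat by lia.
Qed.

Lemma ev_mono r b x y : (forall i, (b i <= r i)%N) ->
  ev (mono _ r b) x y = iota x ^+ (total r - total b) * iota y ^+ total b.
Proof.
move=> le; have -> : (total r - total b = total (fun i => r i - b i)%N)%N.
  rewrite /total -sumnB; last by move=> i _; rewrite leq_mul.
  by apply: eq_bigr => i _; rewrite mulnBl.
rewrite [LHS](rmorph_prod (meval _)) /total !expr_sum -big_split /=.
apply: eq_bigr => i _; rewrite -/(ev _ x y) evM !evX ev_Xv ev_Yv.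
by rewrite -!exprM ![(p ^ i * _)%N]mulnC.
Qed.

Context (pcharL : p \in [pchar L]).

Lemma exprD_pchar n (a b : L) : (a + b) ^+ (p ^ n) = a ^+ (p ^ n) + b ^+ (p ^ n).
Proof.
elim: n => [|n IHn]; first by rewrite !expr1.
by rewrite expnSr !exprM IHn -!(pFrobenius_autE pcharL) rmorphD.
Qed.

Definition twist (i : 'I_f) (x : K) : L := iota x ^+ (p ^ i).

(** The p^i-twist of the entries of g matches the substitution X_i = x^(p^i) because the p^i-th
    power is additive. On functions the action is thus an ordinary linear change of (x, y), the same
    for all i. *)
Lemma ev_act (g : 'M[K]_2) v x y : ev (poly_act twist g v) x y =
  ev v (g 0 0 * x + g 1 0 * y) (g 0 1 * x + g 1 1 * y).
Proof.
rewrite /ev /poly_act /substXY comp_mpoly_meval; apply: meval_eq => j.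
rewrite tnth_mktuple; case: splitP => i e; rewrite -/(ev _ x y) evD !evZ ev_Xv ev_Yv
  /twist -!exprMn -!rmorphM -exprD_pchar -rmorphD //.
Qed.

End Evaluation.

Section CyclicOrdinals.
Context (f : nat).
Implicit Types i j : 'I_f.

Lemma val_ord_pred i : (ord_pred i : nat) = if i == 0%N :> nat then f.-1 else i.-1.
Proof.
have fi := ltn_ord i; case: eqP => e /=.
  by rewrite e add0n modn_small // prednK //; lia.
have -> : (i + f).-1 = (i.-1 + f)%N by lia.
by rewrite modnDr modn_small //; lia.
Qed.

Lemma ord_pred_neq i : (2 <= f)%N -> ord_pred i != i.
Proof.
move=> f2; apply/eqP => /(congr1 (@nat_of_ord f)); rewrite val_ord_pred.
by have := ltn_ord i; case: eqP => /=; lia.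
Qed.

(** Go down from i to 0, wrap around to f - 1, and go down again. *)
Lemma ord_pred_closed (P : 'I_f -> Prop) i :
  P i -> (forall j, P j -> P (ord_pred j)) -> forall j, P j.
Proof.
move=> Pi Pp j.
have down (k l : 'I_f) : (k <= l)%N -> P l -> P k.
  move=> le Pl; have [m hm] : exists m, m = (l - k)%N by exists (l - k)%N.
  elim: m l le Pl hm => [|m IHm] l le Pl hm.
    by have <- : l = k by apply: val_inj => /=; lia.
  have e : (ord_pred l : nat) = l.-1.
    by rewrite val_ord_pred; case: eqP => // ?; lia.
  by apply: (IHm (ord_pred l)); rewrite ?e; [lia|exact: Pp|lia].
case: (leqP j i) => [le|lt]; first exact: down le Pi.
have f0 : (0 < f)%N by have := ltn_ord i; lia.
have P0 : P (Ordinal f0) by apply: down Pi; exact: leq0n.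
apply: (down _ (ord_pred (Ordinal f0))); last exact: Pp.
by rewrite val_ord_pred /=; have := ltn_ord j; lia.
Qed.

End CyclicOrdinals.

(** * Polynomials vanishing on the points of F_q *)

Section Kernel.
Context (p f : nat) (K : finFieldType) (L : fieldType).
Context (iota : {rmorphism K -> L}) (pcharL : p \in [pchar L]).
Context (cardK : #|K| = (p ^ f)%N) (f2 : (2 <= f)%N).
Context (r : 'I_f -> nat) (hr : forall i, (p ^ f <= r i)%N).
Local Notation poly2 := {mpoly L[(f + f)%N]}.
Local Notation ev := (@ev p f K L iota).
Local Notation total := (@total p f).
Local Notation mono := (mono L r).
Implicit Types (u v : poly2) (x y : K) (b c : 'I_f -> nat).

Let pp : prime p := pcharf_prime pcharL.
Let p0 : (0 < p)%N := prime_gt0 pp.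

Lemma iota_card x : iota x ^+ (p ^ f) = iota x.
Proof. by rewrite -rmorphXn -cardK expf_card. Qed.

Lemma exp_ord_pred x (i : 'I_f) : iota x ^+ (p ^ (ord_pred i)) ^+ p = iota x ^+ (p ^ i).
Proof.
rewrite -exprM -expnSr val_ord_pred; case: eqP => [->|e].
  by rewrite prednK ?iota_card //; lia.
by rewrite prednK //; lia.
Qed.

Lemma ev_theta i x y : ev (theta L p i) x y = 0.
Proof.
by rewrite /theta evB !evM !evX !ev_Xv !ev_Yv !exp_ord_pred mulrC subrr.
Qed.

Lemma p_le_r i : (p <= r i)%N.
Proof. by apply: leq_trans (hr i); rewrite -{1}(expn1 p) leq_pexp2l //; lia. Qed.

Definition theta_comb v := exists P : 'I_f -> poly2, v = \sum_i theta L p i * P i.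

Lemma theta_comb0 : theta_comb 0.
Proof. by exists (fun=> 0); rewrite big1 // => i _; rewrite mulr0. Qed.

Lemma theta_comb_lin a u v : theta_comb u -> theta_comb v -> theta_comb (a *: u + v).
Proof.
move=> [P ->] [Q ->]; exists (fun i => a *: P i + Q i).
by rewrite scaler_sumr -big_split; apply: eq_bigr => i _; rewrite mulrDr scalerAr.
Qed.

(** A carry in base p: modulo theta_i, the product X_i Y_(i-1)^p may be traded for Y_i X_(i-1)^p,
    which moves p units of digit i - 1 of b to one unit of digit i. *)
Lemma mono_carry b i : (forall i, (b i <= r i)%N) ->
  (p <= b (ord_pred i))%N -> (b i < r i)%N ->
  theta_comb (mono b - mono (fun l => if l == i then (b i).+1 else
                 if l == ord_pred i then b (ord_pred i) - p else b l)%N).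
Proof.
set j := ord_pred i => le hj hi; set c := fun l => _.
have ji : j != i by exact: ord_pred_neq.
set W := \prod_(l < f | (l != i) && (l != j))
   (Xv L l ^+ (r l - b l) * Yv L l ^+ b l).
set M := Xv L i ^+ (r i - b i).-1 * Yv L i ^+ b i * (Xv L j ^+ (r j - b j) *
  Yv L j ^+ (b j - p)) * W.
exists (fun l => if l == i then M else 0).
rewrite [RHS](bigD1 i) //= eqxx [X in _ = _ + X]big1 ?addr0; last first.
  by move=> l /negPf ->; rewrite mulr0.
have split2 d : mono d = Xv L i ^+ (r i - d i) * Yv L i ^+ d i *
    (Xv L j ^+ (r j - d j) * Yv L j ^+ d j *
     \prod_(l < f | (l != i) && (l != j)) (Xv L l ^+ (r l - d l) * Yv L l ^+ d l)).
  by rewrite /mono /gmono (bigD1 i) //= (bigD1 j).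
rewrite !split2 -/W.
have -> : \prod_(l < f | (l != i) && (l != j))
   (Xv L l ^+ (r l - c l) * Yv L l ^+ c l) = W.
  by apply: eq_bigr => l /andP[/negPf h1 /negPf h2]; rewrite /c h1 h2.
rewrite /c eqxx (negPf ji) eqxx /theta -/j /M.
have e0 : (r i - b i)%N = (r i - b i).-1.+1 by lia.
have -> : (r i - (b i).+1)%N = (r i - b i).-1 by lia.
have e1 : b j = ((b j - p) + p)%N by lia.
have -> : (r j - (b j - p))%N = ((r j - b j) + p)%N by have := le j; lia.
rewrite {1}e0 (exprS _ (b i)) [X in X * Yv L i ^+ b i * _ - _]exprS.
rewrite (exprD (Xv L j)) -{2}(subnK hj) (exprD (Yv L j)).
move: (Xv L i ^+ _) (Yv L i ^+ _) (Xv L j ^+ (_ - _)) (Yv L j ^+ (_ - _)) => x1 x2 x3 x4.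
by ring.
Qed.

(** A carry lowers the sum of the b_i by p - 1, so carrying stops. When none applies and some b_i <
    r_i, then b_(i-1) < p <= r_(i-1), and this propagates around the whole cycle; otherwise b =
    r. *)
Lemma mono_normal b : (forall i, (b i <= r i)%N) ->
  exists c, [/\ (forall i, (c i < p)%N) \/ c =1 r, (forall i, (c i <= r i)%N)
    & theta_comb (mono b - mono c)].
Proof.
have [n] := ubnP (\sum_i b i)%N; elim: n b => // n IHn b hn le.
case: (pselect (exists i, (p <= b (ord_pred i))%N /\ (b i < r i)%N)) => [[i [hj hi]]|H].
  have := mono_carry le hj hi; set c := fun l => _ => hc.
  have lec l : (c l <= r l)%N.
    by rewrite /c; case: ifP => [/eqP -> //|_]; case: ifP => [/eqP ->|_]; have := le l;
      have := le (ord_pred i); lia.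
  have ji := ord_pred_neq i f2.
  have lts : (\sum_i c i < n)%N.
    have sumE (d : 'I_f -> nat) : (\sum_l d l = d i + (d (ord_pred i) +
        \sum_(l < f | (l != i) && (l != ord_pred i)) d l))%N.
      by rewrite (bigD1 i) //= (bigD1 (ord_pred i)).
    move: hn; rewrite !sumE.
    have -> : (\sum_(l < f | (l != i) && (l != ord_pred i)) c l =
               \sum_(l < f | (l != i) && (l != ord_pred i)) b l)%N.
      by apply: eq_bigr => l /andP[/negPf h1 /negPf h2]; rewrite /c h1 h2.
    rewrite /c eqxx (negPf ji) eqxx.
    by have := prime_gt1 pp; move: hj; lia.
  have [d [h1 h2 h3]] := IHn _ lts lec; exists d; split=> //.
  have -> : mono b - mono d = 1 *: (mono b - mono c) + (mono c - mono d).
    by rewrite scale1r addrA subrK.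
  exact: theta_comb_lin.
exists b; split=> //; last by rewrite subrr; exact: theta_comb0.
case: (pselect (exists i, b i < r i)%N) => [[i hi]|H']; last first.
  by right=> i; apply/eqP; rewrite eqn_leq le leqNgt; apply/negP => hi; apply: H'; exists i.
left; apply: (@ord_pred_closed _ (fun i => b i < p)%N (ord_pred i)) => [|j hj].
  by rewrite ltnNge; apply/negP => h; apply: H; exists i.
rewrite ltnNge; apply/negP => h; apply: H; exists j; split=> //.
exact: leq_trans hj (p_le_r j).
Qed.

Lemma total_le b c : (forall i, (b i <= c i)%N) -> (total b <= total c)%N.
Proof. by move=> h; apply: leq_sum => i _; rewrite leq_mul. Qed.

Lemma total_digits_lt (d : {ffun 'I_f -> 'I_p}) : (total (fun i => d i) < p ^ f)%N.
Proof.
have := @sum_digits_lt p f (fun i => if insub i is Some j then d j else 0%N).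
rewrite (eq_bigr (fun i : 'I_f => d i * p ^ i)%N); last by move=> i _; rewrite valK.
by apply=> i hi; case: insubP => [j _ _|_]; [exact: ltn_ord|].
Qed.

Lemma total_digits_inj (d e : {ffun 'I_f -> 'I_p}) :
  total (fun i => d i) = total (fun i => e i) -> d = e.
Proof.
pose ext (g : {ffun 'I_f -> 'I_p}) i : nat := if insub i is Some j then g j else 0%N.
have tE (g : {ffun 'I_f -> 'I_p}) : total (fun i => g i) = (\sum_(i < f) ext g i * p ^ i)%N.
  by apply: eq_bigr => i _; rewrite /ext valK.
have := @sum_digits_inj p f (ext d) (ext e); rewrite !tE /ext.
move=> H he; apply/ffunP => i; apply: val_inj.
have := H _ _ he i (ltn_ord i); rewrite valK; apply=> j hj.
  by case: insubP => [l _ _|_]; [exact: ltn_ord|].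
by case: insubP => [l _ _|_]; [exact: ltn_ord|].
Qed.

Lemma card_le_total : (p ^ f <= total r)%N.
Proof.
have f0 : (0 < f)%N by lia.
rewrite /total (bigD1 (Ordinal f0)) //= expn0 muln1.
exact: leq_trans (hr _) (leq_addr _ _).
Qed.

Lemma V_normal v : V r v ->
  exists (C : {ffun 'I_f -> 'I_p} -> L) (Cinf : L),
    theta_comb (v - (\sum_d C d *: mono (fun i => d i) + Cinf *: mono r)).
Proof.
move: v; apply: V_ind.
- exists (fun=> 0), 0; rewrite big1 ?scale0r ?addr0 ?subr0; first exact: theta_comb0.
  by move=> d _; rewrite scale0r.
- move=> a u v [C [Ci hC]] [C' [Ci' hC']].
  exists (fun d => a * C d + C' d), (a * Ci + Ci').
  have := theta_comb_lin a hC hC'; congr (theta_comb _).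
  have -> : \sum_d (a * C d + C' d) *: mono (fun i => d i) =
    a *: (\sum_d C d *: mono (fun i => d i)) + \sum_d C' d *: mono (fun i => d i).
    rewrite scaler_sumr -big_split; apply: eq_bigr => d _.
    by rewrite scalerDl scalerA.
  rewrite scalerDl -scalerA !scalerBr !scalerDr.
  move: (\sum_d _) (\sum_d _) (a *: u) (Ci *: _) (Ci' *: _) => s1 s2 u' s3 s4.
  by rewrite -!mul_mpolyC; ring.
- move=> b hb; have [c [hc hle ht]] := mono_normal hb.
  case: hc => hc.
    pose d : {ffun 'I_f -> 'I_p} := [ffun i => Ordinal (hc i)].
    exists (fun e => (e == d)%:R), 0.
    rewrite (bigD1 d) //= eqxx scale1r scale0r addr0 big1 ?addr0.
      by rewrite (@mono_ext _ _ r (fun i => d i) c) // => i; rewrite ffunE.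
    by move=> e /negPf ->; rewrite scale0r.
  exists (fun=> 0), 1; rewrite big1 ?add0r ?scale1r.
    by rewrite -(mono_ext L r hc).
  by move=> d _; rewrite scale0r.
Qed.

Lemma ev_theta_comb v x y : theta_comb v -> ev v x y = 0.
Proof.
move=> [P ->]; rewrite ev_sum big1 // => i _; by rewrite evM ev_theta mul0r.
Qed.

Lemma poly_eq0_roots n (P : {poly L}) : (size P <= p ^ f)%N ->
  (forall y, P.[iota y ^+ (p ^ n)] = 0) -> P = 0.
Proof.
move=> sP hP; apply/eqP/negPn/negP => P0.
have inj : injective (fun y => iota y ^+ (p ^ n)).
  move=> y z /eqP; rewrite -subr_eq0.
  have -> : iota y ^+ (p ^ n) - iota z ^+ (p ^ n) = (iota y - iota z) ^+ (p ^ n).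
    apply/eqP; rewrite -(inj_eq (addIr (iota z ^+ (p ^ n)))) -(exprD_pchar pcharL).
    by rewrite !subrK.
  by rewrite expf_eq0 subr_eq0 => /andP[_ /eqP /fmorph_inj].
have := @max_poly_roots _ P [seq iota y ^+ (p ^ n) | y <- enum K] P0.
rewrite size_map -cardE cardK ltnNge sP => h; apply: notF; apply: h.
  by apply/allP => _ /mapP[y _ ->]; apply/rootP.
by rewrite map_inj_uniq ?enum_uniq.
Qed.

(** Modulo the theta_i, v is a combination of Y^r and of monomials with digits b_i < p, whose
    y-exponents are distinct and below q. As total r >= q, only Y^r survives at (0, 1), so its
    coefficient is 0; at x = 1 the rest is a polynomial in y of degree below q with q roots. *)
Lemma ev_kernel v : V r v -> (forall x y, ev v x y = 0) -> Vstar p r v.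
Proof.
move=> hv ev0; split=> //; have [C [Ci ht]] := V_normal hv.
set w := \sum_d _ + _ in ht.
have hle (d : {ffun 'I_f -> 'I_p}) i : (d i <= r i)%N.
  exact: leq_trans (ltnW (ltn_ord _)) (p_le_r i).
have evw x y : \sum_d C d * (iota x ^+ (total r - total (fun i => d i)) *
      iota y ^+ total (fun i => d i)) + Ci * iota y ^+ total r = 0.
  have := ev_theta_comb x y ht; rewrite evB ev0 sub0r => /eqP.
  rewrite oppr_eq0 => /eqP e; rewrite -[RHS]e /w evD ev_sum evZ ev_mono // subnn mul1r.
  by congr (_ + _); apply: eq_bigr => d _; rewrite evZ ev_mono.
have Ci0 : Ci = 0.
  have := evw 0 1; rewrite rmorph1 expr1n mulr1 big1 ?add0r // => d _.
  rewrite rmorph0 expr0n; case: eqP => [e|_]; last by rewrite mul0r mulr0.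
  by have := leq_trans (total_digits_lt d) card_le_total; rewrite ltnNge -subn_eq0 e.
have P0 : \sum_d C d *: 'X^(total (fun i => d i)) = 0 :> {poly L}.
  apply: (@poly_eq0_roots 0).
    apply: (leq_trans (size_sum _ _ _)); apply/bigmax_leqP => d _.
    by apply: (leq_trans (size_scale_leq _ _)); rewrite size_polyXn total_digits_lt.
  move=> y; have := evw 1 y; rewrite Ci0 mul0r addr0 => <-.
  rewrite horner_sum; apply: eq_bigr => d _.
  by rewrite hornerZ hornerXn rmorph1 expr1n mul1r expn0 expr1.
have C0 d : C d = 0.
  have := congr1 (fun P : {poly L} => P`_(total (fun i => d i))) P0.
  rewrite coef0 coef_sum (bigD1 d) //= coefZ coefXn eqxx mulr1 big1 ?addr0 //.
  move=> e ne; rewrite coefZ coefXn; case: eqP => [h|]; last by rewrite mulr0.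
  by move: ne; rewrite (total_digits_inj h) eqxx.
suff w0 : w = 0 by move: ht; rewrite w0 subr0.
by rewrite /w Ci0 scale0r addr0 big1 // => d _; rewrite C0 scale0r.
Qed.

End Kernel.

Lemma eq_modn_small d i j : (0 < i < d)%N -> (j <= d)%N ->
  (j = i %[mod d])%N -> j = i.
Proof.
case/andP=> i0 id; rewrite leq_eqVlt => /orP[/eqP ->|jd].
  by rewrite modnn modn_small // => e; rewrite -e in i0.
by rewrite !modn_small.
Qed.

Lemma eq_modn_pos d i j : (0 < i <= d)%N -> (0 < j <= d)%N ->
  (j = i %[mod d])%N -> j = i.
Proof.
case/andP=> i0; rewrite leq_eqVlt => /orP[/eqP <-|id] /andP[j0 jd].
  move: jd; rewrite leq_eqVlt => /orP[/eqP //|jd] e.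
  by apply/esym/(@eq_modn_small i) => //; rewrite ?j0.
by apply: eq_modn_small; rewrite ?i0.
Qed.

Definition mat2 (R : pzRingType) (s t u v : R) : 'M[R]_2 :=
  \matrix_(i, j) (if i == 0 then if j == 0 then s else t
                  else if j == 0 then u else v).

Lemma unit_mat2 (R : fieldType) (s t u v : R) : s * v - t * u != 0 -> mat2 s t u v \in unitmx.
Proof.
rewrite unitmxE unitfE (expand_det_row _ 0) !big_ord_recl big_ord0 addr0.
by rewrite /cofactor !det_mx11 !mxE /= expr0 expr1 !mul1r mulN1r mulrN.
Qed.

(** * The levels H_k of homogeneous functions on F_q^2 *)

Record congruent_degrees (p f : nat) (K : finFieldType) (L : fieldType)
    (r : 'I_f -> nat) (a h : nat) : Prop := CongruentDegrees {
  cd_pchar : p \in [pchar L];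
  cd_card : #|K| = (p ^ f)%N;
  cd_f : (2 <= f)%N;
  cd_r : forall i, (p ^ f <= r i)%N;
  cd_h : (h < f)%N;
  cd_a0 : (0 < a)%N;
  cd_ap : (a < p)%N;
  cd_total : (total p r = a * p ^ h %[mod (p ^ f).-1])%N
}.

Section Levels.
Context (p f : nat) (K : finFieldType) (L : fieldType).
Context (iota : {rmorphism K -> L}) (r : 'I_f -> nat) (a h : nat).
Context (H : congruent_degrees p K L r a h).
Local Notation poly2 := {mpoly L[(f + f)%N]}.
Local Notation ev := (@ev p f K L iota).
Local Notation q1 := (p ^ f).-1.
Local Notation act := (poly_act (twist (f := f) p iota)).
Implicit Types (u v : poly2) (x y : K) (F : K -> K -> L) (k : nat).

Let pcharL : p \in [pchar L] := cd_pchar H.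
Let cardK : #|K| = (p ^ f)%N := cd_card H.
Let f2 : (2 <= f)%N := cd_f H.
Let hr : forall i, (p ^ f <= r i)%N := cd_r H.
Let hf : (h < f)%N := cd_h H.
Let a0 : (0 < a)%N := cd_a0 H.
Let ap : (a < p)%N := cd_ap H.
Let rE : (total p r = a * p ^ h %[mod (p ^ f).-1])%N := cd_total H.
Let pp : prime p := pcharf_prime pcharL.
Let p0 : (0 < p)%N := prime_gt0 pp.
Let p1 : (1 < p)%N := prime_gt1 pp.
Let cK : #|K|.-1 = q1. Proof. by rewrite cardK. Qed.

(** The summand f keeps the exponent nonnegative. Modulo q - 1 this is p^(h - k), so that eps k *
    deg k is congruent to a p^h, the class of total r, for every k. *)
Definition eps k : nat := p ^ (h + f - k).
Definition deg k : nat := a * p ^ k.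

Lemma eps_gt0 k : (0 < eps k)%N.
Proof. by rewrite expn_gt0 p0. Qed.

Lemma deg_gt0 k : (0 < deg k)%N.
Proof. by rewrite muln_gt0 a0 expn_gt0 p0. Qed.

Lemma epsS k : (k < f)%N -> eps k = (p * eps k.+1)%N.
Proof. by move=> kf; rewrite /eps -expnS; congr (_ ^ _)%N; lia. Qed.

Lemma degS k : deg k.+1 = (p * deg k)%N.
Proof. by rewrite /deg expnS mulnCA. Qed.

Lemma q1_gt1 : (1 < q1)%N.
Proof.
have : (2 ^ 2 <= p ^ f)%N.
  by apply: (@leq_trans (p ^ 2)); [rewrite leq_exp2r|rewrite leq_pexp2l].
by case: (p ^ f)%N => [|[|[|]]].
Qed.

Lemma modn_q (n : nat) : (n * p ^ f = n %[mod q1])%N.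
Proof.
have q0 : (0 < p ^ f)%N by rewrite expn_gt0 p0.
by rewrite -{1}(prednK q0) mulnS addnC modnMDl.
Qed.

Lemma coprime_eps k : coprime q1 (eps k).
Proof.
apply: coprimeXr; rewrite coprime_sym prime_coprime //.
apply/negP => d; have : (p %| q1.+1)%N.
  by rewrite prednK ?expn_gt0 ?p0 // dvdn_exp //; lia.
by rewrite -addn1 dvdn_addr // dvdn1; lia.
Qed.

Lemma eps_deg k : (k < f)%N -> (eps k * deg k = total p r %[mod q1])%N.
Proof.
move=> kf; rewrite rE /eps /deg mulnCA -expnD subnK; last by lia.
by rewrite expnD mulnA modn_q.
Qed.

Lemma deg_lt k : (k < f)%N -> (deg k < p ^ f)%N.
Proof.
move=> kf; apply: (@leq_trans (p * p ^ k)); first by rewrite ltn_pmul2r ?expn_gt0 ?p0.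
by rewrite -expnS leq_pexp2l.
Qed.

(** Both a p^k and q are multiples of p, so a p^k < q leaves a gap of at least p. *)
Lemma deg_lt_q1 k : (k < f)%N -> (0 < k)%N -> (deg k < q1)%N.
Proof.
move=> kf k0; have := deg_lt kf; rewrite -(prednK k0) degS.
have : (p %| p ^ f)%N by rewrite dvdn_exp //; lia.
move=> /dvdnP[m ->]; rewrite (mulnC m p) ltn_pmul2l // => lt.
by have := leq_mul (leqnn p) lt; rewrite mulnS; lia.
Qed.

Definition hmon k (n : nat) x y : L :=
  iota x ^+ (eps k * (deg k - n)) * iota y ^+ (eps k * n).

Definition inH k F : Prop := exists c : nat -> L,
  forall x y, F x y = \sum_(n < (deg k).+1) c n * hmon k n x y.

Lemma inH_ext k F G : (forall x y, F x y = G x y) -> inH k F -> inH k G.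
Proof. by move=> e [c hc]; exists c => x y; rewrite -e. Qed.

Lemma inH_zero k : inH k (fun _ _ => 0).
Proof. by exists (fun=> 0) => x y; rewrite big1 // => i _; rewrite mul0r. Qed.

Lemma inH_lin k (e : L) F G : inH k F -> inH k G -> inH k (fun x y => e * F x y + G x y).
Proof.
move=> [c hc] [d hd]; exists (fun n => e * c n + d n) => x y.
rewrite hc hd mulr_sumr -big_split; apply: eq_bigr => n _.
by rewrite mulrDl mulrA.
Qed.

Lemma inH_add k F G : inH k F -> inH k G -> inH k (fun x y => F x y + G x y).
Proof.
by move=> hF hG; apply: inH_ext (inH_lin 1 hF hG) => x y; rewrite mul1r.
Qed.

Lemma inH_scale k (e : L) F : inH k F -> inH k (fun x y => e * F x y).
Proof.
by move=> hF; apply: inH_ext (inH_lin e hF (inH_zero k)) => x y; rewrite addr0.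
Qed.

Lemma inH_sum k (I : Type) (s : seq I) (P : pred I) (G : I -> K -> K -> L) :
  (forall i, P i -> inH k (G i)) -> inH k (fun x y => \sum_(i <- s | P i) G i x y).
Proof.
move=> hG; elim: s => [|i s IHs].
  by apply: inH_ext (inH_zero k) => x y; rewrite big_nil.
case: (boolP (P i)) => Pi.
  by apply: inH_ext (inH_add (hG i Pi) IHs) => x y; rewrite big_cons Pi.
by apply: inH_ext IHs => x y; rewrite big_cons (negPf Pi).
Qed.

Lemma inH_hmon k n : (n <= deg k)%N -> inH k (hmon k n).
Proof.
move=> le; exists (fun m => (m == n)%:R) => x y.
have nlt : (n < (deg k).+1)%N by rewrite ltnS.
rewrite (bigD1 (Ordinal nlt)) //= eqxx mul1r big1 ?addr0 //.
by move=> i ne; rewrite -(inj_eq val_inj) /= in ne; rewrite (negPf ne) mul0r.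
Qed.

(* hmon k n is a monomial of degree deg k in x ^ eps k and y ^ eps k, and
   x |-> x ^ eps k is additive, so linear substitutions preserve inH k. *)
Lemma hom_linear_subst (al be ga de : L) n m : exists c : nat -> L,
  forall X Y : L, (al * X + ga * Y) ^+ n * (be * X + de * Y) ^+ m =
    \sum_(j < (n + m).+1) c j * (X ^+ (n + m - j) * Y ^+ j).
Proof.
have step N (c : nat -> L) (s t : L) : exists d : nat -> L, forall X Y : L,
   (s * X + t * Y) * (\sum_(j < N.+1) c j * (X ^+ (N - j) * Y ^+ j)) =
   \sum_(j < N.+2) d j * (X ^+ (N.+1 - j) * Y ^+ j).
  exists (fun j => s * (if (j <= N)%N then c j else 0) +
                   t * (if j is j'.+1 then c j' else 0)) => X' Y'.
  rewrite mulrDl.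
  have -> : s * X' * (\sum_(j < N.+1) c j * (X' ^+ (N - j) * Y' ^+ j)) =
     \sum_(j < N.+2) s * (if (j <= N)%N then c j else 0) *
        (X' ^+ (N.+1 - j) * Y' ^+ j).
    rewrite [RHS]big_ord_recr /= ltnn mulr0 mul0r addr0 mulr_sumr.
    apply: eq_bigr => j _; have jN := ltn_ord j; rewrite -ltnS jN subSn //.
    by rewrite exprS; ring.
  have -> : t * Y' * (\sum_(j < N.+1) c j * (X' ^+ (N - j) * Y' ^+ j)) =
     \sum_(j < N.+2) t * (if (j : nat) is j'.+1 then c j' else 0) *
        (X' ^+ (N.+1 - j) * Y' ^+ j).
    rewrite [RHS]big_ord_recl /= mulr0 mul0r add0r mulr_sumr.
    by apply: eq_bigr => j _; rewrite /= subSS exprS; ring.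
  by rewrite -big_split /=; apply: eq_bigr => j _; rewrite mulrDl.
elim: n => [|n [c hc]].
  elim: m => [|m [c hc]].
    by exists (fun=> 1) => X' Y'; rewrite big_ord1 !expr0 !mulr1.
  have [d hd] := step m c be de; exists d => X' Y'.
  by rewrite -hd -hc !expr0 !mul1r exprS.
have [d hd] := step (n + m)%N c al ga; exists d => X' Y'.
rewrite addSn; by rewrite -hd -hc exprS mulrA.
Qed.

Lemma exprD_eps k (s t : L) : (s + t) ^+ eps k = s ^+ eps k + t ^+ eps k.
Proof. exact: exprD_pchar. Qed.

Lemma inH_act k (g : 'M[K]_2) F : inH k F -> inH k
  (fun x y => F (g 0 0 * x + g 1 0 * y) (g 0 1 * x + g 1 1 * y)).
Proof.
move=> [c hc].
suff hm n : (n <= deg k)%N -> inH k (fun x y =>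
    hmon k n (g 0 0 * x + g 1 0 * y) (g 0 1 * x + g 1 1 * y)).
  apply: (@inH_ext k (fun x y => \sum_(n < (deg k).+1) c n *
      hmon k n (g 0 0 * x + g 1 0 * y) (g 0 1 * x + g 1 1 * y))) => [x y|].
    by rewrite hc.
  by apply: inH_sum => n _; apply: inH_scale; apply: hm; rewrite -ltnS.
move=> le.
have [d hd] := hom_linear_subst (iota (g 0 0) ^+ eps k) (iota (g 0 1) ^+ eps k)
  (iota (g 1 0) ^+ eps k) (iota (g 1 1) ^+ eps k) (deg k - n) n.
exists d => x y; rewrite /hmon !exprM !rmorphD !rmorphM !(exprD_pchar pcharL) !exprMn.
by rewrite hd subnK //; apply: eq_bigr => j _; rewrite !exprM.
Qed.

Lemma hmon_uniq k (c : nat -> L) : (k < f)%N ->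
  (forall x y, \sum_(n < (deg k).+1) c n * hmon k n x y = 0) ->
  forall n, (n <= deg k)%N -> c n = 0.
Proof.
move=> kf hc n hn.
have P0 : \poly_(i < (deg k).+1) c i = 0.
  apply: (poly_eq0_roots pcharL cardK (n := h + f - k)).
    exact: leq_trans (size_poly _ _) (deg_lt kf).
  move=> y; rewrite horner_poly -[RHS](hc 1 y); apply: eq_bigr => i _.
  by rewrite /hmon rmorph1 expr1n mul1r -exprM.
by have := congr1 (fun P : {poly L} => P`_n) P0; rewrite coef_poly ltnS hn coef0.
Qed.

(** As eps k = p eps (k + 1) and deg (k + 1) = p deg k, the monomial of index n at level k is the
    one of index p n at level k + 1. *)
Lemma inHS k F : (k.+1 < f)%N -> inH k F -> inH k.+1 F.
Proof.
move=> kf [c hc]; apply: (@inH_ext _ (fun x y => \sum_(n < (deg k).+1) c n * hmon k n x y)).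
  by move=> x y; rewrite hc.
apply: inH_sum => n _; apply: inH_scale.
apply: (@inH_ext _ (hmon k.+1 (p * n))) => [x y|]; last first.
  by apply: inH_hmon; rewrite degS leq_pmul2l // -ltnS.
by rewrite /hmon (epsS (ltnW kf)) degS -mulnBr !mulnA [(eps _ * p)%N]mulnC.
Qed.

Lemma inH_hmon_dvd k n : (k.+1 < f)%N -> (p %| n)%N -> (n <= deg k.+1)%N ->
  inH k (hmon k.+1 n).
Proof.
move=> kf /dvdnP[m ->]; rewrite degS mulnC leq_pmul2l // => hm.
apply: inH_ext (inH_hmon hm) => x y.
by rewrite /hmon (epsS (ltnW kf)) degS -mulnBr !mulnA [(eps _ * p)%N]mulnC.
Qed.

(** H_k is spanned by the monomials of level k + 1 whose index is divisible by p, so those of index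
    prime to p stay independent modulo H_k. *)
Lemma inH_coef_dvd k (c : nat -> L) n : (k.+1 < f)%N ->
  inH k (fun x y => \sum_(n < (deg k.+1).+1) c n * hmon k.+1 n x y) ->
  (n <= deg k.+1)%N -> ~~ (p %| n)%N -> c n = 0.
Proof.
move=> kf [d hd] hn ndv.
pose d' m := if (p %| m)%N then d (m %/ p)%N else 0.
have hd' x y : \sum_(m < (deg k.+1).+1) d' m * hmon k.+1 m x y =
    \sum_(m < (deg k).+1) d m * hmon k m x y.
  rewrite (bigID (fun m : 'I__ => p %| m)%N) /= [X in _ + X]big1 ?addr0; last first.
    by move=> m /negPf hm; rewrite /d' hm mul0r.
  have pm (m : 'I_(deg k).+1) : (p * m < (deg k.+1).+1)%N.
    by rewrite degS ltnS leq_pmul2l // -ltnS.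
  rewrite (reindex_onto (fun m : 'I_(deg k).+1 => Ordinal (pm m))
     (fun m : 'I_(deg k.+1).+1 => inord (m %/ p))) /=; last first.
    move=> m /dvdnP[l hl]; apply: val_inj => /=; rewrite hl mulnK // inordK.
      by rewrite mulnC.
    by have := ltn_ord m; rewrite hl degS [(p * _)%N]mulnC !ltnS leq_pmul2r.
  apply: eq_big => m.
    rewrite dvdn_mulr //=; apply/eqP/val_inj => /=.
    by rewrite mulKn // inordK.
  move=> _; rewrite /d' dvdn_mulr // mulKn //; congr (_ * _).
  by rewrite /hmon (epsS (ltnW kf)) degS -mulnBr !mulnA [(eps _ * p)%N]mulnC.
have := @hmon_uniq k.+1 (fun m => c m - d' m) kf.
move=> /(_ _ n hn); rewrite /d' (negPf ndv) subr0; apply=> x y.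
rewrite (eq_bigr (fun m : 'I__ => c m * hmon k.+1 m x y - d' m * hmon k.+1 m x y)).
  by rewrite sumrB hd' -hd subrr.
by move=> m _; rewrite mulrBl.
Qed.

(** B 0 turns out to be the sum of V_r^* and X_r ([Vstar_plus_XrE]), and the image of B k in Q to be
    Q_k for k < f ([QsocE]). *)
Definition B k v : Prop := V r v /\ inH k (ev v).

Lemma B_zero k : B k 0.
Proof.
by split; [exact: V_zero|apply: inH_ext (inH_zero k) => x y; rewrite ev0].
Qed.

Lemma B_lin k e u v : B k u -> B k v -> B k (e *: u + v).
Proof.
move=> [V1 H1] [V2 H2]; split; first exact: V_lin.
by apply: inH_ext (inH_lin e H1 H2) => x y; rewrite ev_lin.
Qed.

Lemma B_act k (g : 'M[K]_2) v : B k v -> B k (act g v).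
Proof.
move=> [V1 H1]; split; first exact: V_poly_act.
by apply: inH_ext (inH_act g H1) => x y; rewrite ev_act.
Qed.

Lemma BS k v : (k.+1 < f)%N -> B k v -> B k.+1 v.
Proof. by move=> kf [V1 H1]; split=> //; exact: inHS. Qed.

Lemma Vstar_B k v : Vstar p r v -> B k v.
Proof.
move=> [V1 H1]; split=> //; apply: inH_ext (inH_zero k) => x y.
by rewrite (ev_theta_comb iota pcharL cardK f2 x y H1).
Qed.

Lemma total_r_gt0 : (0 < total p r)%N.
Proof. apply: (@leq_trans (p ^ f)); last exact: (card_le_total pcharL cardK f2 hr).
by rewrite expn_gt0 p0. Qed.

Lemma B_Xr k : (k < f)%N -> B k (mono L r (fun=> 0%N)).
Proof.
move=> kf; split; first exact: V_mono.
apply: inH_ext (inH_hmon (leq0n _)) => x y.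
rewrite ev_mono // /hmon subn0 muln0.
have -> : total p (fun _ : 'I_f => 0%N) = 0%N by rewrite /total big1.
rewrite subn0; congr (_ * _); apply: iota_exp_modn.
- by rewrite muln_gt0 eps_gt0 deg_gt0.
- exact: total_r_gt0.
- by rewrite cK eps_deg.
Qed.

Lemma B_Yr k : (k < f)%N -> B k (mono L r r).
Proof.
move=> kf; split; first exact: V_mono.
apply: inH_ext (inH_hmon (leqnn _)) => x y.
rewrite ev_mono // /hmon !subnn muln0; congr (_ * _); apply: iota_exp_modn.
- by rewrite muln_gt0 eps_gt0 deg_gt0.
- exact: total_r_gt0.
- by rewrite cK eps_deg.
Qed.

Lemma ev_mat2 (s t u v : K) w x y :
  ev (act (mat2 s t u v) w) x y = ev w (s * x + u * y) (t * x + v * y).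
Proof. by rewrite (ev_act iota pcharL) !mxE. Qed.

(** * Submodules of V_r containing B_0 *)

Section Uniserial.
Context (S : poly2 -> Prop).
Context (S_V : forall v, S v -> V r v) (S_B0 : forall v, B 0 v -> S v).
Context (S_lin : forall e u v, S u -> S v -> S (e *: u + v)).
Context (S_act : forall (g : 'M[K]_2) v, g \in unitmx -> S v -> S (act g v)).

(** S contains V_r^*, the kernel of evaluation on V_r, so membership in S depends on the function
    alone ([S_of_ev]) and can be studied on explicit monomials in x and y. *)
Definition inS F := exists2 v, S v & forall x y, ev v x y = F x y.

Lemma S_of_ev v : V r v -> inS (ev v) -> S v.
Proof.
move=> hv [w hw e]; have -> : v = 1 *: w + (v - w) by rewrite scale1r addrC subrK.
apply: S_lin => //; apply/S_B0/Vstar_B/(ev_kernel (iota := iota) pcharL cardK f2 hr).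
  by apply: V_sub => //; exact: S_V.
by move=> x y; rewrite evB e subrr.
Qed.

Lemma inS_ext F G : (forall x y, F x y = G x y) -> inS F -> inS G.
Proof. by move=> e [v hv hF]; exists v => // x y; rewrite hF. Qed.

Lemma inS_zero : inS (fun _ _ => 0).
Proof. by exists 0 => [|x y]; [apply: S_B0; exact: B_zero|rewrite ev0]. Qed.

Lemma inS_lin e F G : inS F -> inS G -> inS (fun x y => e * F x y + G x y).
Proof.
move=> [v hv hF] [w hw hG]; exists (e *: v + w); first exact: S_lin.
by move=> x y; rewrite ev_lin hF hG.
Qed.

Lemma inS_scale e F : inS F -> inS (fun x y => e * F x y).
Proof.
by move=> hF; apply: inS_ext (inS_lin e hF inS_zero) => x y; rewrite addr0.
Qed.

Lemma inS_unscale e F : e != 0 -> inS (fun x y => e * F x y) -> inS F.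
Proof. by move=> e0 /(inS_scale e^-1); apply: inS_ext => x y; rewrite mulKf. Qed.

Lemma inS_sum (I : Type) (s : seq I) (P : pred I) (G : I -> K -> K -> L) :
  (forall i, P i -> inS (G i)) -> inS (fun x y => \sum_(i <- s | P i) G i x y).
Proof.
move=> hG; elim: s => [|i s IHs].
  by apply: inS_ext inS_zero => x y; rewrite big_nil.
case: (boolP (P i)) => Pi.
  apply: inS_ext (inS_lin 1 (hG i Pi) IHs) => x y.
  by rewrite big_cons Pi mul1r.
by apply: inS_ext IHs => x y; rewrite big_cons (negPf Pi).
Qed.

Lemma inS_mat2 (s t u v : K) F : s * v - t * u != 0 -> inS F ->
  inS (fun x y => F (s * x + u * y) (t * x + v * y)).
Proof.
move=> nz [w hw hF]; exists (act (mat2 s t u v) w).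
  by apply: S_act => //; exact: unit_mat2.
by move=> x y; rewrite ev_mat2 hF.
Qed.

Lemma inS_torus n F : (0 < n)%N -> inS F ->
  inS (fun x y => \sum_(d : K) iota d ^+ n * F x (d * y)).
Proof.
move=> n0 hF; apply: inS_sum => d _; case: (eqVneq d 0) => [->|d0].
  apply: inS_ext inS_zero => x y.
  by rewrite rmorph0 expr0n; case: n n0 => // n _; rewrite mul0r.
apply: inS_scale.
have nz : 1 * d - 0 * 0 != 0 :> K by rewrite mul1r mul0r subr0.
by apply: inS_ext (inS_mat2 nz hF) => x y; rewrite mul1r !mul0r addr0 add0r.
Qed.

(* Averaging over the torus isolates one weight space. *)
Lemma inS_project k M (c : nat -> L) (m : nat -> nat) j0 :
  (j0 < M)%N -> (j0 <= q1)%N ->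
  (forall j, (j < M)%N -> c j != 0 -> j = j0 %[mod q1] -> j = j0) ->
  inS (fun x y => \sum_(j < M) c j * (iota x ^+ m j * iota y ^+ (eps k * j))) ->
  inS (fun x y => c j0 * (iota x ^+ m j0 * iota y ^+ (eps k * j0))).
Proof.
move=> j0M j0q hj hS.
(* The power sum over d then keeps the indices congruent to j0 modulo q - 1, with sign -1. The
   summand q - 1 only makes the exponent positive, so that d = 0 drops out. *)
pose n := (eps k * (q1 - j0) + q1)%N.
have q1_0 : (0 < q1)%N := ltnW q1_gt1.
have n0 : (0 < n)%N by rewrite /n addn_gt0 q1_0 orbT.
have := inS_scale (-1) (inS_torus n0 hS); apply: inS_ext => x y.
rewrite (eq_bigr (fun d => \sum_(j < M) c j * (iota x ^+ m j *
    iota y ^+ (eps k * j)) * iota d ^+ (n + eps k * j))); last first.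
  move=> d _; rewrite mulr_sumr; apply: eq_bigr => j _.
  by rewrite rmorphM exprMn exprD; ring.
rewrite exchange_big /= (bigD1 (Ordinal j0M)) //= [X in _ + X]big1 => [|j ne].
  rewrite -mulr_sumr iota_powsum ?cK; last by rewrite addn_gt0 n0.
  have -> : (q1 %| n + eps k * j0)%N.
    by rewrite /n addnAC -mulnDr subnK // dvdn_addr // dvdn_mull.
  by rewrite addr0 mulrN1 mulN1r opprK.
rewrite -mulr_sumr iota_powsum ?cK; last by rewrite addn_gt0 n0.
case: (eqVneq (c j) 0) => [->|cj]; first by rewrite !mul0r.
case: (boolP (q1 %| _)%N) => [d|_]; last by rewrite /= oppr0 mulr0.
have /hj : (j < M)%N by [].
move=> /(_ cj) e; move: ne; rewrite -(inj_eq val_inj) /= e ?eqxx //.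
move: d; rewrite /n addnAC -mulnDr dvdn_addl // Gauss_dvdr ?coprime_eps // => d.
apply/eqP; rewrite -(eqn_modDl (q1 - j0)) subnK // modnn.
by move: d; rewrite /dvdn.
Qed.

Section Step.
Context (k : nat) (kf : (k.+1 < f)%N).
Local Notation N := (deg k.+1).
Local Notation ep := (eps k.+1).

Let N_lt : (N < q1)%N := deg_lt_q1 kf (ltn0Sn k).
Let pN : (p %| N)%N. Proof. by rewrite degS dvdn_mulr. Qed.
Let N_gt1 : (1 < N)%N.
Proof. by rewrite degS; apply: leq_trans p1 _; rewrite leq_pmulr // deg_gt0. Qed.

(** The x-exponent complementary to n, in units of eps, for n in 1 .. q - 1. It is kept positive: at
    n = N it is q - 1 and not 0, so that [nmon N] differs from the function of Y^r. *)
Definition cod (n : nat) : nat := if (n < N)%N then (N - n)%N else (N + q1 - n)%N.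
Definition nmon (n : nat) x y : L := iota x ^+ (ep * cod n) * iota y ^+ (ep * n).

Lemma cod_gt0 n : (0 < n <= q1)%N -> (0 < cod n)%N.
Proof.
case/andP=> n0 nq; rewrite /cod; case: (ltnP n N) => hn; rewrite subn_gt0 //.
by apply: leq_ltn_trans nq _; rewrite -{1}[q1]add0n ltn_add2r deg_gt0.
Qed.

Lemma cod_add n : (n <= q1)%N -> (cod n + n = N %[mod q1])%N.
Proof.
move=> nq; rewrite /cod; case: ltnP => h1; first by rewrite subnK // ltnW.
by rewrite subnK ?modnDr //; lia.
Qed.

Lemma nmon_eq n m m' x y : (0 < n <= q1)%N -> (0 < m)%N -> (0 < m')%N ->
  (m' = ep * n %[mod q1])%N -> (m + m' = total p r %[mod q1])%N ->
  nmon n x y = iota x ^+ m * iota y ^+ m'.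
Proof.
move=> hn m0 m'0 e1 e2; rewrite /nmon; congr (_ * _).
  apply: iota_exp_modn => //; first by rewrite muln_gt0 eps_gt0 cod_gt0.
  rewrite cK; apply/eqP; rewrite -(eqn_modDr (ep * n)) -mulnDr.
  rewrite -modnMmr cod_add; last by case/andP: hn.
  by rewrite modnMmr eps_deg // -modnDmr -e1 modnDmr e2.
apply: iota_exp_modn => //; first by rewrite muln_gt0 eps_gt0; case/andP: hn.
by rewrite cK e1.
Qed.

Lemma eps_inv n : exists2 m, (0 < m <= q1)%N & (ep * m = n %[mod q1])%N.
Proof.
have q1_0 : (0 < q1)%N := ltnW q1_gt1.
(* Multiplication by eps gives n p^(2 f), which is congruent to n. *)
pose m0 := (n * p ^ (2 * f - (h + f - k.+1)))%N.
have hm0 : (ep * m0 = n %[mod q1])%N.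
  rewrite /m0 mulnCA -expnD subnKC; last by lia.
  by rewrite mul2n -addnn expnD mulnA modn_q modn_q.
case: (posnP (m0 %% q1)) => e.
  exists q1; first by rewrite q1_0 leqnn.
  by rewrite modnMl -[RHS]hm0 -modnMmr e muln0 mod0n.
exists (m0 %% q1)%N; first by rewrite e ltnW // ltn_mod.
by rewrite modnMmr.
Qed.

(** Apart from X^r and Y^r, a monomial has both exponents positive, so its function depends only on
    their classes modulo q - 1. Their sum is fixed and eps is invertible modulo q - 1, so one index
    n in 1 .. q - 1 describes it. *)
Lemma V_nmon v : V r v -> exists (C : nat -> L) (c0 ci : L),
  forall x y, ev v x y = c0 * ev (mono L r (fun=> 0%N)) x y +
    ci * ev (mono L r r) x y + \sum_(n < q1.+1 | (0 < n)%N) C n * nmon n x y.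
Proof.
move: v; apply: V_ind.
- exists (fun=> 0), 0, 0 => x y; rewrite !mul0r ev0 !add0r big1 // => n _.
  by rewrite mul0r.
- move=> e u v [C [c0 [ci hC]]] [C' [c0' [ci' hC']]].
  exists (fun n => e * C n + C' n), (e * c0 + c0'), (e * ci + ci') => x y.
  rewrite ev_lin hC hC'.
  have -> : \sum_(n < q1.+1 | (0 < n)%N) (e * C n + C' n) * nmon n x y =
    e * (\sum_(n < q1.+1 | (0 < n)%N) C n * nmon n x y) +
    \sum_(n < q1.+1 | (0 < n)%N) C' n * nmon n x y.
    by rewrite mulr_sumr -big_split /=; apply: eq_bigr => n _; rewrite mulrDl -mulrA.
  by ring.
move=> b hb; have tle := total_le p hb.
case: (posnP (total p b)) => t0.
  exists (fun=> 0), 1, 0 => x y; rewrite big1 => [|n _]; last by rewrite mul0r.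
  have -> : mono L r b = mono L r (fun=> 0%N).
    apply: mono_ext => i; move: t0; rewrite /total => /eqP; rewrite sum_nat_eq0.
    move=> /forallP /(_ i); rewrite muln_eq0 expn_eq0 => /orP[/eqP //|].
    by rewrite eqn0Ngt p0.
  by rewrite mul1r mul0r !addr0.
case: (posnP (total p r - total p b)) => t1.
  exists (fun=> 0), 0, 1 => x y; rewrite big1 => [|n _]; last by rewrite mul0r.
  have -> : mono L r b = mono L r r.
    apply: mono_ext => i; apply/eqP; rewrite eqn_leq hb leqNgt; apply/negP => lt.
    suff : (total p b < total p r)%N by lia.
    rewrite /total (bigD1 i) //= [X in (_ < X)%N](bigD1 i) //= -addSn leq_add //.
      by rewrite ltn_pmul2r ?expn_gt0 ?p0.
    by apply: leq_sum => j _; rewrite leq_mul.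
  by rewrite mul1r mul0r add0r addr0.
have [m hm em] := eps_inv (total p b).
exists (fun n => (n == m)%:R), 0, 0 => x y; rewrite !mul0r !add0r ev_mono //.
have mq : (m < q1.+1)%N by case/andP: hm.
have m0 : (0 < m)%N by case/andP: hm.
rewrite (bigD1 (Ordinal mq)) //= eqxx mul1r big1 ?addr0.
  by rewrite (nmon_eq x y hm t1 t0) // subnK.
by move=> n /andP[_]; rewrite -(inj_eq val_inj) /= => /negPf ->; rewrite mul0r.
Qed.

Lemma nmon_inH n : (0 < n <= q1)%N -> (p %| n)%N -> (n < N)%N -> inH k (nmon n).
Proof.
move=> hn pn nN; apply: inH_ext (inH_hmon_dvd kf pn (ltnW nN)) => x y.
by rewrite /nmon /cod nN.
Qed.

(** The parts of v along X^r and Y^r lie in B 0 and can be removed. The remaining indices 1 .. q - 1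
    have distinct torus weights, so S contains each monomial that occurs. If all of these had p | n
    and n < N, then v would be of level k. *)
Lemma S_not_B v : S v -> ~ B k v ->
  exists n, [/\ (0 < n <= q1)%N, inS (nmon n) & ~~ ((p %| n) && (n < N))%N].
Proof.
move=> Sv nB; have [C [c0 [ci hC]]] := V_nmon (S_V Sv).
have kf' : (k < f)%N by lia.
have f0 : (0 < f)%N by lia.
pose w := v - (c0 *: mono L r (fun=> 0%N) + ci *: mono L r r).
have Sw : S w.
  have -> : w = -1 *: (c0 *: mono L r (fun=> 0%N) + ci *: mono L r r) + v.
    by rewrite scaleN1r addrC.
  apply: S_lin => //.
  apply: S_lin; first by apply: S_B0; exact: B_Xr.
  rewrite -[_ *: _]addr0; apply: S_lin; last by apply: S_B0; exact: B_zero.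
  by apply: S_B0; exact: B_Yr.
have ew x y : ev w x y = \sum_(n < q1.+1 | (0 < n)%N) C n * nmon n x y.
  by rewrite /w evB evD !evZ hC; ring.
apply: contrapT => Hn; apply: nB.
have C0 n : (0 < n <= q1)%N -> ~~ ((p %| n) && (n < N))%N -> C n = 0.
  move=> hn hpn; apply/eqP/negPn/negP => Cn; apply: Hn; exists n; split=> //.
  have [n0 nq] := andP hn.
  pose c j := if (0 < j)%N then C j else 0.
  apply: (inS_unscale (e := c n)); first by rewrite /c n0.
  apply: (@inS_project k.+1 q1.+1 c (fun j => ep * cod j)%N n) => //.
    move=> j jq; rewrite /c; case: (posnP j) => [_|j0]; first by rewrite eqxx.
    by move=> _; apply: eq_modn_pos; rewrite ?j0 ?n0.
  apply: (@inS_ext (ev w)); last by exists w.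
  move=> x y; rewrite ew big_mkcond; apply: eq_bigr => j _; rewrite /c.
  by case: ifP => //; rewrite mul0r.
have Bw : B k w.
  split; first exact: S_V.
  apply: (@inH_ext _ (fun x y => \sum_(n < q1.+1 | (0 < n)%N) C n * nmon n x y)).
    by move=> x y; rewrite ew.
  apply: inH_sum => n n0; have hn : (0 < n <= q1)%N by rewrite n0 -ltnS /=.
  case: (boolP ((p %| n) && (n < N))%N) => [/andP[h1 h2]|h1].
    by apply: inH_scale; exact: nmon_inH.
  by apply: inH_ext (inH_zero k) => x y; rewrite C0 ?mul0r.
rewrite -[v](subrK (c0 *: mono L r (fun=> 0%N) + ci *: mono L r r)) -/w.
rewrite -[w]scale1r; apply: B_lin => //; apply: B_lin; first exact: B_Xr.
rewrite -[_ *: _]addr0; apply: B_lin; [exact: B_Yr|exact: B_zero].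
Qed.

Lemma inS_swap n : inS (nmon n) ->
  inS (fun x y => iota x ^+ (ep * n) * iota y ^+ (ep * cod n)).
Proof.
have nz : 0 * 0 - 1 * 1 != 0 :> K by rewrite mul0r mul1r sub0r oppr_eq0 oner_neq0.
move=> /(inS_mat2 nz); apply: inS_ext => x y.
by rewrite /nmon !mul0r !mul1r add0r addr0 mulrC.
Qed.

Lemma inS_translate n m : inS (fun x y => iota x ^+ (ep * m) * iota y ^+ (ep * n)) ->
  inS (fun x y => \sum_(j < n.+1) 'C(n, j)%:R *
    (iota x ^+ (ep * (m + (n - j))) * iota y ^+ (ep * j))).
Proof.
have nz : 1 * 1 - 1 * 0 != 0 :> K by rewrite mulr0 mul1r subr0 oner_neq0.
move=> /(inS_mat2 nz); apply: inS_ext => x y.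
rewrite !mul0r !mul1r addr0 rmorphD [in X in _ * X]exprM (exprD_pchar pcharL).
rewrite exprDn mulr_sumr; apply: eq_bigr => j _.
by rewrite -!exprM mulnDr exprD -mulr_natl; ring.
Qed.

Lemma natr_neq0 n : ((n%:R : L) != 0) = ~~ (p %| n)%N.
Proof. by rewrite (dvdn_pcharf pcharL). Qed.

(** The substitution y -> x + y produces index 1 with coefficient n, which settles the case of n
    prime to p. If p | n, then n >= N, and exchanging x and y leads to the index N + q - 1 - n,
    congruent to -1 modulo p. *)
Lemma inS_nmon1 n : (0 < n <= q1)%N -> inS (nmon n) ->
  ~~ ((p %| n) && (n < N))%N -> inS (nmon 1).
Proof.
have q1_1 := q1_gt1.
have main m : (0 < m <= q1)%N -> ~~ (p %| m)%N -> inS (nmon m) -> inS (nmon 1).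
  move=> hm pm hS; have [m0 mq] := andP hm.
  apply: (inS_unscale (e := m%:R)); first by rewrite natr_neq0.
  have := inS_translate hS.
  move=> /(@inS_project k.+1 m.+1 (fun j => 'C(m, j)%:R)
     (fun j => ep * (cod m + (m - j)))%N 1%N).
  case=> //; first exact: ltnW.
    by move=> j jm _; apply: eq_modn_small; [rewrite q1_1|exact: leq_trans (jm : (j <= m)%N) mq].
  move=> v Sv e; exists v => // x y; rewrite e bin1; congr (_ * _).
  rewrite (@nmon_eq 1 (ep * (cod m + (m - 1))) (ep * 1)) //.
  - exact: ltnW.
  - by rewrite muln_gt0 eps_gt0 addn_gt0 cod_gt0.
  - by rewrite muln1 eps_gt0.
  rewrite -mulnDr -addnA subnK // -modnMmr cod_add // modnMmr.
  by rewrite eps_deg.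
move=> hn hS; rewrite negb_and -leqNgt => /orP[pn|Nn]; first exact: main hn pn hS.
case: (boolP (p %| n)%N) => pn; last exact: main hn pn hS.
have cE : cod n = (N + q1 - n)%N by rewrite /cod ltnNge Nn.
have [n0 nq] := andP hn.
have hc : (0 < cod n <= q1)%N by rewrite cE; lia.
apply: (main (cod n)) => //; last first.
  apply: inS_ext (inS_swap hS) => x y; rewrite (@nmon_eq (cod n) (ep * n) (ep * cod n)) //.
  - by rewrite muln_gt0 eps_gt0.
  - by rewrite muln_gt0 eps_gt0; case/andP: hc.
  by rewrite -mulnDr addnC -modnMmr cod_add // modnMmr eps_deg.
apply/negP => pc; have : (p %| (cod n + n).+1)%N.
  rewrite cE subnK; last by lia.
  by rewrite -addnS prednK ?expn_gt0 ?p0 // dvdn_add // dvdn_exp //; lia.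
by rewrite -addn1 dvdn_addr ?dvdn1 ?dvdn_add //; lia.
Qed.

(** Exchanging x and y in [nmon 1] gives y-index N - 1; translating it gives every index n < N with
    coefficient C(N - 1, n), prime to p by [prime_ndvd_bin]. The extreme indices 0 and N are X^r and
    Y^r, already in B 0. *)
Lemma inS_all v : inS (nmon 1) -> B k.+1 v -> S v.
Proof.
have q1_1 := q1_gt1.
move=> h1 [Vv [c hc]]; apply: S_of_ev => //.
have cod1 : cod 1 = N.-1 by rewrite /cod N_gt1 subn1.
have := inS_translate (inS_swap h1); rewrite cod1 => hT.
apply: (@inS_ext (fun x y => \sum_(n < N.+1) c n * hmon k.+1 n x y)).
  by move=> x y; rewrite hc.
apply: inS_sum => n _; apply: inS_scale.
have f0 : (0 < f)%N by lia.
case: (posnP n) => n0.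
  exists (mono L r (fun=> 0%N)); first by apply: S_B0; exact: B_Xr.
  move=> x y; rewrite ev_mono // n0 /hmon subn0 muln0.
  have -> : total p (fun _ : 'I_f => 0%N) = 0%N by rewrite /total big1.
  rewrite subn0; congr (_ * _); apply: iota_exp_modn.
  - exact: total_r_gt0.
  - by rewrite muln_gt0 eps_gt0 deg_gt0.
  - by rewrite cK eps_deg.
case: (ltnP n N) => nN; last first.
  have -> : (n : nat) = N by have := ltn_ord n; lia.
  exists (mono L r r); first by apply: S_B0; exact: B_Yr.
  move=> x y; rewrite ev_mono // /hmon !subnn muln0; congr (_ * _).
  apply: iota_exp_modn.
  - exact: total_r_gt0.
  - by rewrite muln_gt0 eps_gt0 deg_gt0.
  - by rewrite cK eps_deg.
have nN' : (n < N.-1.+1)%N by rewrite prednK //; lia.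
apply: (inS_unscale (e := 'C(N.-1, n)%:R)).
  by rewrite natr_neq0; apply: prime_ndvd_bin.
have := @inS_project k.+1 N.-1.+1 (fun j => 'C(N.-1, j)%:R)
   (fun j => ep * (1 + (N.-1 - j)))%N n nN'.
have nq : (n < q1)%N := ltn_trans nN N_lt.
case=> //; first exact: ltnW.
  move=> j jm _; apply: eq_modn_small; first by rewrite n0 nq.
  by apply: leq_trans (ltnW N_lt); rewrite prednK ?(ltnW N_gt1) // in jm; exact: ltnW.
move=> w Sw e; exists w => // x y; rewrite e; congr (_ * (_ ^+ (_ * _) * _)); lia.
Qed.

(** Thus every nonzero submodule of V_r / B_k contains B_(k+1) / B_k. *)
Lemma uniserial : (forall v, S v -> B k v) \/ (forall v, B k.+1 v -> S v).
Proof.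
case: (pselect (forall v, S v -> B k v)) => hS; [by left|right].
move=> v; apply: inS_all; move/existsNP: hS => [w /not_implyP[Sw nBw]].
by have [n [h1 h2 h3]] := S_not_B Sw nBw; exact: inS_nmon1 h1 h2 h3.
Qed.

End Step.
End Uniserial.
End Levels.

Lemma prime_ndvd_fact p n : prime p -> (n < p)%N -> ~~ (p %| n`!)%N.
Proof.
move=> pp; elim: n => [|n IHn] np; first by rewrite dvdn1; case: eqP pp => // ->.
by rewrite factS Euclid_dvdM // negb_or gtnNdvd //= IHn // ltnW.
Qed.

Lemma prime_ndvd_bin_lt p n m : prime p -> (n < p)%N -> (m <= n)%N ->
  ~~ (p %| 'C(n, m))%N.
Proof.
move=> pp np mn; apply: contra (prime_ndvd_fact pp np) => d.
by rewrite -(bin_fact mn) dvdn_mulr.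
Qed.

(** * The socle filtration of Q *)

Section QuotientTheory.
Context (A : nzRingType) (M : lmodType A) (S : M -> Prop).
Implicit Types x y : M.

Lemma quot_pi_lin a x y : quot_pi S (a *: x + y) = a *: quot_pi S x + quot_pi S y.
Proof. by rewrite quot_piD -quot_scaleE. Qed.

Lemma quot_piZ a x : quot_pi S (a *: x) = a *: quot_pi S x.
Proof. by rewrite -quot_scaleE. Qed.

Lemma quot_pi0 : quot_pi S 0 = 0.
Proof. by rewrite -(scale0r (0 : M)) quot_piZ scale0r. Qed.

Lemma quot_piB x y : quot_pi S (x - y) = quot_pi S x - quot_pi S y.
Proof. by rewrite quot_piD -scaleN1r quot_piZ scaleN1r. Qed.

Lemma quot_pi_sum (I : Type) (s : seq I) (P : pred I) (F : I -> M) :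
  quot_pi S (\sum_(i <- s | P i) F i) = \sum_(i <- s | P i) quot_pi S (F i).
Proof. by apply: (big_morph (quot_pi S) (@quot_piD A M S) quot_pi0). Qed.

Lemma quot_pi_lspan x y : quot_pi S x = quot_pi S y <-> lspan S (x - y).
Proof.
rewrite -(asboolE (lspan S _)) -[`[< _ >]]/(x - y \in lspanb S).
by rewrite Quotient.idealrBE; split=> /eqP.
Qed.

Context (S0 : S 0) (S_lin : forall a x y, S x -> S y -> S (a *: x + y)).

Lemma quot_pi_eq x y : quot_pi S x = quot_pi S y <-> S (x - y).
Proof.
rewrite quot_pi_lspan; split=> [/(_ S S0 S_lin)|Sxy N N0 Nl SN]; first exact.
exact: SN.
Qed.

Lemma quot_pi_eq0 x : quot_pi S x = 0 <-> S x.
Proof. by rewrite -quot_pi0 quot_pi_eq subr0. Qed.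

End QuotientTheory.

Lemma quot_actE (k : finFieldType) (A : fieldType) (M : lmodType A)
    (S : M -> Prop) (rho : 'M[k]_2 -> M -> M) g x :
  S 0 -> (forall a x y, S x -> S y -> S (a *: x + y)) ->
  (forall x y, rho g (x - y) = rho g x - rho g y) ->
  (forall x, S x -> S (rho g x)) ->
  quot_act (S := S) rho g (quot_pi S x) = quot_pi S (rho g x).
Proof.
move=> S0 Sl rB Sr; apply/quot_pi_eq => //; rewrite -rB; apply: Sr.
by apply/quot_pi_eq => //; rewrite quot_piK.
Qed.

Section SocleFiltration.
Context (p f : nat) (D : padic_data p f) (r : 'I_f -> nat) (a h : nat).
Context (H : congruent_degrees p (kF D) (Fbar D) r a h).
Local Notation K := (kF D).
Local Notation L := (Fbar D).
Local Notation poly2 := {mpoly L[(f + f)%N]}.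
Local Notation ev := (@ev p f K L (iota_kF D)).
Local Notation B := (@B p f K L (iota_kF D) r a h).
Local Notation act := (@Vr_act p f D).
Local Notation q1 := (p ^ f).-1.
Implicit Types (v w : poly2) (k : nat).

Let pcharL : p \in [pchar L] := cd_pchar H.
Let cardK : #|K| = (p ^ f)%N := cd_card H.
Let f0 : (0 < f)%N := ltnW (cd_f H).
Let cK : #|K|.-1 = q1. Proof. by rewrite cardK. Qed.

Lemma Vr_act_lin g (e : L) v w : act g (e *: v + w) = e *: act g v + act g w.
Proof. exact: substXY_lin. Qed.

Lemma Vr_actB g v w : act g (v - w) = act g v - act g w.
Proof. by rewrite addrC -scaleN1r Vr_act_lin scaleN1r addrC. Qed.

Lemma Xr_generator : \prod_i Xv L i ^+ r i = mono L r (fun=> 0%N).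
Proof. by apply: eq_bigr => i _; rewrite subn0 expr0 mulr1. Qed.

Lemma Xr_lin e v w : Xr r v -> Xr r w -> Xr r (e *: v + w).
Proof.
move=> hv hw S hS Sx; have [_ Sl _] := hS.
by apply: Sl; [exact: hv hS Sx|exact: hw hS Sx].
Qed.

Lemma Xr0 : Xr (D := D) r 0.
Proof. by move=> S []. Qed.

Lemma Xr_sum (I : Type) (s : seq I) (F : I -> poly2) :
  (forall i, Xr r (F i)) -> Xr r (\sum_(i <- s) F i).
Proof.
move=> hF; elim/big_ind: _ => [|v w hv hw|i _ //]; first exact: Xr0.
by rewrite -[v]scale1r; exact: Xr_lin.
Qed.

Lemma Xr_B0 v : Xr r v -> B 0 v.
Proof.
move=> /(_ (B 0)); apply; last by rewrite Xr_generator; exact: B_Xr.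
split; first exact: B_zero.
  by move=> e u w; exact: B_lin.
by move=> g u _; apply: (B_act H).
Qed.

(** The lower unipotent of parameter d sends the function of X^r to (x^eps + d^eps y^eps)^a at level
    0. A power sum over d extracts the term of index j, with coefficient C(a, j), nonzero because a
    < p. *)
Lemma Xr_hmon j : (j <= a)%N -> exists2 v, Xr r v &
  forall x y, ev v x y = hmon p f (iota_kF D) a h 0 j x y.
Proof.
move=> ja; have ap := cd_ap H.
have q1a : (a < q1)%N.
  have := deg_lt_q1 H (cd_f H) isT; rewrite /deg expn1 => h1.
  by apply: leq_trans (ltnW h1); have := cd_a0 H; have := prime_gt1 (pcharf_prime pcharL); nia.
have ep0 := eps_gt0 H 0.
pose w := \sum_(d : K) iota_kF D d ^+ (eps p f h 0 * (q1 - j)) *: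
   act (mat2 1 0 d 1) (mono L r (fun=> 0%N)).
have Xw : Xr r w.
  apply: Xr_sum => d; rewrite -[_ *: _]addr0; apply: Xr_lin; last exact: Xr0.
  move=> S [S0 Sl Sa] Sx; apply: Sa; last by rewrite -Xr_generator.
  by apply: unit_mat2; rewrite mul1r mul0r subr0 oner_neq0.
have binz : ('C(a, j)%:R : L) != 0.
  by rewrite (natr_neq0 H) prime_ndvd_bin_lt // (pcharf_prime pcharL).
have ewx x y : ev w x y = - 'C(a, j)%:R * hmon p f (iota_kF D) a h 0 j x y.
  have -> : ev w x y = \sum_(d : K) \sum_(i < a.+1)
      'C(a, i)%:R * hmon p f (iota_kF D) a h 0 i x y *
      iota_kF D d ^+ (eps p f h 0 * (q1 - j + i)).
    rewrite ev_sum; apply: eq_bigr => d _; rewrite evZ (ev_mat2 _ H) ev_mono //.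
    have -> : total p (fun _ : 'I_f => 0%N) = 0%N by rewrite /total big1.
    rewrite subn0 expr0 mulr1 (@iota_exp_modn _ _ _ _ _ (eps p f h 0 * deg p a 0)).
    - rewrite mul1r [iota_kF D (_ + _) ^+ _]exprM rmorphD rmorphM (exprD_eps H) exprMn exprDn mulr_sumr.
      rewrite /deg muln1; apply: eq_bigr => i _.
      rewrite /hmon /deg muln1 mulnDr exprD !exprM exprMn -mulr_natl.
      by ring.
    - exact: total_r_gt0 H.
    - by rewrite muln_gt0 ep0 (deg_gt0 H).
    - by rewrite cK (eps_deg H).
  have js : (j < a.+1)%N by [].
  have pos i : (0 < eps p f h 0 * (q1 - j + i))%N.
    by rewrite muln_gt0 ep0 addn_gt0 subn_gt0 (leq_ltn_trans ja q1a).
  rewrite exchange_big /= (bigD1 (Ordinal js)) //= [X in _ + X]big1 => [|i ne].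
    rewrite -mulr_sumr iota_powsum ?cK // subnK ?dvdn_mull //; last first.
      exact: ltnW (leq_ltn_trans ja q1a).
    by rewrite addr0 mulrN1 mulNr.
  rewrite -mulr_sumr iota_powsum ?cK // Gauss_dvdr ?(coprime_eps H) //.
  case: (boolP (q1 %| _)%N) => [d|_]; last by rewrite oppr0 mulr0.
  have iq : (i < q1)%N by apply: leq_trans (ltn_ord i) q1a.
  have jq : (j < q1)%N by apply: leq_ltn_trans ja q1a.
  have /eqP : (i = j %[mod q1])%N.
    apply/eqP; rewrite -(eqn_modDl (q1 - j)) subnK ?modnn; last exact: ltnW.
    by move: d; rewrite /dvdn.
  by rewrite !modn_small //; move: ne; rewrite -(inj_eq val_inj) /= => /negPf ->.
exists ((- 'C(a, j)%:R)^-1 *: w).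
  by rewrite -[_ *: _]addr0; apply: Xr_lin => //; exact: Xr0.
by move=> x y; rewrite evZ ewx mulKf // oppr_eq0.
Qed.

(** By [Xr_hmon] every function of level 0 comes from an element of X_r; the difference vanishes on
    F_q^2 and lies in V_r^* by [ev_kernel]. *)
Lemma Vstar_plus_XrE v : Vstar_plus_Xr (D := D) r v <-> B 0 v.
Proof.
split=> [[v1 [v2 [h1 h2 ->]]]|[Vv [c hc]]].
  rewrite -[v1]scale1r; apply: B_lin; first exact: (Vstar_B _ H).
  exact: Xr_B0.
have /choice[w wP] : forall j : 'I_a.+1, exists w : poly2, Xr r w /\
    forall x y, ev w x y = hmon p f (iota_kF D) a h 0 j x y.
  move=> j; have [|u hu e] := @Xr_hmon j; first by rewrite -ltnS.
  by exists u.
pose w2 := \sum_(j < a.+1) c j *: w j.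
have Xw : Xr r w2.
  apply: Xr_sum => j; rewrite -[_ *: _]addr0; apply: Xr_lin; last exact: Xr0.
  by have [] := wP j.
exists (v - w2), w2; split=> //; last by rewrite subrK.
have [Vw _] := Xr_B0 Xw.
apply: (ev_kernel (iota := iota_kF D) pcharL cardK (cd_f H) (cd_r H)).
  exact: V_sub.
move=> x y; rewrite evB hc ev_sum /deg muln1; apply/eqP; rewrite subr_eq0.
apply/eqP; apply: eq_bigr => j _; rewrite evZ; by have [_ ->] := wP j.
Qed.

Local Notation pi0 := (quot_pi (Vstar_plus_Xr (D := D) r)).

Lemma VpX0 : Vstar_plus_Xr (D := D) r 0.
Proof. by apply/Vstar_plus_XrE; exact: B_zero. Qed.

Lemma VpX_lin e v w : Vstar_plus_Xr (D := D) r v -> Vstar_plus_Xr (D := D) r w ->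
  Vstar_plus_Xr (D := D) r (e *: v + w).
Proof. by rewrite !Vstar_plus_XrE; exact: B_lin. Qed.

Lemma pi0_eq v w : pi0 v = pi0 w <-> B 0 (v - w).
Proof. by rewrite (quot_pi_eq VpX0 VpX_lin) Vstar_plus_XrE. Qed.

Lemma Q_actE g v : Q_act g (pi0 v) = pi0 (act g v).
Proof.
apply: quot_actE; [exact: VpX0|exact: VpX_lin|exact: Vr_actB|].
by move=> w; rewrite !Vstar_plus_XrE; exact: (B_act H).
Qed.

Lemma Q_actB g x y : Q_act (D := D) (r := r) g (x - y) = Q_act g x - Q_act g y.
Proof.
by rewrite -[x]quot_piK -[y]quot_piK -quot_piB !Q_actE Vr_actB quot_piB.
Qed.

Lemma B0_le k v : (k < f)%N -> B 0 v -> B k v.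
Proof.
elim: k => // k IHk kf hv; apply: (BS H) => //; apply: IHk => //; exact: ltnW.
Qed.

Lemma expn_modn n : (p ^ (n %% f) = p ^ n %[mod q1])%N.
Proof.
rewrite [in RHS](divn_eq n f) expnD mulnC; elim: (n %/ f)%N => [|m IHm].
  by rewrite mul0n muln1.
by rewrite mulSn expnD mulnCA mulnC (modn_q H).
Qed.

Lemma total_unit (i : 'I_f) : total p (unit_deg i) = (p ^ i)%N.
Proof.
rewrite /total (bigD1 i) //= /unit_deg eqxx mul1n big1 ?addn0 //.
by move=> j /negPf ->; rewrite mul0n.
Qed.

Lemma unit_deg_le (i j : 'I_f) : (unit_deg i j <= r j)%N.
Proof.
apply: leq_trans (cd_r H j); rewrite /unit_deg.
by case: (_ == _) => //; rewrite expn_gt0 (prime_gt0 (pcharf_prime pcharL)).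
Qed.

Lemma expn_lt_total (i : 'I_f) : (p ^ i < total p r)%N.
Proof.
apply: leq_trans (card_le_total pcharL cardK (cd_f H) (cd_r H)).
by rewrite ltn_exp2l ?(prime_gt1 (pcharf_prime pcharL)) // ltn_ord.
Qed.

Lemma deg_gt1 k : (0 < k)%N -> (1 < deg p a k)%N.
Proof.
move=> k0; have p1 := prime_gt1 (pcharf_prime pcharL).
apply: (leq_trans p1); rewrite -(prednK k0) degS leq_pmulr //.
exact: deg_gt0 H _.
Qed.

Lemma ev_unit i x y : ev (mono L r (unit_deg i)) x y =
  iota_kF D x ^+ (total p r - p ^ i) * iota_kF D y ^+ (p ^ i).
Proof. by rewrite ev_mono ?total_unit //; exact: unit_deg_le. Qed.

Lemma ev_unit_hmon k n (i : 'I_f) x y : (k < f)%N -> (0 < n < deg p a k)%N ->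
  (p ^ i = eps p f h k * n %[mod q1])%N ->
  ev (mono L r (unit_deg i)) x y = hmon p f (iota_kF D) a h k n x y.
Proof.
move=> kf /andP[n0 nd] em; have lt := expn_lt_total i.
rewrite ev_unit /hmon; congr (_ * _); apply: iota_exp_modn; rewrite ?cK //.
- by rewrite subn_gt0.
- by rewrite muln_gt0 (eps_gt0 H) subn_gt0.
- apply/eqP; rewrite -(eqn_modDr (p ^ i)) subnK ?(ltnW lt) //.
  by rewrite -[X in (_ == X)%N]modnDmr em modnDmr -mulnDr subnK ?(eps_deg H) // ltnW.
- by rewrite expn_gt0 (prime_gt0 (pcharf_prime pcharL)).
- by rewrite muln_gt0 (eps_gt0 H).
Qed.

Lemma B_unit_mono k n (i : 'I_f) : (k < f)%N -> (0 < n < deg p a k)%N ->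
  (p ^ i = eps p f h k * n %[mod q1])%N -> B k (mono L r (unit_deg i)).
Proof.
move=> kf hn em; split; first by apply: V_mono; exact: unit_deg_le.
apply: (@inH_ext _ _ _ _ _ _ _ _ (hmon p f (iota_kF D) a h k n)) => [x y|].
  by rewrite (ev_unit_hmon x y kf hn em).
by apply: inH_hmon; case/andP: hn => _ /ltnW.
Qed.

Definition QsocP k := forall x, Qsoc D r k x <-> exists2 v, B k v & x = pi0 v.

Section FromB.
Context (k : nat) (kf : (k < f)%N) (hk : QsocP k).

Lemma Qsoc_zero : Qsoc D r k 0.
Proof. by apply/hk; exists 0; [exact: B_zero|rewrite quot_pi0]. Qed.

Lemma Qsoc_lin e x y : Qsoc D r k x -> Qsoc D r k y -> Qsoc D r k (e *: x + y).
Proof.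
move=> /hk[v hv ->] /hk[w hw ->]; apply/hk; exists (e *: v + w); first exact: B_lin.
by rewrite quot_pi_lin.
Qed.

Lemma Qsoc_act g x : Qsoc D r k x -> Qsoc D r k (Q_act g x).
Proof.
move=> /hk[v hv ->]; apply/hk; exists (act g v); first exact: (B_act H).
by rewrite Q_actE.
Qed.

Lemma Qsoc_pi v : V r v -> Qsoc D r k (pi0 v) <-> B k v.
Proof.
move=> hv; split=> [/hk[w hw /pi0_eq e]|h1]; last by apply/hk; exists v.
rewrite -[v](subrK w) -[v - w]scale1r; apply: B_lin => //; exact: B0_le.
Qed.

Definition piB v : quot (Qsoc D r k) := quot_pi (Qsoc D r k) (pi0 v).

Lemma piB_lin e v w : piB (e *: v + w) = e *: piB v + piB w.
Proof. by rewrite /piB !quot_pi_lin. Qed.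

Lemma piBB v w : piB (v - w) = piB v - piB w.
Proof. by rewrite /piB !quot_piB. Qed.

Lemma piB0 : piB 0 = 0.
Proof. by rewrite /piB !quot_pi0. Qed.

Lemma piB_eq0 v : V r v -> piB v = 0 <-> B k v.
Proof.
by move=> hv; rewrite -Qsoc_pi // /piB (quot_pi_eq0 Qsoc_zero Qsoc_lin).
Qed.

Lemma piB_eq v w : V r v -> V r w -> piB v = piB w <-> B k (v - w).
Proof.
move=> hv hw; rewrite -(piB_eq0 (V_sub hv hw)) piBB; split=> [->|/eqP].
  by rewrite subrr.
by rewrite subr_eq0 => /eqP.
Qed.

Lemma Qgr_actE g v : Qgr_act D r k g (piB v) = piB (act g v).
Proof.
rewrite /Qgr_act /piB quot_actE ?Q_actE //;
  [exact: Qsoc_zero|exact: Qsoc_lin|exact: Q_actB|exact: Qsoc_act].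
Qed.

Lemma quot_im_Qrep x : quot_im (S := Qsoc D r k) (@Qrep p f D r) x <-> exists2 v, V r v & x = piB v.
Proof.
split=> [[_ [v hv ->] ->]|[v hv ->]]; first by exists v.
by exists (pi0 v) => //; exists v.
Qed.

End FromB.

Section SocleStep.
Context (k : nat) (kf : (k.+1 < f)%N) (hk : QsocP k).
Let kf' : (k < f)%N := ltnW kf.
Local Notation piB := (@piB k).

Definition Bim (x : quot (Qsoc D r k)) := exists2 v, B k.+1 v & x = piB v.

Lemma subrep_Bim : subrep (Qgr_act D r k) Bim.
Proof.
split; first by exists 0; [exact: B_zero|rewrite piB0].
  move=> e x y [v hv ->] [w hw ->]; exists (e *: v + w); first exact: B_lin.
  by rewrite piB_lin.
move=> g x _ [v hv ->]; exists (act g v); first exact: (B_act H).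
by rewrite Qgr_actE.
Qed.

(** The preimage of S in V_r is a submodule containing B_0, to which [uniserial] applies. *)
Lemma subrep_Bim_dichotomy S : subrep (Qgr_act D r k) S ->
  (forall x, S x -> quot_im (S := Qsoc D r k) (@Qrep p f D r) x) ->
  (forall x, S x -> x = 0) \/ (forall x, Bim x -> S x).
Proof.
move=> [S0 Sl Sa] hS.
have [] := @uniserial _ _ _ _ (iota_kF D) _ _ _ H (fun v => V r v /\ S (piB v)) _ _ _ _ k kf.
- by move=> v [].
- move=> v hv; have [Vv _] := hv; split=> //.
  by rewrite (piB_eq0 kf' hk Vv).2 //; exact: B0_le.
- move=> e v w [V1 S1] [V2 S2]; split; first exact: V_lin.
  by rewrite piB_lin; exact: Sl.
- move=> g v gu [V1 S1]; split; first exact: V_poly_act.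
  by rewrite -[X in S (piB X)]/(act g v) -(Qgr_actE hk); exact: Sa.
- move=> hB; left=> x Sx; have /quot_im_Qrep[v hv e] := hS _ Sx.
  by rewrite e; apply/(piB_eq0 kf' hk hv)/hB; rewrite -e.
- by move=> hB; right=> x [v hv ->]; have [] := hB v hv.
Qed.

(** With p^i congruent to eps (k + 1), the monomial X^(r - e_i) Y_i has index 1 at level k + 1; 1
    being prime to p, it is not of level k. *)
Lemma Bim_neq0 : exists2 x, Bim x & x != 0.
Proof.
have d1 := deg_gt1 (ltn0Sn k).
have e1 : (0 < 1 < deg p a k.+1)%N by rewrite d1.
pose i0 := Ordinal (ltn_pmod (h + f - k.+1) f0).
have em : (p ^ i0 = eps p f h k.+1 * 1 %[mod q1])%N by rewrite muln1 expn_modn.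
have hV : V r (mono L r (unit_deg i0)) by apply: V_mono; exact: unit_deg_le.
have Bb := B_unit_mono kf e1 em.
exists (piB (mono L r (unit_deg i0))); first by exists (mono L r (unit_deg i0)).
apply/eqP => /(piB_eq0 kf' hk hV)[_ hH].
suff : (1%N == 1%N)%:R = 0 :> L by move/eqP; rewrite oner_eq0.
apply: (@inH_coef_dvd _ _ _ _ (iota_kF D) _ _ _ H k (fun n => (n == 1%N)%:R) 1) => //.
- apply: inH_ext hH => x y; rewrite (ev_unit_hmon x y kf e1 em).
  have d1' : (1 < (deg p a k.+1).+1)%N by exact: ltnW.
  rewrite (bigD1 (Ordinal d1')) //= mul1r big1 ?addr0 //.
  by move=> n; rewrite -(inj_eq val_inj) /= => /negPf ->; rewrite mul0r.
- exact: ltnW.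
- by rewrite dvdn1; case: eqP (pcharf_prime pcharL) => // ->.
Qed.

(** A simple submodule contains the image of B_(k+1) by the dichotomy, and equals it by minimality.
    So this image is the only simple submodule, hence the whole socle. *)
Lemma QsocP_step : QsocP k.+1.
Proof.
move=> x; have dich := subrep_Bim_dichotomy; split.
  move=> [[v0 hv0 ->] [s [es hs]]].
  have hin u : u \in s -> Bim u.
    move=> /hs[S [[Srep [z Sz z0] Smin] SQ Su]].
    have [h0|h1] := dich S Srep SQ; first by rewrite (h0 z Sz) eqxx in z0.
    have [h2|h2] := Smin _ subrep_Bim h1; last exact: h2.
    by have [y By y0] := Bim_neq0; rewrite (h2 y By) eqxx in y0.
  have : Bim (\sum_(u <- s) u).
    have [B0 Bl _] := subrep_Bim; rewrite big_seq; elim/big_ind: _ => // u w hu hw.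
    by rewrite -[u]scale1r; exact: Bl.
  rewrite -es => -[w hw] /(piB_eq kf' hk hv0) e.
  have {}e := e (proj1 hw).
  exists v0 => //; rewrite -[v0](subrK w) -[v0 - w]scale1r; apply: B_lin => //.
  exact: (BS H).
move=> [v hv ->]; split; first by exists v => //; case: hv.
exists [:: piB v]; split; first by rewrite big_seq1.
move=> u; rewrite inE => /eqP ->; exists Bim; split; last by exists v.
  split; [exact: subrep_Bim|exact: Bim_neq0|move=> S' hS' sub].
  apply: dich => // y /sub[w [Vw _] ->]; apply/quot_im_Qrep; by exists w.
by move=> y [w [Vw _] ->]; apply/quot_im_Qrep; exists w.
Qed.

End SocleStep.

Lemma QsocE k : (k < f)%N -> QsocP k.
Proof.
elim: k => [_ x|k IHk kf]; last by apply: QsocP_step => //; apply: IHk; exact: ltnW.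
split=> [->|[v hv ->]]; first by exists 0; [exact: B_zero|rewrite quot_pi0].
by rewrite /Qsoc /= -quot_pi0; apply/pi0_eq; rewrite subr0.
Qed.

End SocleFiltration.

(** * Valuations and reduction of polynomials *)

Section Valuations.
Context (L : fieldType) (v : L -> rat) (vP : is_valuation v).
Implicit Types (x y : L) (c d : rat).

Lemma valM x y : x != 0 -> y != 0 -> v (x * y) = v x + v y.
Proof. by case: vP => h _; exact: h. Qed.

Lemma val1 : v 1 = 0.
Proof.
have := @valM 1 1 (oner_neq0 _) (oner_neq0 _); rewrite mulr1 => /eqP.
by rewrite -subr_eq0 opprD addNKr oppr_eq0 => /eqP.
Qed.

Lemma valN1 : v (-1) = 0.
Proof.
have n1 : (-1 : L) != 0 by rewrite oppr_eq0 oner_neq0.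
have := valM n1 n1; rewrite mulrNN mulr1 val1 => /esym /eqP.
by rewrite -mulr2n mulrn_eq0 /= => /eqP.
Qed.

Lemma valX x n : x != 0 -> v (x ^+ n) = v x *+ n.
Proof.
move=> x0; elim: n => [|n IHn]; first by rewrite expr0 val1.
by rewrite exprS valM ?expf_neq0 // IHn mulrS.
Qed.

Lemma valV x : x != 0 -> v x^-1 = - v x.
Proof.
move=> x0; apply/eqP; rewrite -addr_eq0 addrC -valM ?invr_neq0 // divff //.
by rewrite val1.
Qed.

Lemma vge0 c : vge v c 0.
Proof. by rewrite /vge eqxx. Qed.

Lemma vgeD c x y : vge v c x -> vge v c y -> vge v c (x + y).
Proof.
rewrite /vge; have [->|x0] /= := eqVneq x 0; first by rewrite add0r.
have [->|y0] /= := eqVneq y 0; first by rewrite addr0 (negPf x0).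
have [//|s0] /= := eqVneq (x + y) 0.
case: vP => _ h hx hy; apply: le_trans (h x y x0 y0 s0).
by rewrite le_min hx hy.
Qed.

Lemma vgeM c d x y : vge v c x -> vge v d y -> vge v (c + d) (x * y).
Proof.
rewrite /vge; have [->|x0] /= := eqVneq x 0; first by rewrite mul0r eqxx.
have [->|y0] /= := eqVneq y 0; first by rewrite mulr0 eqxx.
by move=> hx hy; rewrite valM // lerD ?orbT.
Qed.

Lemma vge_le c d x : d <= c -> vge v c x -> vge v d x.
Proof. by move=> dc /orP[/eqP ->|h]; rewrite /vge ?eqxx // (le_trans dc h) orbT. Qed.

Lemma vgeN c x : vge v c x -> vge v c (- x).
Proof.
move=> hx; rewrite -mulN1r -[c]add0r; apply: vgeM => //.
by rewrite /vge valN1 lexx orbT.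
Qed.

Lemma vge_one : vge v 0 1.
Proof. by rewrite /vge val1 lexx orbT. Qed.

Lemma vgeX x n : vge v 0 x -> vge v 0 (x ^+ n).
Proof.
move=> hx; elim: n => [|n IHn]; first by rewrite expr0 vge_one.
by rewrite exprS -[0]addr0; exact: vgeM.
Qed.

Lemma vge_nat n : vge v 0 n%:R.
Proof.
elim: n => [|n IHn]; first exact: vge0.
by rewrite -natr1; apply: vgeD => //; exact: vge_one.
Qed.

Lemma vge_sum c (I : Type) (s : seq I) (P : pred I) (F : I -> L) :
  (forall i, P i -> vge v c (F i)) -> vge v c (\sum_(i <- s | P i) F i).
Proof.
by move=> h; apply: (big_ind (vge v c)); [exact: vge0|exact: vgeD|exact: h].
Qed.

Lemma vge_prod (I : Type) (s : seq I) (P : pred I) (F : I -> L) :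
  (forall i, P i -> vge v 0 (F i)) -> vge v 0 (\prod_(i <- s | P i) F i).
Proof.
move=> h; apply: (big_ind (vge v 0)); [exact: vge_one| |exact: h].
by move=> x y hx hy; rewrite -[0]addr0; exact: vgeM.
Qed.

Context (kappa : fieldType) (red : L -> kappa) (redP : is_residue_map v red).

Lemma red1 : red 1 = 1. Proof. by case: redP. Qed.
Lemma redD x y : vge v 0 x -> vge v 0 y -> red (x + y) = red x + red y.
Proof. by case: redP => _ h _ _; exact: h. Qed.
Lemma redM x y : vge v 0 x -> vge v 0 y -> red (x * y) = red x * red y.
Proof. by case: redP => _ _ h _; exact: h. Qed.

Lemma red0 : red 0 = 0.
Proof. by case: redP => _ _ _ h; apply/h; [rewrite /integer_of vge0|left]. Qed.

Lemma red_gt0 c x : 0 < c -> vge v c x -> red x = 0.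
Proof.
move=> c0 hx; case: redP => _ _ _ h; apply/h.
  by apply: vge_le hx; exact: ltW.
by case/orP: hx => [/eqP ->|hx]; [left|right; exact: lt_le_trans hx].
Qed.

Lemma redN x : vge v 0 x -> red (- x) = - red x.
Proof.
move=> hx; apply/eqP; rewrite -addr_eq0 -redD ?addNr ?red0 //; exact: vgeN.
Qed.

Lemma redX x n : vge v 0 x -> red (x ^+ n) = red x ^+ n.
Proof.
move=> hx; elim: n => [|n IHn]; first by rewrite !expr0 red1.
by rewrite !exprS redM ?IHn //; exact: vgeX.
Qed.

Lemma red_nat n : red n%:R = n%:R.
Proof.
elim: n => [|n IHn]; first exact: red0.
by rewrite -!natr1 redD ?IHn ?red1 ?vge_nat ?vge_one.
Qed.

Lemma red_sum (I : Type) (s : seq I) (P : pred I) (F : I -> L) :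
  (forall i, P i -> vge v 0 (F i)) ->
  red (\sum_(i <- s | P i) F i) = \sum_(i <- s | P i) red (F i).
Proof.
move=> h; suff [] : vge v 0 (\sum_(i <- s | P i) F i) /\
  red (\sum_(i <- s | P i) F i) = \sum_(i <- s | P i) red (F i) by [].
elim/big_rec2: _ => [|i y1 y2 Pi [h1 h2]]; first by rewrite vge0 red0.
by split; [apply: vgeD => //; exact: h|rewrite redD ?h2 //; exact: h].
Qed.

Lemma red_prod (I : Type) (s : seq I) (P : pred I) (F : I -> L) :
  (forall i, P i -> vge v 0 (F i)) ->
  red (\prod_(i <- s | P i) F i) = \prod_(i <- s | P i) red (F i).
Proof.
move=> h; suff [] : vge v 0 (\prod_(i <- s | P i) F i) /\
  red (\prod_(i <- s | P i) F i) = \prod_(i <- s | P i) red (F i) by [].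
elim/big_rec2: _ => [|i y1 y2 Pi [h1 h2]]; first by rewrite vge_one red1.
split; last by rewrite redM ?h2 //; exact: h.
by rewrite -[0]addr0; apply: vgeM => //; exact: h.
Qed.

Section Poly.
Context (n : nat).
Implicit Types (P Q : {mpoly L[n]}).

Definition pint c P : Prop := forall m, vge v c P@_m.

Lemma pint0 c : pint c 0.
Proof. by move=> m; rewrite mcoeff0 vge0. Qed.

Lemma pintD c P Q : pint c P -> pint c Q -> pint c (P + Q).
Proof. by move=> h1 h2 m; rewrite mcoeffD; exact: vgeD. Qed.

Lemma pintZ c d x P : vge v d x -> pint c P -> pint (d + c) (x *: P).
Proof. by move=> h1 h2 m; rewrite mcoeffZ; exact: vgeM. Qed.

Lemma pintZ0 c x P : vge v 0 x -> pint c P -> pint c (x *: P).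
Proof. by rewrite -{2}[c]add0r; exact: pintZ. Qed.

Lemma pintN c P : pint c P -> pint c (- P).
Proof. by move=> h m; rewrite mcoeffN; exact: vgeN. Qed.

Lemma pintB c P Q : pint c P -> pint c Q -> pint c (P - Q).
Proof. by move=> h1 h2; apply: pintD => //; exact: pintN. Qed.

Lemma pint_le c d P : d <= c -> pint c P -> pint d P.
Proof. by move=> dc h m; exact: vge_le (h m). Qed.

Lemma pintM c d P Q : pint c P -> pint d Q -> pint (c + d) (P * Q).
Proof.
move=> hP hQ m; rewrite mcoeffM; apply: vge_sum => i _; exact: vgeM.
Qed.

Lemma pintM0 P Q : pint 0 P -> pint 0 Q -> pint 0 (P * Q).
Proof. by rewrite -{3}[0]addr0; exact: pintM. Qed.

Lemma pint1 : pint 0 1.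
Proof. by move=> m; rewrite mcoeff1; exact: vge_nat. Qed.

Lemma pintXU i : pint 0 'X_i.
Proof. by move=> m; rewrite mcoeffX; exact: vge_nat. Qed.

Lemma pintX P k : pint 0 P -> pint 0 (P ^+ k).
Proof.
move=> h; elim: k => [|k IHk]; first exact: pint1.
by rewrite exprS; exact: pintM0.
Qed.

Lemma pint_sum c (I : Type) (s : seq I) (p : pred I) (F : I -> {mpoly L[n]}) :
  (forall i, p i -> pint c (F i)) -> pint c (\sum_(i <- s | p i) F i).
Proof.
by move=> h; apply: (big_ind (pint c)); [exact: pint0|exact: pintD|exact: h].
Qed.

Lemma pint_prod (I : Type) (s : seq I) (p : pred I) (F : I -> {mpoly L[n]}) :
  (forall i, p i -> pint 0 (F i)) -> pint 0 (\prod_(i <- s | p i) F i).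
Proof.
by move=> h; apply: (big_ind (pint 0)); [exact: pint1|exact: pintM0|exact: h].
Qed.

Local Notation redp := (map_mpoly red).

(* The library's facts on map_mpoly are for morphisms; red is one only on the
   integers. *)
Lemma mcoeff_redp P m : (redp P)@_m = red P@_m.
Proof.
rewrite /map_mpoly /mmap raddf_sum /=.
rewrite (eq_bigr (fun m' => red P@_m' * (m' == m)%:R)); last first.
  by move=> m' _; rewrite mcoeffCM mmap1_id mcoeffX.
case: (boolP (m \in msupp P)) => hm.
  rewrite (bigD1_seq m) ?msupp_uniq //= eqxx mulr1 big1 ?addr0 //.
  by move=> m' /negPf ->; rewrite mulr0.
rewrite big_seq big1 => [|m' hm']; first by rewrite memN_msupp_eq0 ?red0.
by case: eqP hm' hm => [->  ->|]; rewrite ?mulr0.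
Qed.

Lemma redpD P Q : pint 0 P -> pint 0 Q -> redp (P + Q) = redp P + redp Q.
Proof.
by move=> hP hQ; apply/mpolyP => m; rewrite mcoeffD !mcoeff_redp mcoeffD redD.
Qed.

Lemma redp0 : redp (0 : {mpoly L[n]}) = 0.
Proof. by apply/mpolyP => m; rewrite mcoeff_redp !mcoeff0 red0. Qed.

Lemma redpZ x P : vge v 0 x -> pint 0 P -> redp (x *: P) = red x *: redp P.
Proof.
by move=> hx hP; apply/mpolyP => m; rewrite mcoeffZ !mcoeff_redp mcoeffZ redM.
Qed.

Lemma redp_gt0 c P : 0 < c -> pint c P -> redp P = 0.
Proof.
by move=> c0 hP; apply/mpolyP => m; rewrite mcoeff_redp mcoeff0 (red_gt0 c0).
Qed.

Lemma redpM P Q : pint 0 P -> pint 0 Q -> redp (P * Q) = redp P * redp Q.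
Proof.
move=> hP hQ; apply/mpolyP => m; rewrite mcoeff_redp !mcoeffM red_sum.
  by apply: eq_bigr => i _; rewrite redM // !mcoeff_redp.
by move=> i _; rewrite -[0]addr0; exact: vgeM.
Qed.

Lemma redp1 : redp (1 : {mpoly L[n]}) = 1.
Proof. by apply/mpolyP => m; rewrite mcoeff_redp !mcoeff1 red_nat. Qed.

Lemma redpXU (i : 'I_n) : redp ('X_i : {mpoly L[n]}) = 'X_i.
Proof. by apply/mpolyP => m; rewrite mcoeff_redp !mcoeffX red_nat. Qed.

Lemma redpX P k : pint 0 P -> redp (P ^+ k) = redp P ^+ k.
Proof.
move=> hP; elim: k => [|k IHk]; first by rewrite !expr0 redp1.
by rewrite !exprS redpM ?IHk //; exact: pintX.
Qed.

Lemma redp_sum (I : Type) (s : seq I) (p : pred I) (F : I -> {mpoly L[n]}) :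
  (forall i, p i -> pint 0 (F i)) ->
  redp (\sum_(i <- s | p i) F i) = \sum_(i <- s | p i) redp (F i).
Proof.
move=> h; suff [] : pint 0 (\sum_(i <- s | p i) F i) /\
  redp (\sum_(i <- s | p i) F i) = \sum_(i <- s | p i) redp (F i) by [].
elim/big_rec2: _ => [|i y1 y2 Pi [h1 h2]]; first by rewrite redp0; split=> //; exact: pint0.
by split; [apply: pintD => //; exact: h|rewrite redpD ?h2 //; exact: h].
Qed.

Lemma redp_prod (I : Type) (s : seq I) (p : pred I) (F : I -> {mpoly L[n]}) :
  (forall i, p i -> pint 0 (F i)) ->
  redp (\prod_(i <- s | p i) F i) = \prod_(i <- s | p i) redp (F i).
Proof.
move=> h; suff [] : pint 0 (\prod_(i <- s | p i) F i) /\
  redp (\prod_(i <- s | p i) F i) = \prod_(i <- s | p i) redp (F i) by [].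
elim/big_rec2: _ => [|i y1 y2 Pi [h1 h2]]; first by rewrite redp1; split=> //; exact: pint1.
by split; [apply: pintM0 => //; exact: h|rewrite redpM ?h2 //; exact: h].
Qed.

Lemma pint_exp_taylor (c : L) (a b : {mpoly L[n]}) k : vge v 1 c ->
  pint 0 a -> pint 0 b ->
  pint 2 ((a + c *: b) ^+ k - (a ^+ k + c *: (k%:R *: (b * a ^+ k.-1)))).
Proof.
move=> hc ha hb; elim: k => [|k IHk].
  by rewrite !expr0 scale0r scaler0 addr0 subrr; exact: pint0.
have hc0 : vge v 0 c by apply: vge_le hc.
have hab : pint 0 (a + c *: b) by apply: pintD => //; exact: pintZ0.
set R := _ - _ in IHk.
have e : (a + c *: b) ^+ k = a ^+ k + c *: (k%:R *: (b * a ^+ k.-1)) + R.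
  by rewrite [RHS]addrC subrK.
clearbody R.
have -> : (a + c *: b) ^+ k.+1 - (a ^+ k.+1 + c *: (k.+1%:R *: (b * a ^+ k.+1.-1)))
   = (a + c *: b) * R + (c * c) *: (k%:R *: (b * b * a ^+ k.-1)).
  rewrite exprS e /= -natr1 -!mul_mpolyC !mpolyCM mpolyCD mpolyC1.
  case: k {IHk e} => [|k].
    by rewrite mpolyC0 !expr0 expr1; ring.
  by rewrite /= !exprS; ring.
apply: pintD; first by rewrite -[2]add0r; exact: pintM.
rewrite -[2 : rat]/(1 + 1) -[1 + 1]addr0; apply: pintZ; first exact: vgeM.
apply: pintZ0; first exact: vge_nat.
by apply: pintM0; [exact: pintM0|exact: pintX].
Qed.

(** The product rule, with an error of valuation at least 2. Uniqueness of [s] ensures that [j != i]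
    omits exactly one factor. *)
Lemma pint_prod_taylor (I : eqType) (s : seq I) (c : L) (A B C : I -> {mpoly L[n]}) :
  uniq s -> vge v 1 c -> (forall i, pint 0 (A i)) -> (forall i, pint 0 (B i)) ->
  (forall i, pint 2 (C i - (A i + c *: B i))) ->
  pint 2 (\prod_(i <- s) C i - (\prod_(i <- s) A i +
    c *: \sum_(i <- s) B i * \prod_(j <- s | j != i) A j)).
Proof.
move=> us hc hA hB hC; have hc0 : vge v 0 c by apply: vge_le hc.
elim: s us => [_|i s IHs /= /andP[ins us]].
  by rewrite !big_nil scaler0 addr0 subrr; exact: pint0.
have {}IHs := IHs us.
have eB : \sum_(l <- i :: s) B l * \prod_(j <- i :: s | j != l) A j =
   B i * \prod_(j <- s) A j + A i * \sum_(l <- s) B l * \prod_(j <- s | j != l) A j.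
  rewrite big_cons big_cons eqxx /=; congr (_ * _ + _).
    rewrite [RHS]big_seq [LHS]big_seq_cond; apply: eq_bigl => j.
    by case: (boolP (j \in s)) => //= js; apply: contraNneq ins => <-.
  rewrite mulr_sumr [LHS]big_seq [RHS]big_seq; apply: eq_bigr => l ls.
  rewrite big_cons; case: eqP => [e|_]; first by rewrite e ls in ins.
  by rewrite mulrCA.
rewrite eB !big_cons.
set PA := \prod_(j <- s) A j; set PC := \prod_(j <- s) C j in IHs *.
set S := \sum_(l <- s) _ in IHs *.
set R := PC - _ in IHs; have eR : PC = PA + c *: S + R by rewrite [RHS]addrC subrK.
set R' := C i - (A i + c *: B i).
have eR' : C i = A i + c *: B i + R' by rewrite [RHS]addrC subrK.
have hR' : pint 2 R' := hC i.
have hPA : pint 0 PA by apply: pint_prod => j _.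
have hS : pint 0 S.
  by apply: pint_sum => j _; apply: pintM0 => //; apply: pint_prod.
clearbody R R' PA PC S.
have -> : C i * PC - (A i * PA + c *: (B i * PA + A i * S)) =
   (A i + c *: B i) * R + R' * PC + (c * c) *: (B i * S).
  by rewrite eR' eR -!mul_mpolyC mpolyCM; ring.
have hPC : pint 0 PC.
  rewrite eR; apply: pintD; first by apply: pintD => //; exact: pintZ0.
  exact: pint_le IHs.
apply: pintD; first apply: pintD.
- rewrite -[2]add0r; apply: pintM => //; apply: pintD => //; exact: pintZ0.
- by rewrite -[2]addr0; apply: pintM.
rewrite -[2 : rat]/(1 + 1) -[1 + 1]addr0; apply: pintZ; [exact: vgeM|exact: pintM0].
Qed.

End Poly.
End Valuations.

(** * Compact induction *)

Section PadicBasics.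
Context (p f : nat) (D : padic_data p f).
Local Notation G := 'M[F D]_2.
Local Notation vF := (@vF p f D).
Local Notation vE := (@vE p f D).
Local Notation redF := (@redF p f D).
Local Notation redE := (@redE p f D).
Local Notation vFP := (vF_valuation D).

Lemma natF_alg n : (n%:R : F D) = (n%:R : Qp D)%:A.
Proof. by rewrite scaler_nat. Qed.

Lemma natE_alg n : (n%:R : E D) = (n%:R : F D)%:A.
Proof. by rewrite scaler_nat. Qed.

Lemma pF_neq0 : (p%:R : F D) != 0.
Proof.
have [_ [p0 _] _ _] := QpP D.
by rewrite natF_alg scaler_eq0 (negPf p0) oner_eq0.
Qed.

Lemma vF_p : vF p%:R = 1.
Proof. by have [_ [p0 p1] _ _] := QpP D; rewrite natF_alg vF_extends. Qed.

Lemma alg_eq0 (x : F D) : (x%:A == 0 :> E D) = (x == 0).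
Proof. by rewrite scaler_eq0 oner_eq0 orbF. Qed.

Lemma pE_neq0 : (p%:R : E D) != 0.
Proof. by rewrite natE_alg alg_eq0 pF_neq0. Qed.

Lemma vE_p : vE p%:R = 1.
Proof. by rewrite natE_alg vE_extends ?pF_neq0 // vF_p. Qed.

Lemma vge_alg c (x : F D) : vge vE c x%:A = vge vF c x.
Proof.
rewrite /vge alg_eq0; have [//|x0] := eqVneq x 0; by rewrite vE_extends.
Qed.

(** Valuations on F are integers, so a positive one is at least 1. This converts identities in the
    residue field into divisibility by p. *)
Lemma vge_unramified (x : F D) : vge vF 0 x -> redF x = 0 -> vge vF 1 x.
Proof.
move=> hx rx; have [_ _ _ h] := redFP D.
have [->|v0] := (h x hx).1 rx; first exact: vge0.
have [->|x0] := eqVneq x 0; first exact: vge0.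
rewrite /vge (negPf x0) /=; have /intrP[n en] := F_unramified x0.
move: v0; rewrite en ltr0z => n0.
by rewrite -[1]/(1%:~R) ler_int -gtz0_ge1.
Qed.

Lemma vge_frob (x : F D) : vge vF 0 x -> vge vF 0 (frob D x).
Proof.
move=> hx; rewrite -[frob D x](subrK (x ^+ p)); apply: (vgeD vFP).
  by apply: vge_le (frobP hx).
exact: (vgeX vFP).
Qed.

Lemma redF_frob (x : F D) : vge vF 0 x -> redF (frob D x) = redF x ^+ p.
Proof.
move=> hx; have h1 := frobP hx.
rewrite -{1}[frob D x](subrK (x ^+ p)) (redD (redFP D)); last 2 first.
- by apply: vge_le h1.
- exact: (vgeX vFP).
by rewrite (red_gt0 (redFP D) _ h1) // add0r (redX vFP (redFP D)).
Qed.

Lemma vge_frobn i (x : F D) : vge vF 0 x -> vge vF 0 (iter i (frob D) x).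
Proof. by move=> hx; elim: i => //= i; exact: vge_frob. Qed.

Lemma redF_frobn i (x : F D) : vge vF 0 x ->
  redF (iter i (frob D) x) = redF x ^+ (p ^ i).
Proof.
move=> hx; elim: i => [|i IHi] /=; first by rewrite expn0 expr1.
by rewrite redF_frob ?vge_frobn // IHi -exprM expnSr.
Qed.

Definition frobE (i : 'I_f) (x : F D) : E D := (iter i (frob D) x)%:A.

Lemma frobED i x y : frobE i (x + y) = frobE i x + frobE i y.
Proof. by rewrite /frobE -scalerDl; congr (_ *: _); elim: (i : nat) => //= n ->; rewrite rmorphD. Qed.

Lemma frobEM i x y : frobE i (x * y) = frobE i x * frobE i y.
Proof.
rewrite /frobE -scalerAl mul1r scalerA; congr (_ *: _).
by elim: (i : nat) => //= n ->; rewrite rmorphM.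
Qed.

Lemma frobE1 i : frobE i 1 = 1.
Proof.
rewrite /frobE; have -> : iter i (frob D) 1 = 1.
  by elim: (i : nat) => //= n ->; rewrite rmorph1.
by rewrite scale1r.
Qed.

Lemma vge_frobE i x : vge vF 0 x -> vge vE 0 (frobE i x).
Proof. by move=> hx; rewrite /frobE vge_alg vge_frobn. Qed.

Lemma redE_frobE i x : vge vF 0 x ->
  redE (frobE i x) = iota_kF D (redF x) ^+ (p ^ i).
Proof.
move=> hx; rewrite /frobE -iota_kFP; last exact: vge_frobn.
by rewrite redF_frobn // rmorphXn.
Qed.

Lemma vF_exprz (n : int) : vF (p%:R ^ n) = n%:~R.
Proof.
case: n => n; first by rewrite -exprnP (valX vFP) ?pF_neq0 // vF_p.
rewrite NegzE -exprnN (valV vFP) ?expf_neq0 ?pF_neq0 // (valX vFP) ?pF_neq0 //.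
by rewrite vF_p mulrNz.
Qed.

Lemma inKP (g : G) : reflect [/\ forall i j, vge vF 0 (g i j), \det g != 0
  & vF (\det g) = 0] (inK g).
Proof.
apply: (iffP and3P) => [[/forallP h1 h2 /eqP h3]|[h1 h2 h3]]; split=> //.
- by move=> i j; have /forallP := h1 i; exact.
- by apply/forallP => i; apply/forallP => j; exact: h1.
- by apply/eqP.
Qed.

Lemma inK_unit (g : G) : inK g -> g \in unitmx.
Proof. by case/inKP=> _ h _; rewrite unitmxE unitfE. Qed.

Lemma inK_mul (g k : G) : inK g -> inK k -> inK (g *m k).
Proof.
case/inKP=> h1 h2 h3 /inKP[k1 k2 k3]; apply/inKP; split.
- move=> i j; rewrite mulmx2E.
  by apply: (vgeD vFP); rewrite -[0]addr0; apply: (vgeM vFP).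
- by rewrite det_mulmx mulf_neq0.
- by rewrite det_mulmx (valM vFP) // h3 k3 addr0.
Qed.

Lemma inK_inv (g : G) : inK g -> inK (invmx g).
Proof.
move=> hg; have gu := inK_unit hg; case/inKP: hg => h1 h2 h3; apply/inKP; split.
- move=> i j; rewrite /invmx gu mxE mxE -[0]addr0; apply: (vgeM vFP).
    by rewrite /vge (valV vFP) // h3 oppr0 lexx orbT.
  rewrite /cofactor det_mx11 -[0]addr0; apply: (vgeM vFP); last by rewrite !mxE.
  by apply: (vgeX vFP); apply: (vgeN vFP); exact: (vge_one vFP).
- by rewrite det_inv invr_neq0.
- by rewrite det_inv (valV vFP) // h3 oppr0.
Qed.

Lemma inK_mull (g k : G) : inK g -> inK (g *m k) = inK k.
Proof.
move=> hg; apply/idP/idP => [h1|]; last exact: inK_mul.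
by rewrite -(mulKmx (inK_unit hg) k); apply: inK_mul => //; exact: inK_inv.
Qed.

Lemma inK_mulr (g k : G) : inK k -> inK (g *m k) = inK g.
Proof.
move=> hk; apply/idP/idP => [h1|h1]; last exact: inK_mul.
by rewrite -(mulmxK (inK_unit hk) g); apply: inK_mul => //; exact: inK_inv.
Qed.

Lemma inK_det0 (c : F D) (g : G) : \det g = 0 -> inK (c *: g) = false.
Proof. by move=> h; apply/negP => /inKP[_]; rewrite detZ h mulr0 eqxx. Qed.

(** A factor p^n adds 2 n to the valuation of the determinant, hence n to the floor of its half, and
    this is the power that [Kpart] removes; a factor in K adds nothing. *)
Lemma Kpart_mul (n : int) (h g : G) : inK h -> \det g != 0 ->
  Kpart (p%:R ^ n *: (h *m g)) = h *m Kpart g.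
Proof.
case/inKP=> _ h2 h3 g0; rewrite /Kpart detZ det_mulmx.
have pn0 : (p%:R ^ n : F D) != 0 by apply: expfz_neq0; exact: pF_neq0.
rewrite (valM vFP) ?expf_neq0 ?mulf_neq0 // (valX vFP) // vF_exprz (valM vFP) //.
rewrite h3 add0r -[_ *+ 2]mulr_natr mulrDl mulfK // floorDzr; last exact: intr_int.
rewrite intrKfloor -scalemxAr scalerA; congr (_ *: _).
by rewrite -expfzDr ?pF_neq0 // opprD addrAC addNr add0r.
Qed.

Lemma Kpart_mulr (g k : G) : inK k -> Kpart (g *m k) = Kpart g *m k.
Proof.
case/inKP=> _ k2 k3; rewrite /Kpart det_mulmx -scalemxAl; congr (_ ^ (- _) *: _).
have [->|g0] := eqVneq (\det g) 0; first by rewrite mul0r.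
by rewrite (valM vFP) // k3 addr0.
Qed.

Section Ind.
Context (A : nzRingType) (M : lmodType A) (act : G -> M -> M).
Context (act_lin : forall h (a : A) u v, act h (a *: u + v) = a *: act h u + act h v).
Context (actM : forall h k v, inK h -> inK k -> act (h *m k) v = act h (act k v)).
Implicit Types (g : G) (u v : M) (phi psi : G -> M).

Lemma act0 h : act h 0 = 0.
Proof. by have := act_lin h (-1) 0 0; rewrite scaler0 addr0 scaleN1r addNr. Qed.

Lemma bracket_lin g (a : A) u v :
  bracket act g (a *: u + v) = a *: bracket act g u + bracket act g v.
Proof.
apply/funext => x; rewrite /bracket !fctE.
by case: ifP => _; rewrite ?act_lin // scaler0 addr0.
Qed.

Lemma bracket0 g : bracket act g 0 = 0.
Proof. by apply/funext => x; rewrite /bracket act0; case: ifP. Qed.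

Lemma bracketZ g (a : A) u : bracket act g (a *: u) = a *: bracket act g u.
Proof. by rewrite -[a *: u]addr0 bracket_lin bracket0 addr0. Qed.

Lemma bracketD g u v : bracket act g (u + v) = bracket act g u + bracket act g v.
Proof. by rewrite -[u]scale1r bracket_lin !scale1r. Qed.

Lemma bracket_sum g (I : Type) (s : seq I) (P : pred I) (F : I -> M) :
  bracket act g (\sum_(i <- s | P i) F i) = \sum_(i <- s | P i) bracket act g (F i).
Proof. by apply: (big_morph _ (bracketD g) (bracket0 g)). Qed.

Lemma bracket_mulK g k v : inK k -> bracket act (g *m k) v = bracket act g (act k v).
Proof.
move=> hk; apply/funext => x; rewrite /bracket mulmxA Kpart_mulr // inK_mulr //.
by case: ifP => // hx; rewrite actM.
Qed.

Context (N : M -> Prop) (N0 : N 0).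
Context (N_act : forall h v, inK h -> N v -> N (act h v)).

Lemma ind_bracket g v : g \in unitmx -> N v -> ind act N (bracket act g v).
Proof.
move=> gu hv; have g0 : \det g != 0 by move: gu; rewrite unitmxE unitfE.
split.
- move=> x; rewrite unitmxE unitfE negbK => /eqP x0.
  by rewrite /bracket /Kpart inK_det0 // det_mulmx x0 mul0r.
- move=> n h x hh; rewrite unitmxE unitfE => x0.
  rewrite /bracket -scalemxAl -mulmxA Kpart_mul ?det_mulmx ?mulf_neq0 // inK_mull //.
  by case: ifP => hx; rewrite ?actM ?act0.
- by move=> x; rewrite /bracket; case: ifP => // hx; exact: N_act.
exists [:: invmx g] => x; rewrite /bracket; case: ifP => [hx _|]; last by rewrite eqxx.
exists (invmx g), (Num.floor (vF (\det (x *m g)) / 2%:R)), (Kpart (x *m g)).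
split=> //; first by rewrite inE.
rewrite -scalemxAl mulmxK // scalerA -expfzDr ?pF_neq0 // subrr expr0z.
by rewrite scale1r.
Qed.

Lemma ind_zero : ind act N (0 : G -> M).
Proof.
split=> //; first by move=> n h g _ _; rewrite act0.
by exists [::] => g; rewrite eqxx.
Qed.

Lemma ind_lin (a : A) phi psi : (forall u v, N u -> N v -> N (a *: u + v)) ->
  ind act N phi -> ind act N psi -> ind act N (a *: phi + psi).
Proof.
move=> N_lin [h1 h2 h3 [s hs]] [k1 k2 k3 [t ht]]; split.
- by move=> g gu; rewrite !fctE h1 // k1 // scaler0 addr0.
- by move=> n h g hh gu; rewrite !fctE h2 // k2 // act_lin.
- by move=> g; rewrite !fctE; exact: N_lin.
exists (s ++ t) => g; rewrite !fctE; have [p0|p0] := eqVneq (phi g) 0.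
  have [q0|q0 _] := eqVneq (psi g) 0; first by rewrite p0 q0 scaler0 addr0 eqxx.
  have [x [n [h [xt hh e]]]] := ht g q0.
  by exists x, n, h; rewrite mem_cat xt orbT.
move=> _; have [x [n [h [xs hh e]]]] := hs g p0.
by exists x, n, h; rewrite mem_cat xs.
Qed.

Lemma ind_sum (I : Type) (s : seq I) (P : pred I) (phi : I -> G -> M) :
  (forall u v, N u -> N v -> N (u + v)) ->
  (forall i, P i -> ind act N (phi i)) -> ind act N (\sum_(i <- s | P i) phi i).
Proof.
move=> N_add h; elim/big_ind: _ => [|u w hu hw|i Pi]; [exact: ind_zero| |exact: h].
by rewrite -[u]scale1r; apply: ind_lin => // x y; rewrite scale1r; exact: N_add.
Qed.

End Ind.
End PadicBasics.

(** * Reduction of substitutions and expansion to first order in p *)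

Section SubstReduction.
Context (L : fieldType) (v : L -> rat) (vP : is_valuation v).
Context (kappa : fieldType) (red : L -> kappa) (redP : is_residue_map v red).
Context (f : nat).
Local Notation polyL := {mpoly L[(f + f)%N]}.
Local Notation redp := (map_mpoly red).
Local Notation pint := (pint v).

Lemma redp_Xv (i : 'I_f) : redp (Xv L i) = Xv kappa i.
Proof. exact: (redpXU vP redP). Qed.

Lemma redp_Yv (i : 'I_f) : redp (Yv L i) = Yv kappa i.
Proof. exact: (redpXU vP redP). Qed.

Lemma pint_Xv (i : 'I_f) : pint 0 (Xv L i).
Proof. exact: (pintXU vP). Qed.

Lemma pint_Yv (i : 'I_f) : pint 0 (Yv L i).
Proof. exact: (pintXU vP). Qed.

Lemma pint_gmono r b (A B : 'I_f -> polyL) : (forall i, pint 0 (A i)) ->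
  (forall i, pint 0 (B i)) -> pint 0 (gmono r b A B).
Proof.
by move=> hA hB; apply: (pint_prod vP) => i _; apply: (pintM0 vP); exact: (pintX vP).
Qed.

Lemma redp_gmono r b (A B : 'I_f -> polyL) : (forall i, pint 0 (A i)) ->
  (forall i, pint 0 (B i)) ->
  redp (gmono r b A B) = gmono r b (fun i => redp (A i)) (fun i => redp (B i)).
Proof.
move=> hA hB; rewrite (redp_prod vP redP); last first.
  by move=> i _; apply: (pintM0 vP); exact: (pintX vP).
apply: eq_bigr => i _; rewrite (redpM vP redP) ?(redpX vP redP) //; exact: (pintX vP).
Qed.

Lemma V_redp r (P : polyL) : V r P -> V r (redp P).
Proof.
move=> hP m; rewrite mcoeff_msupp (mcoeff_redp redP) => h i; apply: hP.
rewrite mcoeff_msupp; apply: contra_neq h => ->; exact: red0 redP.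
Qed.

Lemma redp_expand r (P : polyL) : V r P -> pint 0 P ->
  redp P = \sum_(m <- msupp P) red P@_m *: mono kappa r (fun i => m (rshift f i)).
Proof.
move=> hV hP; rewrite {1}(V_expand hV) (redp_sum vP redP).
  apply: eq_bigr => m _; rewrite (redpZ redP) //.
    rewrite redp_gmono; [|exact: pint_Xv|exact: pint_Yv].
    by congr (_ *: _); apply: eq_bigr => i _; rewrite redp_Xv redp_Yv.
  by apply: pint_gmono; [exact: pint_Xv|exact: pint_Yv].
by move=> m _; apply: (pintZ0 vP) => //; apply: pint_gmono; [exact: pint_Xv|exact: pint_Yv].
Qed.

Lemma substXY_expand (R : comNzRingType) r PX PY (P : {mpoly R[(f + f)%N]}) : V r P ->
  substXY PX PY P = \sum_(m <- msupp P) P@_m *: gmono r (fun i => m (rshift f i)) PX PY.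
Proof.
move=> hV; rewrite {1}(V_expand hV) substXY_sum; apply: eq_bigr => m _.
by rewrite substXYZ substXY_mono.
Qed.

Lemma pint_substXY r PX PY (P : polyL) : V r P -> pint 0 P ->
  (forall i, pint 0 (PX i)) -> (forall i, pint 0 (PY i)) -> pint 0 (substXY PX PY P).
Proof.
move=> hV hP hX hY; rewrite (substXY_expand _ _ hV); apply: (pint_sum vP) => m _.
by apply: (pintZ0 vP) => //; exact: pint_gmono.
Qed.

Lemma redp_substXY r PX PY (P : polyL) : V r P -> pint 0 P ->
  (forall i, pint 0 (PX i)) -> (forall i, pint 0 (PY i)) ->
  redp (substXY PX PY P) =
  substXY (fun i => redp (PX i)) (fun i => redp (PY i)) (redp P).
Proof.
move=> hV hP hX hY; rewrite (substXY_expand _ _ hV) (redp_sum vP redP); last first.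
  by move=> m _; apply: (pintZ0 vP) => //; exact: pint_gmono.
rewrite (redp_expand hV hP) substXY_sum; apply: eq_bigr => m _.
by rewrite (redpZ redP) ?substXYZ ?substXY_mono ?redp_gmono //; exact: pint_gmono.
Qed.

Lemma gmono_unit (R : comNzRingType) (r : 'I_f -> nat) (i : 'I_f)
    (A B : 'I_f -> {mpoly R[(f + f)%N]}) :
  gmono r (unit_deg i) A B = B i * A i ^+ (r i).-1 * \prod_(j | j != i) A j ^+ r j.
Proof.
rewrite /gmono (bigD1 i) //= /unit_deg eqxx subn1 expr1 [A i ^+ _ * _]mulrC.
by congr (_ * _); apply: eq_bigr => j /negPf ->; rewrite subn0 expr0 mulr1.
Qed.

Lemma gmono_zero (R : comNzRingType) (r : 'I_f -> nat)
    (A B : 'I_f -> {mpoly R[(f + f)%N]}) :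
  gmono r (fun=> 0%N) A B = \prod_j A j ^+ r j.
Proof. by apply: eq_bigr => j _; rewrite subn0 expr0 mulr1. Qed.

Lemma gmonoZ (R : comNzRingType) (r b : 'I_f -> nat) (c : R)
    (A B : 'I_f -> {mpoly R[(f + f)%N]}) :
  gmono r b (fun i => c *: A i) B = (\prod_i c ^+ (r i - b i)) *: gmono r b A B.
Proof.
rewrite /gmono -mul_mpolyC rmorph_prod -big_split; apply: eq_bigr => i _ /=.
by rewrite exprZn -scalerAl mul_mpolyC.
Qed.

(* If the l-combination of the zeroth-order terms is divisible by c (= p), the
   quotient by c reduces to its first-order part plus a multiple of the
   zeroth-order monomial. *)
Lemma taylor_reduction (I : finType) (r : 'I_f -> nat) (c : L) (mu : I -> L)
    (al be : I -> 'I_f -> L) (S S' : 'I_f -> polyL) :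
  v c = 1 -> c != 0 -> (forall l, vge v 0 (mu l)) ->
  (forall l i, vge v 0 (al l i)) -> (forall l i, vge v 0 (be l i)) ->
  (forall i, pint 0 (S i)) -> (forall i, pint 0 (S' i)) ->
  vge v 1 (\sum_l mu l * \prod_i al l i ^+ r i) ->
  let T := c^-1 *: \sum_l mu l *: \prod_i (al l i *: S i + c *: (be l i *: S' i)) ^+ r i in
  pint 0 T /\ exists kap, redp T =
    kap *: gmono r (fun=> 0%N) (fun i => redp (S i)) (fun i => redp (S' i)) +
    \sum_i (\sum_l red (mu l) * ((r i)%:R * red (be l i) * (red (al l i) ^+ (r i).-1 *
       \prod_(j | j != i) red (al l j) ^+ r j))) *:
      gmono r (unit_deg i) (fun i => redp (S i)) (fun i => redp (S' i)).
Proof.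
move=> vc c0 hmu hal hbe hS hS' hcst T.
have hc : vge v 1 c by rewrite /vge vc lexx orbT.
pose A l i := (al l i *: S i) ^+ r i.
pose Bt l i := (r i)%:R *: ((be l i *: S' i) * (al l i *: S i) ^+ (r i).-1).
have haS l i : pint 0 (al l i *: S i) by apply: (pintZ0 vP).
have hbS l i : pint 0 (be l i *: S' i) by apply: (pintZ0 vP).
have hA l i : pint 0 (A l i) by apply: (pintX vP).
have hB l i : pint 0 (Bt l i).
  apply: (pintZ0 vP); first exact: (vge_nat vP).
  by apply: (pintM0 vP) => //; exact: (pintX vP).
pose Rl l := \prod_i (al l i *: S i + c *: (be l i *: S' i)) ^+ r i -
   (\prod_i A l i + c *: \sum_i Bt l i * \prod_(j | j != i) A l j).
have hR l : pint 2 (Rl l).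
  apply: (pint_prod_taylor vP (C := fun i => (al l i *: S i + c *: (be l i *: S' i)) ^+ r i)).
  - exact: index_enum_uniq.
  - exact: hc.
  - exact: hA.
  - exact: hB.
  - by move=> i; apply: (pint_exp_taylor vP).
pose cst := \sum_l mu l * \prod_i al l i ^+ r i.
pose W := \sum_l mu l *: \sum_i Bt l i * \prod_(j | j != i) A l j.
pose Rt := \sum_l mu l *: Rl l.
have prodA l : \prod_i A l i = (\prod_i al l i ^+ r i) *:
    gmono r (fun=> 0%N) S S'.
  rewrite gmono_zero -mul_mpolyC rmorph_prod -big_split /=; apply: eq_bigr => i _.
  by rewrite /A exprZn mul_mpolyC.
have hg0 : pint 0 (gmono r (fun=> 0%N) S S') by exact: pint_gmono.
have TE : T = (c^-1 * cst) *: gmono r (fun=> 0%N) S S' + W + c^-1 *: Rt.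
  have -> : T = c^-1 *: \sum_l (mu l *: \prod_i A l i +
      c *: (mu l *: \sum_i Bt l i * \prod_(j | j != i) A l j) + mu l *: Rl l).
    congr (_ *: _); apply: eq_bigr => l _; rewrite scalerA [c * _]mulrC -scalerA -!scalerDr.
    by congr (_ *: _); rewrite /Rl [RHS]addrC subrK.
  rewrite !big_split /= -scaler_sumr !scalerDr scalerA mulVf // scale1r.
  congr (_ + _ + _); rewrite /cst mulr_sumr scaler_suml scaler_sumr; apply: eq_bigr => l _.
  by rewrite prodA !scalerA !mulrA.
have hW : pint 0 W.
  apply: (pint_sum vP) => l _; apply: (pintZ0 vP) => //; apply: (pint_sum vP) => i _.
  by apply: (pintM0 vP) => //; apply: (pint_prod vP).
have hcV : vge v (-1) c^-1 by rewrite /vge (valV vP) // vc lexx orbT.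
(* The remainder has valuation at least 2, so it still reduces to 0 after division by c. *)
have hRt : pint 1 (c^-1 *: Rt).
  apply: (@pint_le _ _ _ (-1 + 2)) => //; apply: (pintZ vP) => //; apply: (pint_sum vP) => l _.
  exact: (pintZ0 vP).
have hk : vge v 0 (c^-1 * cst).
  by apply: (@vge_le _ _ (-1 + 1)) => //; apply: (vgeM vP).
have hk0 : pint 0 ((c^-1 * cst) *: gmono r (fun=> 0%N) S S') by apply: (pintZ0 vP).
have hRt0 : pint 0 (c^-1 *: Rt) by apply: pint_le hRt.
have hs := pintD vP hk0 hW.
rewrite TE; split; first exact: (pintD vP).
exists (red (c^-1 * cst)).
rewrite (redpD redP) // (redpD redP) // (redpZ redP) // redp_gmono //.
rewrite (redp_gt0 redP _ hRt) // addr0; congr (_ + _).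
rewrite /W (redp_sum vP redP); last first.
  move=> l _; apply: (pintZ0 vP) => //; apply: (pint_sum vP) => i _.
  by apply: (pintM0 vP) => //; apply: (pint_prod vP).
rewrite (eq_bigr (fun l => \sum_i (red (mu l) * ((r i)%:R * red (be l i) *
   (red (al l i) ^+ (r i).-1 * \prod_(j | j != i) red (al l j) ^+ r j))) *:
    gmono r (unit_deg i) (fun i => redp (S i)) (fun i => redp (S' i)))).
  by rewrite exchange_big; apply: eq_bigr => i _; rewrite scaler_suml.
move=> l _; rewrite (redpZ redP) //; last first.
  apply: (pint_sum vP) => i _; by apply: (pintM0 vP) => //; apply: (pint_prod vP).
rewrite (redp_sum vP redP); last first.
  by move=> i _; apply: (pintM0 vP) => //; apply: (pint_prod vP).
rewrite scaler_sumr; apply: eq_bigr => i _; rewrite -scalerA; congr (_ *: _).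
have hp : pint 0 ((al l i *: S i) ^+ (r i).-1) by apply: (pintX vP).
rewrite (redpM vP redP) //; last by apply: (pint_prod vP).
rewrite (redpZ redP) ?(vge_nat vP) //; last by apply: (pintM0 vP).
rewrite (redpM vP redP) // (redpZ redP) // (redpX vP redP) // (redpZ redP) //.
rewrite (red_nat vP redP) (redp_prod vP redP) // gmono_unit exprZn.
rewrite (eq_bigr (fun j => (red (al l j) ^+ r j)%:MP * redp (S j) ^+ r j)); last first.
  move=> j _; rewrite /A (redpX vP redP) // (redpZ redP) // exprZn.
  by rewrite mul_mpolyC.
rewrite big_split /= -rmorph_prod -!mul_mpolyC !mpolyCM.
by ring.
Qed.

End SubstReduction.

Lemma addr_sub_mid (V : zmodType) (x y z : V) : x + (y + z) - y = x + z.
Proof. by rewrite addrCA [y + _]addrC addrK. Qed.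

Lemma dvdn_sub_unique q m n j j0 : (0 < m)%N -> (m + n = q + j0)%N -> (j0 < q)%N ->
  (j <= n)%N -> (q %| m + n - j)%N -> j = j0.
Proof.
move=> m0 e jq jn /dvdnP[[|[|s]] hs]; [lia|lia|exfalso].
move: hs; rewrite !mulSn; lia.
Qed.

(** Counted cyclically from h + 2, the index h + 1 comes last, at offset f - 1 = k + 1, and h comes
    just before it, at offset k. *)
Lemma cyclic_offset f k h i : f = k.+2 -> (i < f)%N -> (h < f)%N ->
  i <> (h.+1 %% f)%N ->
  exists2 j, (j <= k)%N & (h + 2 + j = i %[mod f])%N /\ (j = k -> i = h).
Proof.
move=> fk hi hh ne.
have e1 : (h.+1 %% f)%N = if h.+1 == f then 0%N else h.+1.
  by case: eqP => [->|e]; [exact: modnn|apply: modn_small; lia].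
case: (leqP (h + 2) i) => h1.
  exists (i - (h + 2))%N; first by lia.
  by split; [rewrite subnKC|lia].
have le : (h + 2 <= i + f)%N by move: ne; rewrite e1; case: eqP => e; lia.
exists (i + f - (h + 2))%N; first by move: ne; rewrite e1; case: eqP => e; lia.
by split; [rewrite subnKC ?modnDr|lia].
Qed.

(** * The relation in the image of T - a_p *)

Section HeckeRelation.
Context (p f : nat) (D : padic_data p f) (r : 'I_f -> nat) (a : nat) (h : 'I_f).
Context (H : congruent_degrees p (kF D) (Fbar D) r a h).
Context (k : nat) (fk : f = k.+2).
Context (r_h1 : a = 1%N -> (p %| r h)%N).
Local Notation K := (kF D).
Local Notation L := (Fbar D).
Local Notation iota := (iota_kF D).
Local Notation polyE := {mpoly (E D)[(f + f)%N]}.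
Local Notation B := (@B p f K L iota r a h).
Local Notation act := (@Vr_act p f D).
Local Notation q1 := (p ^ f).-1.
Local Notation A := (deg p a k.+1).
Local Notation ep := (eps p f h k.+1).
Local Notation i1 := (ordS h).
Local Notation vF := (@vF p f D).
Local Notation vE := (@vE p f D).
Local Notation redF := (@redF p f D).
Local Notation redE := (@redE p f D).
Local Notation vFP := (vF_valuation D).
Local Notation vEP := (vE_valuation D).
Local Notation pint := (@pint _ vE (f + f)).
Local Notation redp := (map_mpoly redE).

Let pcharL : p \in [pchar L] := cd_pchar H.
Let cardK : #|K| = (p ^ f)%N := cd_card H.
Let cK : #|K|.-1 = q1. Proof. by rewrite cardK. Qed.
Let kf : (k.+1 < f)%N. Proof. by rewrite fk. Qed.
Let kf' : (k < f)%N := ltnW kf.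
Let pp : prime p := pcharf_prime pcharL.
Let p0 : (0 < p)%N := prime_gt0 pp.
Let ep0 : (0 < ep)%N := eps_gt0 H k.+1.
Let pA : (p %| A)%N. Proof. by rewrite degS dvdn_mulr. Qed.
Let A_lt : (A < q1)%N := deg_lt_q1 H kf (ltn0Sn k).
Let A_gt1 : (1 < A)%N := deg_gt1 H (ltn0Sn k).
Let qE : (p ^ f = q1.+1)%N. Proof. by rewrite prednK // expn_gt0 p0. Qed.

(** As k + 1 = f - 1, the exponent [ep] is p^(h + 1): the variable Y_(h+1) has index 1 at the top
    level. *)
Lemma expn_i1 : (p ^ i1 = ep * 1 %[mod q1])%N.
Proof. by rewrite muln1 /= (expn_modn H) /eps; congr (p ^ _ %% _)%N; lia. Qed.

(** Expand (l - nu)^(ep n) in powers of l^ep. The exponent m + n - j of l^ep stays positive and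
    below 2 (q - 1), so the sum over l retains only m + n - j = q - 1, that is j = j0. *)
Lemma powsum_conv m n j0 (nu : K) : (0 < m <= q1)%N -> (m + n = q1 + j0)%N ->
  (j0 < q1)%N ->
  \sum_(l : K) iota l ^+ (ep * m) * iota (l - nu) ^+ (ep * n) =
  - ('C(n, j0)%:R * (- iota nu ^+ ep) ^+ j0).
Proof.
case/andP=> m0 mq e jq.
have jn : (j0 < n.+1)%N by lia.
have -> : \sum_(l : K) iota l ^+ (ep * m) * iota (l - nu) ^+ (ep * n) =
   \sum_(l : K) \sum_(j < n.+1) 'C(n, j)%:R * (- iota nu ^+ ep) ^+ j *
      iota l ^+ (ep * (m + n - j)).
  apply: eq_bigr => l _.
  have -> : iota (l - nu) ^+ (ep * n) = (iota l ^+ ep - iota nu ^+ ep) ^+ n.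
    rewrite exprM; congr (_ ^+ _); apply/eqP; rewrite eq_sym subr_eq; apply/eqP.
    by rewrite -(exprD_eps H) -rmorphD subrK.
  rewrite exprDn mulr_sumr; apply: eq_bigr => j _.
  have jle : (j <= n)%N by rewrite -ltnS.
  rewrite -addnBA // mulnDr exprD -!exprM -mulr_natl; ring.
rewrite exchange_big /= (bigD1 (Ordinal jn)) //= [X in _ + X]big1 => [|j ne].
  have -> : (m + n - j0 = q1)%N by lia.
  rewrite -mulr_sumr iota_powsum ?cK; last by rewrite muln_gt0 ep0; lia.
  by rewrite dvdn_mull // addr0 mulrN1.
have jle : (j <= n)%N by rewrite -ltnS.
rewrite -mulr_sumr iota_powsum ?cK; last by rewrite muln_gt0 ep0; lia.
rewrite Gauss_dvdr ?(coprime_eps H) //.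
case: (boolP (q1 %| _)%N) => [d|_]; last by rewrite oppr0 mulr0.
by move/eqP: ne; case; apply: val_inj; exact: dvdn_sub_unique m0 e jq jle d.
Qed.

Section Relation.
Context (t : nat) (tA : (t.+1 < A)%N) (pt : ~~ (p %| t.+1)%N).

(** In units of [ep], l - nu has exponent A at order zero and A - 1 at order one. As (q - A + t) + A
    = (q - 1) + (t + 1) and (q - A + t) + (A - 1) = (q - 1) + t, [powsum_conv] yields C(A, t + 1)
    and C(A - 1, t). *)
Definition mexp : nat := (ep * (p ^ f - A + t))%N.
Definition mu (l : K) : E D := (teich l ^+ mexp)%:A.

Let mt_gt0 : (0 < p ^ f - A + t)%N.
Proof. by rewrite qE; lia. Qed.
Let mt_lt : (p ^ f - A + t < q1)%N.
Proof. by rewrite qE; lia. Qed.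
Lemma teich_int (l : K) : vge vF 0 (teich l).
Proof. by have [] := teichP l. Qed.

Lemma red_teich (l : K) : redF (teich l) = l.
Proof. by have [] := teichP l. Qed.

Lemma mu_int l : vge vE 0 (mu l).
Proof. by rewrite /mu vge_alg; apply: (vgeX vFP); exact: teich_int. Qed.

Lemma red_mu l : redE (mu l) = iota l ^+ mexp.
Proof.
rewrite /mu -iota_kFP; last by apply: (vgeX vFP); exact: teich_int.
rewrite (redX vFP (redFP D)) ?red_teich ?rmorphXn //; exact: teich_int.
Qed.

(** The translate of Y^r by k_l ([VE_act_k_]). *)
Definition Pl (l : K) : polyE :=
  \prod_i (frobE i (teich l) *: Xv (E D) i + Yv (E D) i) ^+ r i.
Definition P : polyE := \sum_l mu l *: Pl l.
Definition Pp : polyE := p%:R^-1 *: P.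

Lemma V_Pl l : V r (Pl l).
Proof.
have -> : Pl l = gmono r r (@Xv f (E D))
   (fun i => frobE i (teich l) *: Xv (E D) i + 1 *: Yv (E D) i).
  by apply: eq_bigr => i _; rewrite subnn mul1r scale1r.
by apply: V_gmono => // i; [exact: V_Xv|exact: V_linear_form].
Qed.

Lemma V_Pp : V r Pp.
Proof. by apply: V_scale; apply: V_sum => l _; apply: V_scale; exact: V_Pl. Qed.

Definition Bop (nu : K) : polyE -> polyE := substXY (@Xv f _)
  (fun i => (- (teich nu)%:A) ^+ (p ^ i) *: Xv (E D) i + p%:R *: Yv (E D) i).
Definition Cop : polyE -> polyE :=
  substXY (fun i => p%:R *: Xv (E D) i) (@Yv f _).

Lemma V_Bop nu v : V r v -> V r (Bop nu v).
Proof. by apply: V_substXY => i; [exact: V_Xv|exact: V_linear_form]. Qed.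

Lemma V_Cop v : V r v -> V r (Cop v).
Proof. by apply: V_substXY => i; [apply: V_scale; exact: V_Xv|exact: V_Yv]. Qed.

(** The coefficient of X_i in the image of the i-th factor of [Pl l] under [Bop nu]. Only its
    reduction (l - nu)^(p^i) matters. *)
Definition dl (nu l : K) (i : 'I_f) : F D :=
  iter i (frob D) (teich l) + (- teich nu) ^+ (p ^ i).

Lemma dl_alg nu l (i : 'I_f) : (dl nu l i)%:A = frobE i (teich l) + (- (teich nu)%:A) ^+ (p ^ i) :> E D.
Proof.
rewrite /dl scalerDl /frobE; congr (_ + _).
by rewrite -[LHS]/(in_alg (E D) _) rmorphXn rmorphN.
Qed.

Lemma dl_int nu l i : vge vF 0 (dl nu l i).
Proof.
apply: (vgeD vFP); first by apply: vge_frobn; exact: teich_int.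
by apply: (vgeX vFP); apply: (vgeN vFP); exact: teich_int.
Qed.

Lemma red_dl nu l i : iota (redF (dl nu l i)) = iota (l - nu) ^+ (p ^ i).
Proof.
have tn := teich_int nu; have tl := teich_int l.
rewrite /dl (redD (redFP D)); last 2 first.
- exact: vge_frobn.
- by apply: (vgeX vFP); apply: (vgeN vFP).
rewrite redF_frobn // (redX vFP (redFP D)) ?(redN vFP (redFP D)) ?red_teich //; last exact: (vgeN vFP).
by rewrite rmorphD !rmorphXn rmorphB rmorphN (exprD_pchar pcharL).
Qed.

Lemma total_prod (x : L) : \prod_(i < f) (x ^+ (p ^ i)) ^+ r i = x ^+ total p r.
Proof.
rewrite /total expr_sum; apply: eq_bigr => i _; by rewrite -exprM mulnC.
Qed.

Lemma total_prod_unit (i : 'I_f) (x : L) :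
  (x ^+ (p ^ i)) ^+ (r i).-1 * \prod_(j < f | j != i) (x ^+ (p ^ j)) ^+ r j =
  x ^+ (total p r - p ^ i).
Proof.
have ri0 : (0 < r i)%N by apply: leq_trans (cd_r H i); rewrite expn_gt0 p0.
rewrite /total [in RHS](bigD1 i) //=; set S := (\sum_(j < f | j != i) r j * p ^ j)%N.
have -> : (r i * p ^ i + S - p ^ i = (r i).-1 * p ^ i + S)%N.
  by rewrite -{1}(prednK ri0) mulSn -addnA addKn.
rewrite exprD expr_sum -exprM mulnC; congr (_ * _).
by apply: eq_bigr => j _; rewrite -exprM mulnC.
Qed.

(* The terms of the first-order expansion other than i1 have level at most k:
   p ^ i = eps k * p ^ j with j <= k. *)
Lemma B_other i : i != i1 ->
  B k ((r i)%:R *: mono L r (unit_deg i)).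
Proof.
move=> ne.
have ne' : (i : nat) <> (h.+1 %% f)%N by move=> e; move/eqP: ne; apply; exact: val_inj.
have [j jk [ej jh]] := cyclic_offset fk (ltn_ord i) (ltn_ord h) ne'.
have em : (p ^ i = eps p f h k * p ^ j %[mod q1])%N.
  rewrite /eps -expnD -(expn_modn H (_ + _)) -(expn_modn H i).
  congr (p ^ _ %% _)%N; rewrite -ej; congr (_ %% _)%N.
  have aux x y : y = k.+2 -> (x + y - k = x + 2)%N by clear; lia.
  by rewrite (aux _ _ fk).
case: (boolP (p ^ j < deg p a k)%N) => hj.
  rewrite -[_ *: _]addr0; apply: B_lin; last exact: B_zero.
  by apply: (B_unit_mono H kf' _ em); rewrite hj expn_gt0 p0.
(* The index p^j reaches a p^k only for a = 1 and j = k, that is i = h; there the coefficient r_h is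
   0 in characteristic p. *)
have [ea ejk] : a = 1%N /\ j = k.
  have a0 := cd_a0 H; move: hj; rewrite -leqNgt /deg => hj.
  have le : (a * p ^ k <= p ^ k)%N.
    by apply: leq_trans hj _; rewrite leq_pexp2l.
  have pk0 : (0 < p ^ k)%N by rewrite expn_gt0 p0.
  have a1 : a = 1%N.
    by apply/eqP; rewrite eqn_leq a0 andbT -(leq_pmul2r pk0) mul1n.
  split=> //; apply/eqP; rewrite eqn_leq jk -(leq_exp2l _ _ (prime_gt1 pp)).
  by move: hj; rewrite a1 mul1n.
have ih : i = h by apply: val_inj; exact: jh.
have -> : ((r i)%:R : L) = 0.
  by apply/eqP; rewrite -(dvdn_pcharf pcharL) ih r_h1.
by rewrite scale0r; exact: B_zero.
Qed.

(** Order zero has a coefficient reducing to a multiple of C(A, t + 1), which is 0; its quotient by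
    p leaves a multiple of X^r, of every level. At order one the terms with i != h + 1 have level k
    by [B_other], and the sum over l at i = h + 1 is given by [powsum_conv]. *)
Lemma Bop_Pp nu : pint 0 (Bop nu Pp) /\
  B k (redp (Bop nu Pp) - ((r i1)%:R * - ('C(A.-1, t)%:R * (- iota nu ^+ ep) ^+ t)) *:
        mono L r (unit_deg i1)).
Proof.
have fi := @taylor_reduction _ _ vEP _ _ (redEP D) f K r p%:R mu
  (fun l i => (dl nu l i)%:A) (fun _ _ => 1) (@Xv f (E D)) (@Yv f (E D))
  (vE_p D) (pE_neq0 D) mu_int.
case: fi.
- by move=> l i; rewrite vge_alg; exact: dl_int.
- by move=> _ _; exact: (vge_one vEP).
- exact: (pint_Xv vEP).
- exact: (pint_Yv vEP).
(* E may be ramified, so the sum is moved to F, where a zero residue gives valuation at least 1. *)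
- have -> : \sum_l mu l * \prod_i (dl nu l i)%:A ^+ r i =
     (\sum_l teich l ^+ mexp * \prod_i dl nu l i ^+ r i)%:A.
    rewrite -[RHS]/(in_alg (E D) _) rmorph_sum; apply: eq_bigr => l _.
    by rewrite rmorphM rmorph_prod; congr (_ * _); apply: eq_bigr => i _; rewrite rmorphXn.
  have hl l : vge vF 0 (teich l ^+ mexp * \prod_i dl nu l i ^+ r i).
    rewrite -[0 : rat]addr0; apply: (vgeM vFP).
      by apply: (vgeX vFP); exact: teich_int.
    by apply: (vge_prod vFP) => i _; apply: (vgeX vFP); exact: dl_int.
  rewrite vge_alg; apply: vge_unramified; first by apply: (vge_sum vFP).
  apply: (fmorph_inj iota); rewrite rmorph0 (red_sum vFP (redFP D)) // rmorph_sum.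
  rewrite (eq_bigr (fun l => iota l ^+ (ep * (p ^ f - A + t)) * iota (l - nu) ^+ (ep * A))).
    rewrite (powsum_conv (j0 := t.+1)); last 1 first.
    - by apply: ltn_trans tA A_lt.
    - have /eqP -> : ('C(A, t.+1)%:R : L) == 0.
        by rewrite -(dvdn_pcharf pcharL) prime_dvd_bin_pred.
      by rewrite mul0r oppr0.
    - by rewrite mt_gt0 ltnW.
    - by rewrite qE; lia.
  move=> l _; rewrite (redM (redFP D)); last 2 first.
  - by apply: (vgeX vFP); exact: teich_int.
  - by apply: (vge_prod vFP) => i _; apply: (vgeX vFP); exact: dl_int.
  rewrite (redX vFP (redFP D)) ?red_teich; last exact: teich_int.
  rewrite (red_prod vFP (redFP D)); last by move=> i _; apply: (vgeX vFP); exact: dl_int.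
  rewrite rmorphM rmorphXn rmorph_prod; congr (_ * _).
  rewrite (eq_bigr (fun i : 'I_f => (iota (l - nu) ^+ (p ^ i)) ^+ r i)); last first.
    by move=> i _; rewrite (redX vFP (redFP D)) ?rmorphXn ?red_dl //; exact: dl_int.
  rewrite total_prod; apply: iota_exp_modn.
  - exact: total_r_gt0 H.
  - by rewrite muln_gt0 ep0; lia.
  - by rewrite cK (eps_deg H).
have -> : p%:R^-1 *: (\sum_l mu l *:
    \prod_i ((dl nu l i)%:A *: Xv (E D) i + p%:R *: (1 *: Yv (E D) i)) ^+ r i) = Bop nu Pp.
  rewrite /Bop /Pp /P substXYZ substXY_sum; congr (_ *: _); apply: eq_bigr => l _.
  rewrite substXYZ; congr (_ *: _); rewrite /Pl substXY_prod; apply: eq_bigr => i _.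
  rewrite substXY_exp; congr (_ ^+ _).
  by rewrite substXYD substXYZ substXY_Xv substXY_Yv addrA -scalerDl scale1r dl_alg.
move=> h1 [kap hkap]; split=> //; rewrite hkap.
set c := (_ * - _).
have gX b : gmono r b (fun i => redp (Xv (E D) i)) (fun i => redp (Yv (E D) i)) = mono L r b.
  by apply: eq_bigr => i _; rewrite (redp_Xv vEP (redEP D)) (redp_Yv vEP (redEP D)).
rewrite gX (eq_bigr (fun i : 'I_f => (\sum_l iota l ^+ mexp *
    iota (l - nu) ^+ (total p r - p ^ i)) *: ((r i)%:R *: mono L r (unit_deg i)))); last first.
  move=> i _; rewrite gX scalerA mulr_suml; congr (_ *: _); apply: eq_bigr => l _.
  have rd j : redE (dl nu l j)%:A = iota (l - nu) ^+ (p ^ j).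
    by rewrite -iota_kFP ?red_dl //; exact: dl_int.
  rewrite red_mu (red1 (redEP D)) mulr1 rd.
  rewrite (eq_bigr (fun j : 'I_f => (iota (l - nu) ^+ (p ^ j)) ^+ r j)); last first.
    by move=> j _; rewrite rd.
  by rewrite total_prod_unit mulrCA [RHS]mulrC.
rewrite (bigD1 i1) //=.
have -> : (\sum_l iota l ^+ mexp * iota (l - nu) ^+ (total p r - p ^ i1)) *:
   ((r i1)%:R *: mono L r (unit_deg i1)) = c *: mono L r (unit_deg i1).
  rewrite scalerA mulrC; congr (_ * _ *: _).
  rewrite -(powsum_conv nu (m := p ^ f - A + t) (n := A.-1)); last 1 first.
  - by apply: ltn_trans A_lt; exact: ltnW.
  - apply: eq_bigr => l _; congr (_ * _); apply: iota_exp_modn.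
    + by rewrite subn_gt0 (expn_lt_total H).
    + by rewrite muln_gt0 ep0; lia.
    + rewrite cK; apply/eqP; rewrite -(eqn_modDr (p ^ i1)) subnK; last first.
        exact: ltnW (expn_lt_total H _).
      rewrite -[X in (_ == X)%N]modnDmr expn_i1 modnDmr -mulnDr addn1 prednK ?(eps_deg H) //.
      exact: ltnW.
  - by rewrite mt_gt0 ltnW.
  - by rewrite qE; lia.
rewrite addr_sub_mid.
apply: B_lin; first exact: (B_Xr _ H).
elim/big_ind: _ => [|u w hu hw|i ne]; first exact: B_zero.
  by rewrite -[u]scale1r; exact: B_lin.
rewrite -[_ *: _]addr0; apply: B_lin; [exact: B_other|exact: B_zero].
Qed.

Definition wmat : 'M[K]_2 := mat2 0 1 1 0.

Lemma act_wmat d b : act wmat (mono L d b) = gmono d b (@Yv f L) (@Xv f L).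
Proof.
rewrite /Vr_act /poly_act substXY_mono; apply: eq_bigr => i _.
have z0 : (0 : L) ^+ (p ^ i) = 0 by rewrite expr0n expn_eq0 eqn0Ngt p0.
by rewrite !mxE /= rmorph0 rmorph1 z0 expr1n !scale0r !scale1r add0r addr0.
Qed.

(** The factors become Y_i + p frob^i([l]) X_i, with X and Y in exchanged roles. Order zero is a
    power sum of exponent ep (q - A + t), which vanishes since 0 < q - A + t < q - 1. At order one
    and i = h + 1 the exponent is congruent to ep (q - A + t + 1), a multiple of q - 1 only if t + 2
    = A. *)
Lemma Cop_Pp : pint 0 (Cop Pp) /\
  B k (redp (Cop Pp) - (if t.+2 == A then - (r i1)%:R else 0) *:
        act wmat (mono L r (unit_deg i1))).
Proof.
have fi := @taylor_reduction _ _ vEP _ _ (redEP D) f K r p%:R mu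
  (fun _ _ => 1) (fun l i => frobE i (teich l)) (@Yv f (E D)) (@Xv f (E D))
  (vE_p D) (pE_neq0 D) mu_int.
case: fi.
- by move=> _ _; exact: (vge_one vEP).
- by move=> l i; apply: vge_frobE; exact: teich_int.
- exact: (pint_Yv vEP).
- exact: (pint_Xv vEP).
- have -> : \sum_l mu l * \prod_(i < f) (1 : E D) ^+ r i = (\sum_l teich l ^+ mexp)%:A.
    rewrite -[RHS]/(in_alg (E D) _) rmorph_sum; apply: eq_bigr => l _.
    by rewrite big1 ?mulr1 // => i _; rewrite expr1n.
  have hl (l : K) : vge vF 0 (teich l ^+ mexp) by apply: (vgeX vFP); exact: teich_int.
  rewrite vge_alg; apply: vge_unramified; first by apply: (vge_sum vFP).
  apply: (fmorph_inj iota); rewrite rmorph0 (red_sum vFP (redFP D)) // rmorph_sum.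
  rewrite (eq_bigr (fun l => iota l ^+ mexp)); last first.
    move=> l _; rewrite (redX vFP (redFP D)) ?red_teich ?rmorphXn //; exact: teich_int.
  rewrite iota_powsum /mexp ?cK; last by rewrite muln_gt0 ep0 mt_gt0.
  by rewrite Gauss_dvdr ?(coprime_eps H) // gtnNdvd // oppr0.
have -> : p%:R^-1 *: (\sum_l mu l *:
    \prod_i (1 *: Yv (E D) i + p%:R *: (frobE i (teich l) *: Xv (E D) i)) ^+ r i) = Cop Pp.
  rewrite /Cop /Pp /P substXYZ substXY_sum; congr (_ *: _); apply: eq_bigr => l _.
  rewrite substXYZ; congr (_ *: _); rewrite /Pl substXY_prod; apply: eq_bigr => i _.
  rewrite substXY_exp; congr (_ ^+ _).
  rewrite substXYD substXYZ substXY_Xv substXY_Yv scale1r addrC; congr (_ + _).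
  by rewrite !scalerA mulrC.
move=> h1 [kap hkap]; split=> //; rewrite hkap.
set c := (if _ then _ else _).
have gX b : gmono r b (fun i => redp (Yv (E D) i)) (fun i => redp (Xv (E D) i)) =
    act wmat (mono L r b).
  rewrite act_wmat; apply: eq_bigr => i _.
  by rewrite (redp_Xv vEP (redEP D)) (redp_Yv vEP (redEP D)).
rewrite gX (eq_bigr (fun i : 'I_f => (\sum_l iota l ^+ (mexp + p ^ i)) *:
    act wmat ((r i)%:R *: mono L r (unit_deg i)))); last first.
  move=> i _; rewrite gX -[_ *: mono L r _ in RHS]addr0 Vr_act_lin.
  have -> : act wmat 0 = 0 by exact: substXY0.
  rewrite addr0 scalerA mulr_suml; congr (_ *: _); apply: eq_bigr => l _.
  rewrite red_mu redE_frobE ?red_teich; last exact: teich_int.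
  rewrite (red1 (redEP D)) expr1n big1 => [|j _]; last by rewrite expr1n.
  by rewrite !mulr1 exprD mulrCA [RHS]mulrC.
rewrite (bigD1 i1) //=.
have -> : (\sum_l iota l ^+ (mexp + p ^ i1)) *: act wmat ((r i1)%:R *: mono L r (unit_deg i1))
   = c *: act wmat (mono L r (unit_deg i1)).
  rewrite -[(r i1)%:R *: _]addr0 Vr_act_lin.
  have -> : act wmat 0 = 0 by exact: substXY0.
  rewrite addr0 scalerA; congr (_ *: _).
  have mp : (0 < mexp + p ^ i1)%N by rewrite addn_gt0 muln_gt0 ep0 mt_gt0.
  rewrite iota_powsum ?cK // /dvdn -modnDmr expn_i1 modnDmr -mulnDr.
  rewrite -/(q1 %| _)%N Gauss_dvdr ?(coprime_eps H) //.
  have -> : (q1 %| p ^ f - A + t + 1)%N = (t.+2 == A).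
    apply/idP/eqP => [d|e].
      have : (q1 <= p ^ f - A + t + 1)%N by apply: dvdn_leq d; rewrite addn1.
      by move: tA A_lt; rewrite qE; move: q1 A; clear; move=> x y; lia.
    have -> : (p ^ f - A + t + 1 = q1)%N by rewrite qE; move: A_lt e; move: q1 A; clear; move=> x y; lia.
    exact: dvdnn.
  by rewrite /c; case: ifP => _; rewrite ?mulN1r // oppr0 mul0r.
rewrite addr_sub_mid.
apply: B_lin; first by apply: (B_act H); exact: (B_Xr _ H).
elim/big_ind: _ => [|u w hu hw|i ne]; first exact: B_zero.
  by rewrite -[u]scale1r; exact: B_lin.
rewrite -[_ *: _]addr0; apply: B_lin; last exact: B_zero.
by apply: (B_act H); exact: B_other.
Qed.

End Relation.
End HeckeRelation.

(** * Reduction of integral functions in the induction *)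

Section ReductionOfInduction.
Context (p f : nat) (D : padic_data p f).
Context (r : 'I_f -> nat).
Local Notation G := 'M[F D]_2.
Local Notation polyE := {mpoly (E D)[(f + f)%N]}.
Local Notation act := (@Vr_act p f D).
Local Notation actE := (@VE_act p f D).
Local Notation reduce := (@Defs.reduce p f D).
Local Notation vF := (@vF p f D).
Local Notation vE := (@vE p f D).
Local Notation redF := (@redF p f D).
Local Notation redE := (@redE p f D).
Local Notation vFP := (vF_valuation D).
Local Notation vEP := (vE_valuation D).
Local Notation pint := (@pint _ vE (f + f)).
Local Notation redp := (map_mpoly redE).
Implicit Types (g : G) (v : polyE).

Lemma VE_act_lin g (c : E D) u v : actE g (c *: u + v) = c *: actE g u + actE g v.
Proof. exact: substXY_lin. Qed.

Lemma VE_actM g1 g2 v : actE (g1 *m g2) v = actE g1 (actE g2 v).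
Proof.
apply: poly_actM => i j l; rewrite -!/(frobE i _) mulmx2E.
by rewrite frobED !frobEM.
Qed.

Lemma V_VE_act g v : V r v -> V r (actE g v).
Proof. exact: V_poly_act. Qed.

Lemma pint_frob_form i g j : inK g ->
  pint 0 (frobE i (g 0 j) *: Xv (E D) i + frobE i (g 1 j) *: Yv (E D) i).
Proof.
case/inKP=> h1 _ _; apply: (pintD vEP); apply: (pintZ0 vEP).
- exact: vge_frobE.
- exact: (pint_Xv vEP).
- exact: vge_frobE.
- exact: (pint_Yv vEP).
Qed.

Lemma VO_act g v : inK g -> VO r v -> VO r (actE g v).
Proof.
move=> hg [h1 h2]; split; first exact: V_VE_act.
by apply: (pint_substXY vEP h1 h2) => i; exact: pint_frob_form.
Qed.

Lemma VO_add (u v : polyE) : VO r u -> VO r v -> VO r (u + v).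
Proof.
move=> [h1 h2] [k1 k2]; split; first exact: V_add.
exact: (pintD vEP).
Qed.

Lemma VO_zero : VO r (0 : polyE).
Proof. by split=> [|m]; [exact: V_zero|rewrite mcoeff0; exact: vge0]. Qed.

(** Frobenius reduces to the p-th power, so the action twisted by sigma^i reduces to the one twisted
    by p^i-th powers. *)
Lemma redp_VE_act g v : inK g -> VO r v ->
  redp (actE g v) = act (map_mx redF g) (redp v).
Proof.
move=> hg [h1 h2]; rewrite /VE_act /poly_act (redp_substXY vEP (redEP D) h1 h2);
  [|by move=> i; exact: pint_frob_form|by move=> i; exact: pint_frob_form].
have /inKP[hi _ _] := hg.
have e i j : redp (frobE i (g 0 j) *: Xv (E D) i + frobE i (g 1 j) *: Yv (E D) i) =
   iota_kF D (redF (g 0 j)) ^+ (p ^ i) *: Xv (Fbar D) i +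
   iota_kF D (redF (g 1 j)) ^+ (p ^ i) *: Yv (Fbar D) i.
  have v0 := vge_frobE i (hi 0 j); have v1 := vge_frobE i (hi 1 j).
  have pX := pint_Xv vEP i; have pY := pint_Yv vEP i.
  rewrite (redpD (redEP D)); [|exact: (pintZ0 vEP)|exact: (pintZ0 vEP)].
  rewrite !(redpZ (redEP D)) // !redE_frobE //.
  by rewrite (redp_Xv vEP (redEP D)) (redp_Yv vEP (redEP D)).
by apply: eq_substXY => i; rewrite !mxE; exact: e.
Qed.

Lemma redF_mulmx g1 g2 : inK g1 -> inK g2 ->
  map_mx redF (g1 *m g2) = map_mx redF g1 *m map_mx redF g2.
Proof.
move=> /inKP[h1 _ _] /inKP[k1 _ _]; apply/matrixP => i j.
rewrite [LHS]mxE mulmx2E [RHS]mulmx2E !mxE.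
have vm x y : vge vF 0 x -> vge vF 0 y -> vge vF 0 (x * y).
  by move=> hx hy; rewrite -[0 : rat]addr0; apply: (vgeM vFP).
by rewrite (redD (redFP D)) ?(redM (redFP D)) //; exact: vm.
Qed.

Lemma redF_unit g : inK g -> map_mx redF g \in unitmx.
Proof.
move=> hg; have := redF_mulmx hg (inK_inv hg); rewrite mulmxV ?(inK_unit hg) //.
have -> : map_mx redF (1%:M : G) = 1%:M.
  apply/matrixP => i j; rewrite !mxE; case: (_ == _).
    by rewrite (red1 (redFP D)).
  by rewrite (red0 (redFP D)).
by move=> /esym /mulmx1_unit[].
Qed.

Lemma reduce_bracket g v : VO r v -> reduce (bracket actE g v) =
  bracket (inflate act) g (redp v).
Proof.
move=> hv; apply/funext => x; rewrite /Defs.reduce /bracket; case: ifP => hx.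
  by rewrite redp_VE_act.
exact: (redp0 (redEP D)).
Qed.

Lemma VO_bracket g v x : VO r v -> VO r (bracket actE g v x).
Proof.
by move=> hv; rewrite /bracket; case: ifP => hx; [exact: VO_act|exact: VO_zero].
Qed.

Lemma reduce_sum (I : Type) (s : seq I) (P : pred I) (phi : I -> G -> polyE) :
  (forall i x, P i -> VO r (phi i x)) ->
  reduce (\sum_(i <- s | P i) phi i) = \sum_(i <- s | P i) reduce (phi i).
Proof.
move=> h; apply/funext => x; rewrite /Defs.reduce !fct_sumE (redp_sum vEP (redEP D)) //.
by move=> i Pi; have [] := h i x Pi.
Qed.

Lemma reduceD (phi psi : G -> polyE) : (forall x, VO r (phi x)) ->
  (forall x, VO r (psi x)) -> reduce (phi + psi) = reduce phi + reduce psi.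
Proof.
move=> h1 h2; apply/funext => x; rewrite /Defs.reduce !fctE (redpD (redEP D)) //.
  by have [] := h1 x.
by have [] := h2 x.
Qed.

Lemma ind_VO_bracket g v : g \in unitmx -> VO r v -> ind actE (VO r) (bracket actE g v).
Proof.
move=> gu hv.
exact: (ind_bracket VE_act_lin (fun g1 g2 v _ _ => VE_actM g1 g2 v) VO_zero
  (fun g v hg hv => VO_act hg hv) gu hv).
Qed.

Lemma ind_reduce phi : ind actE (VO r) phi ->
  ind (inflate act) (V r) (reduce phi).
Proof.
move=> [h1 h2 h3 [s hs]]; split.
- by move=> g gu; rewrite /Defs.reduce h1 // (redp0 (redEP D)).
- by move=> n k g hk gu; rewrite /Defs.reduce (h2 n k g hk gu) redp_VE_act.
- by move=> g; apply: (V_redp (redEP D)); have [] := h3 g.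
exists s => g hg; apply: hs; apply: contra_neq hg => e.
by rewrite /Defs.reduce e (redp0 (redEP D)).
Qed.

End ReductionOfInduction.

Lemma pint_exp_sub (L : fieldType) (v : L -> rat) (vP : is_valuation v) n (c : L)
    (s u : {mpoly L[n]}) m : vge v 1 c -> pint v 0 s -> pint v 0 u ->
  pint v 1 ((s + c *: u) ^+ m - s ^+ m).
Proof.
move=> hc hs hu; have ht := pint_exp_taylor vP m hc hs hu.
set W := m%:R *: _ in ht.
have -> : (s + c *: u) ^+ m - s ^+ m = ((s + c *: u) ^+ m - (s ^+ m + c *: W)) + c *: W.
  by rewrite opprD addrA subrK.
apply: (pintD vP); first exact: pint_le ht.
rewrite -[1 : rat]addr0; apply: (pintZ vP) => //; apply: (pintZ0 vP); first exact: (vge_nat vP).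
by apply: (pintM0 vP) => //; exact: (pintX vP).
Qed.

Lemma addr_sub_regroup (V : zmodType) (s1 s2 s3 s5 : V) :
  s1 + s2 = s1 + (s2 - s3) - s5 + s3 + s5.
Proof. by rewrite [RHS]addrAC subrK -addrA subrK. Qed.

Lemma addr_scale_cancel (R : pzRingType) (V : lmodType R) (c : R) (x y s1 s2 s3 w : V) :
  c *: x = s3 -> w = s2 + s3 + c *: y -> s1 + w - c *: (x + y) = s1 + s2.
Proof.
by move=> <- ->; rewrite scalerDr -[s2 + _ + _]addrA [s1 + (s2 + _)]addrA addrK.
Qed.

(** * Integrality of the image under T - a_p *)

Section IntegralRelation.
Context (p f : nat) (D : padic_data p f) (r : 'I_f -> nat) (a : nat) (h : 'I_f).
Context (H : congruent_degrees p (kF D) (Fbar D) r a h).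
Context (k : nat) (fk : f = k.+2).
Context (r_h1 : a = 1%N -> (p %| r h)%N).
Context (ap : E D) (ap0 : ap != 0) (ap_lo : 1 / 2%:R < vE ap).
Context (t : nat) (tA : (t.+1 < deg p a k.+1)%N) (pt : ~~ (p %| t.+1)%N).
Local Notation G := 'M[F D]_2.
Local Notation K := (kF D).
Local Notation polyE := {mpoly (E D)[(f + f)%N]}.
Local Notation actE := (@VE_act p f D).
Local Notation q1 := (p ^ f).-1.
Local Notation vF := (@vF p f D).
Local Notation vE := (@vE p f D).
Local Notation redE := (@redE p f D).
Local Notation vFP := (vF_valuation D).
Local Notation vEP := (vE_valuation D).
Local Notation pint := (@pint _ vE (f + f)).
Local Notation redp := (map_mpoly redE).
Local Notation mu := (@mu p f D a h k t).
Local Notation Pp := (@Pp p f D r a h k t).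

Let p0 : (0 < p)%N := prime_gt0 (pcharf_prime (cd_pchar H)).
Let q1_0 : (0 < q1)%N := ltnW (q1_gt1 H).
Let rh_q : (p ^ f <= r h)%N := cd_r H h.

Definition bDelta (i : 'I_f) : nat := if i == h then (r i - q1)%N else r i.
Definition Delta : polyE := mono (E D) r r - mono (E D) r bDelta.

Lemma bDelta_le i : (bDelta i <= r i)%N.
Proof. by rewrite /bDelta; case: ifP => // _; exact: leq_subr. Qed.

Lemma prod_bDelta (R : comNzRingType) (c : R) : \prod_i c ^+ (r i - bDelta i) = c ^+ q1.
Proof.
rewrite (bigD1 h) //= /bDelta eqxx big1 => [|i /negPf ->]; last by rewrite subnn expr0.
by rewrite mulr1 subKn // (leq_trans _ rh_q) // leq_pred.
Qed.

Lemma V_Delta : V r Delta.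
Proof. by apply: V_sub; apply: V_mono => // i; exact: bDelta_le. Qed.

Lemma pint_mono b : pint 0 (mono (E D) r b).
Proof. by apply: (pint_gmono vEP); [exact: (pint_Xv vEP)|exact: (pint_Yv vEP)]. Qed.

Lemma pint_Delta : pint 0 Delta.
Proof. by apply: (pintB vEP); exact: pint_mono. Qed.

Lemma Cop_Delta : Cop Delta = mono (E D) r r - p%:R ^+ q1 *: mono (E D) r bDelta.
Proof.
have e1 : gmono r r (fun i => p%:R *: Xv (E D) i) (@Yv f (E D)) = mono (E D) r r.
  by apply: eq_bigr => i _; rewrite subnn !expr0.
have e2 : gmono r bDelta (fun i => p%:R *: Xv (E D) i) (@Yv f (E D)) =
    p%:R ^+ q1 *: mono (E D) r bDelta.
  by rewrite gmonoZ prod_bDelta.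
by rewrite /Cop /Delta substXYB !substXY_mono e1 e2.
Qed.

(** With L = s X_h + p Y_h and s a power of -[nu], the factor L^q - X_h^(q-1) L can be split off.
    Modulo p it is (s^q - s) X_h^q, and s^q - s has residue 0 in F_q. *)
Lemma pint_Bop_Delta nu : pint 1 (Bop nu Delta).
Proof.
pose s i : F D := (- teich nu) ^+ (p ^ i).
pose Lf (i : 'I_f) : polyE := (s i)%:A *: Xv (E D) i + p%:R *: Yv (E D) i.
have sint i : vge vF 0 (s i).
  by apply: (vgeX vFP); apply: (vgeN vFP); exact: teich_int.
have hp1 : vge vE 1 p%:R by rewrite /vge vE_p lexx orbT.
have sEint i : vge vE 0 (s i)%:A by rewrite vge_alg.
have hL i : pint 0 (Lf i).
  apply: (pintD vEP); apply: (pintZ0 vEP) => //.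
  - exact: (pint_Xv vEP).
  - exact: (vge_nat vEP).
  - exact: (pint_Yv vEP).
have BE v : Bop nu v = substXY (@Xv f _) Lf v.
  apply: eq_substXY => // i; congr (_ *: _ + _).
  by rewrite -[RHS]/(in_alg (E D) _) rmorphXn rmorphN.
have -> : Bop nu Delta = Lf h ^+ (r h - p ^ f) *
    (\prod_(i < f | i != h) Lf i ^+ r i) * (Lf h ^+ (p ^ f) - Xv (E D) h ^+ q1 * Lf h).
  rewrite BE /Delta substXYB !substXY_mono.
  have e3 : gmono r r (@Xv f (E D)) Lf = Lf h ^+ r h * \prod_(i < f | i != h) Lf i ^+ r i.
    rewrite /gmono (bigD1 h) //= subnn expr0 mul1r; congr (_ * _).
    by apply: eq_bigr => i _; rewrite subnn expr0 mul1r.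
  have e4 : gmono r bDelta (@Xv f (E D)) Lf = Xv (E D) h ^+ q1 * Lf h ^+ (r h - q1) *
      \prod_(i < f | i != h) Lf i ^+ r i.
    rewrite /gmono (bigD1 h) //= /bDelta eqxx.
    rewrite (_ : r h - (r h - q1) = q1)%N; last by rewrite subKn // (leq_trans _ rh_q) // leq_pred.
    by congr (_ * _); apply: eq_bigr => i /negPf ->; rewrite subnn expr0 mul1r.
  have e1 : Lf h ^+ r h = Lf h ^+ (r h - p ^ f) * Lf h ^+ (p ^ f).
    by rewrite -exprD subnK.
  have e2 : Lf h ^+ (r h - q1) = Lf h ^+ (r h - p ^ f) * Lf h.
    have aux x y : (0 < y)%N -> (y <= x)%N -> (x - y.-1 = (x - y).+1)%N by clear; lia.
    by rewrite aux ?expn_gt0 ?p0 // exprSr.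
  rewrite e3 e4 e1 e2; move: (Lf h ^+ _) (Lf h ^+ _) (\prod_(i < f | _) _) (Xv _ _ ^+ _).
  by move: (Lf h) => z1 z2 z3 z4 z5; ring.
rewrite -[1 : rat]add0r; apply: (pintM vEP).
  by apply: (pintM0 vEP); [exact: (pintX vEP)|apply: (pint_prod vEP) => i _; exact: (pintX vEP)].
have -> : Lf h ^+ (p ^ f) - Xv (E D) h ^+ q1 * Lf h =
   (Lf h ^+ (p ^ f) - ((s h)%:A *: Xv (E D) h) ^+ (p ^ f)) +
   (((s h)%:A ^+ (p ^ f) - (s h)%:A) *: Xv (E D) h ^+ (p ^ f) -
    p%:R *: (Xv (E D) h ^+ q1 * Yv (E D) h)).
  have eX : Xv (E D) h ^+ (p ^ f) = Xv (E D) h ^+ q1 * Xv (E D) h.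
    by rewrite -exprSr prednK // expn_gt0 p0.
  rewrite exprZn eX; move: (Lf h ^+ (p ^ f)) => LL.
  by rewrite /Lf -!mul_mpolyC mpolyCB; ring.
apply: (pintD vEP).
  by apply: (pint_exp_sub vEP) => //; [apply: (pintZ0 vEP) => //; exact: (pint_Xv vEP)|
    exact: (pint_Yv vEP)].
apply: (pintB vEP); rewrite -[1 : rat]addr0; apply: (pintZ vEP) => //.
- have -> : (s h)%:A ^+ (p ^ f) - (s h)%:A = (s h ^+ (p ^ f) - s h)%:A :> E D.
    by rewrite -[RHS]/(in_alg (E D) _) rmorphB rmorphXn.
  rewrite vge_alg; apply: vge_unramified.
    apply: (vgeD vFP); first exact: (vgeX vFP).
    exact: (vgeN vFP).
  rewrite (redD (redFP D)); [|exact: (vgeX vFP)|exact: (vgeN vFP)].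
  rewrite (redN vFP (redFP D)) // (redX vFP (redFP D)) //.
  by rewrite -(cd_card H) expf_card subrr.
- by apply: (pintX vEP); exact: (pint_Xv vEP).
- by apply: (pintM0 vEP); [apply: (pintX vEP); exact: (pint_Xv vEP)|exact: (pint_Yv vEP)].
Qed.

Definition g_ (l : K) : G := mx2 p%:R (teich l) 0 1.
Definition alpha : G := mx2 1 0 0 p%:R.
Definition k_ (l : K) : G := mx2 1 (teich l) 0 1.

Lemma unit_g_ l : g_ l \in unitmx.
Proof. by apply: unit_mat2; rewrite mulr1 mulr0 subr0 pF_neq0. Qed.

Lemma unit_alpha : alpha \in unitmx.
Proof. by apply: unit_mat2; rewrite mul1r mulr0 subr0 pF_neq0. Qed.

Lemma det_mat2 (R : comNzRingType) (s u v w : R) : \det (mat2 s u v w) = s * w - u * v.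
Proof.
rewrite (expand_det_row _ 0) !big_ord_recl big_ord0 addr0.
by rewrite /cofactor !det_mx11 !mxE /= expr0 expr1 !mul1r mulN1r mulrN.
Qed.

Lemma inK_k_ l : inK (k_ l).
Proof.
have d1 : \det (k_ l) = 1 by rewrite det_mat2 mulr1 mulr0 subr0.
apply/inKP; rewrite d1 oner_eq0 (val1 vFP); split=> // i j; rewrite mxE.
case: (i == 0); case: (j == 0); [exact: (vge_one vFP)|exact: teich_int|
  exact: vge0|exact: (vge_one vFP)].
Qed.

Lemma VE_act_k_ l : actE (k_ l) (mono (E D) r r) = Pl r l.
Proof.
rewrite /VE_act /poly_act substXY_mono; apply: eq_bigr => i _.
rewrite subnn expr0 mul1r !mxE /=; congr (_ ^+ _).
by rewrite -!/(frobE i _) frobE1 scale1r.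
Qed.

Definition cl (l : K) : E D := ap / p%:R * mu l.

Lemma cl_vge l : vge vE (vE ap - 1) (cl l).
Proof.
rewrite -[vE ap - 1]addr0; apply: (vgeM vEP); last exact: mu_int.
by rewrite /vge (valM vEP) ?invr_neq0 ?pE_neq0 // (valV vEP) ?pE_neq0 // vE_p lexx orbT.
Qed.

Lemma vE_ap_gt0 : 0 < vE ap.
Proof. by apply: lt_trans ap_lo; rewrite divr_gt0. Qed.

Lemma VO_small v (c : rat) : 0 < c -> V r v -> pint c v -> VO r v /\ redp v = 0.
Proof.
move=> c0 hV hp; split; last exact: (redp_gt0 (redEP D) c0 hp).
by split=> //; apply: pint_le hp; exact: ltW.
Qed.

Lemma small_Bop l nu : VO r (Bop nu (cl l *: Delta)) /\ redp (Bop nu (cl l *: Delta)) = 0.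
Proof.
apply: (VO_small vE_ap_gt0); first by apply: V_Bop; apply: V_scale; exact: V_Delta.
rewrite /Bop substXYZ -/(Bop nu Delta) -[vE ap](subrK 1).
by apply: (pintZ vEP); [exact: cl_vge|exact: pint_Bop_Delta].
Qed.

Lemma small_Cop l : VO r (Cop (cl l *: Delta) - cl l *: mono (E D) r r) /\
  redp (Cop (cl l *: Delta) - cl l *: mono (E D) r r) = 0.
Proof.
apply: (VO_small vE_ap_gt0).
  apply: V_sub; first by apply: V_Cop; apply: V_scale; exact: V_Delta.
  by apply: V_scale; exact: V_mono.
rewrite /Cop substXYZ -/(Cop Delta) Cop_Delta -scalerBr addrAC subrr add0r.
rewrite -[vE ap](subrK 1); apply: (pintZ vEP); first exact: cl_vge.
apply: (pintN vEP); rewrite -[1 : rat]addr0; apply: (pintZ vEP); last exact: pint_mono.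
rewrite -(prednK q1_0) exprS -[1 : rat]addr0; apply: (vgeM vEP).
  by rewrite /vge vE_p lexx orbT.
by apply: (vgeX vEP); exact: (vge_nat vEP).
Qed.

(** The coefficient has valuation at least 2 v(a_p) - 1, positive because v(a_p) > 1/2. *)
Lemma small_ap l : VO r ((- (ap * cl l)) *: Delta) /\ redp ((- (ap * cl l)) *: Delta) = 0.
Proof.
have c0 : 0 < vE ap + (vE ap - 1).
  by rewrite addrA subr_gt0 -mulr2n -mulr_natr -ltr_pdivrMr.
apply: (VO_small c0); first by apply: V_scale; exact: V_Delta.
rewrite -[X in pint X]addr0; apply: (pintZ vEP); last exact: pint_Delta.
apply: (vgeN vEP); apply: (vgeM vEP); last exact: cl_vge.
by rewrite /vge lexx orbT.
Qed.

Section AtG.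
Context (g : G) (gu : g \in unitmx).
Local Notation br := (bracket actE).
Local Notation g' := (fun l => g *m k_ l *m invmx alpha).

Lemma unit_g' l : g' l \in unitmx.
Proof. by rewrite !unitmx_mul gu (inK_unit (inK_k_ l)) unitmx_inv unit_alpha. Qed.

Definition rel_phi : G -> polyE := br g Pp + \sum_l br (g' l) (cl l *: Delta).
Definition rel_psi : G -> polyE :=
  hecke_bracket actE (@Bop p f D) (@Cop p f D) g Pp +
  \sum_l hecke_bracket actE (@Bop p f D) (@Cop p f D) (g' l) (cl l *: Delta).

Lemma rel_T : T_minus_ap r ap (rel_psi - ap *: rel_phi).
Proof.
exists rel_phi, rel_psi; split=> //.
  have hb x v : x \in unitmx -> V r v -> ind actE (V r) (br x v).
    move=> xu hv; exact: (ind_bracket (@VE_act_lin _ _ D)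
      (fun g1 g2 v _ _ => VE_actM g1 g2 v) (@V_zero f (E D) r)
      (fun g v _ hv => @V_VE_act p f D r g v hv) xu hv).
  rewrite /rel_phi -[br g Pp]scale1r; apply: (ind_lin (@VE_act_lin _ _ D)).
  - by move=> u v; exact: V_lin.
  - by apply: hb => //; exact: V_Pp.
  apply: (ind_sum (@VE_act_lin _ _ D) (@V_zero f (E D) r)); first by move=> u v; exact: V_add.
  move=> l _; apply: hb; first exact: unit_g'.
  by apply: V_scale; exact: V_Delta.
exists ((g, Pp) :: [seq (g' l, cl l *: Delta) | l <- enum K]); split.
- move=> x; rewrite inE => /orP[/eqP -> /=|/mapP[l _ -> /=]].
    by split=> //; exact: V_Pp.
  by split; [exact: unit_g'|apply: V_scale; exact: V_Delta].
- by rewrite big_cons big_map big_enum.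
- by rewrite big_cons big_map big_enum.
Qed.

Definition rel_main : G -> polyE :=
  hecke_bracket actE (@Bop p f D) (@Cop p f D) g Pp.
(** The translates of Y^r are taken out of the alpha-terms, to be cancelled in [rel_E]. Each bracket
    that is left is integral with zero reduction. *)
Definition rel_small (l : K) : G -> polyE :=
  (\sum_nu br (g' l *m g_ nu) (Bop nu (cl l *: Delta)) +
   br (g *m k_ l) (Cop (cl l *: Delta) - cl l *: mono (E D) r r)) +
  br (g' l) ((- (ap * cl l)) *: Delta).

(* The term ap [g, P / p] is cancelled by the translates of Y ^ r coming from
   the [g', Delta]. *)
Lemma rel_E : rel_psi - ap *: rel_phi = rel_main + \sum_l rel_small l.
Proof.
have lin := @VE_act_lin _ _ D.
have aP : ap *: br g Pp = \sum_l br (g *m k_ l) (cl l *: mono (E D) r r).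
  rewrite -(bracketZ lin) /Pp /P scalerA scaler_sumr (bracket_sum lin).
  apply: eq_bigr => l _.
  rewrite (bracket_mulK (fun g1 g2 v _ _ => VE_actM g1 g2 v) _ _ (inK_k_ l)).
  rewrite -[cl l *: _]addr0 lin VE_act_k_ scalerA.
  by have -> : actE (k_ l) 0 = 0 by [exact: substXY0]; rewrite addr0.
have e1 l : hecke_bracket actE (@Bop p f D) (@Cop p f D) (g' l) (cl l *: Delta) =
    rel_small l + br (g *m k_ l) (cl l *: mono (E D) r r) + ap *: br (g' l) (cl l *: Delta).
  rewrite /hecke_bracket /rel_small.
  have -> : g' l *m mx2 1 0 0 p%:R = g *m k_ l.
    by rewrite -[mx2 1 0 0 _]/alpha mulmxKV // unit_alpha.
  have h4 : br (g' l) ((- (ap * cl l)) *: Delta) = - (ap *: br (g' l) (cl l *: Delta)).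
    by rewrite !(bracketZ lin) scaleNr scalerA.
  have h5 : br (g *m k_ l) (Cop (cl l *: Delta) - cl l *: mono (E D) r r) =
     br (g *m k_ l) (Cop (cl l *: Delta)) - br (g *m k_ l) (cl l *: mono (E D) r r).
    by rewrite (bracketD lin) -scaleN1r [br _ (-1 *: _)](bracketZ lin) scaleN1r.
  by rewrite h4 h5; exact: addr_sub_regroup.
have e2 : \sum_l hecke_bracket actE (@Bop p f D) (@Cop p f D) (g' l) (cl l *: Delta) =
    \sum_l rel_small l + \sum_l br (g *m k_ l) (cl l *: mono (E D) r r) +
    \sum_l ap *: br (g' l) (cl l *: Delta).
  by rewrite -!big_split; apply: eq_bigr => l _; exact: e1.
apply: (addr_scale_cancel _ aP); rewrite scaler_sumr; exact: e2.
Qed.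

End AtG.
End IntegralRelation.

(** * The reduced relation modulo Q_(f-2) *)

Section ReducedRelation.
Context (p f : nat) (D : padic_data p f) (r : 'I_f -> nat) (a : nat) (h : 'I_f).
Context (H : congruent_degrees p (kF D) (Fbar D) r a h).
Context (k : nat) (fk : f = k.+2).
Context (r_h1 : a = 1%N -> (p %| r h)%N).
Context (ap : E D) (ap0 : ap != 0) (ap_lo : 1 / 2%:R < vE ap).
Local Notation G := 'M[F D]_2.
Local Notation K := (kF D).
Local Notation L := (Fbar D).
Local Notation iota := (iota_kF D).
Local Notation polyE := {mpoly (E D)[(f + f)%N]}.
Local Notation polyF := {mpoly L[(f + f)%N]}.
Local Notation ev := (@ev p f K L iota).
Local Notation inH := (@inH p f K L iota a h).
Local Notation hmon := (@hmon p f K L iota a h).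
Local Notation act := (@Vr_act p f D).
Local Notation actE := (@VE_act p f D).
Local Notation reduce := (@Defs.reduce p f D).
Local Notation A := (deg p a k.+1).
Local Notation ep := (eps p f h k.+1).
Local Notation i1 := (ordS h).
Local Notation redE := (@redE p f D).
Local Notation redp := (map_mpoly redE).
Local Notation piB := (@piB p f D r k).
Local Notation brQ := (bracket (inflate (Qgr_act D r k))).

Let kf : (k.+1 < f)%N. Proof. by rewrite fk. Qed.
Let kf' : (k < f)%N := ltnW kf.
Let hk : QsocP D r a h k := QsocE H kf'.

Definition Zv : polyF := mono L r (unit_deg i1).
Definition wZv : polyF := act (wmat D) Zv.

Lemma V_Zv : V r Zv.
Proof. by apply: V_mono; exact: (unit_deg_le H). Qed.

Lemma V_wZv : V r wZv.
Proof. by apply: V_poly_act; exact: V_Zv. Qed.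

Lemma piB_bracket g v x : piB (bracket (inflate act) g v x) = brQ g (piB v) x.
Proof.
rewrite /bracket; case: ifP => _; last exact: piB0.
by rewrite /inflate (Qgr_actE H hk).
Qed.

Lemma piBZ e v : piB (e *: v) = e *: piB v.
Proof. by rewrite -[e *: v]addr0 piB_lin piB0 addr0. Qed.

Lemma piBD u v : piB (u + v) = piB u + piB v.
Proof. by rewrite -[u]scale1r piB_lin !scale1r. Qed.

Lemma piB_sum (I : Type) (s : seq I) (P : pred I) (F : I -> polyF) :
  piB (\sum_(i <- s | P i) F i) = \sum_(i <- s | P i) piB (F i).
Proof. by rewrite /piB !quot_pi_sum. Qed.

Section Relation.
Context (t : nat) (tA : (t.+1 < A)%N) (pt : ~~ (p %| t.+1)%N).
Context (g : G) (gu : g \in unitmx).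
Local Notation Pp := (@Pp p f D r a h k t).
Local Notation Delta := (@Delta p f D r h).
Local Notation chi := (rel_psi r a h k ap t g - ap *: rel_phi r a h k ap t g).

Lemma VO_Bop_Pp nu : VO r (Bop nu Pp).
Proof.
split; first by apply: V_Bop; exact: V_Pp.
by have [] := Bop_Pp H fk r_h1 tA pt nu.
Qed.

Lemma VO_Cop_Pp : VO r (Cop Pp).
Proof.
split; first by apply: V_Cop; exact: V_Pp.
by have [] := Cop_Pp H fk r_h1 tA pt.
Qed.

Lemma inflate_act_lin (x : G) (e : L) u v :
  inflate act x (e *: u + v) = e *: inflate act x u + inflate act x v.
Proof. exact: Vr_act_lin. Qed.

Lemma indVO_add (phi psi : G -> polyE) : ind actE (VO r) phi -> ind actE (VO r) psi ->
  ind actE (VO r) (phi + psi).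
Proof.
move=> h1 h2; rewrite -[phi]scale1r; apply: (ind_lin (@VE_act_lin _ _ D)) => //.
by move=> u v; rewrite scale1r; exact: VO_add.
Qed.

Lemma indVO_sum (I : Type) (s : seq I) (P : pred I) (phi : I -> G -> polyE) :
  (forall i, P i -> ind actE (VO r) (phi i)) -> ind actE (VO r) (\sum_(i <- s | P i) phi i).
Proof.
apply: (ind_sum (@VE_act_lin _ _ D) (VO_zero D r)).
by move=> u v; exact: VO_add.
Qed.

Lemma indVO_val (phi : G -> polyE) x : ind actE (VO r) phi -> VO r (phi x).
Proof. by case. Qed.

Lemma unit_mulg_ nu : g *m mx2 p%:R (teich nu) 0 1 \in unitmx.
Proof. by rewrite unitmx_mul gu (unit_g_ nu). Qed.

Lemma unit_mulalpha : g *m mx2 1 0 0 p%:R \in unitmx.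
Proof. by rewrite unitmx_mul gu (unit_alpha D). Qed.

Lemma indVO_main : ind actE (VO r) (rel_main r a h k t g).
Proof.
apply: indVO_add.
  apply: indVO_sum => nu _; apply: ind_VO_bracket; first exact: unit_mulg_.
  exact: VO_Bop_Pp.
by apply: ind_VO_bracket; [exact: unit_mulalpha|exact: VO_Cop_Pp].
Qed.

Lemma unit_mulk_ l : g *m k_ l \in unitmx.
Proof. by rewrite unitmx_mul gu (inK_unit (inK_k_ l)). Qed.

Lemma indVO_small l : ind actE (VO r) (rel_small r a h k ap t g l).
Proof.
apply: indVO_add; first apply: indVO_add.
- apply: indVO_sum => nu _; apply: ind_VO_bracket.
    by rewrite unitmx_mul (unit_g' gu) (unit_g_ nu).
  by have [] := small_Bop H k ap0 ap_lo t l nu.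
- apply: ind_VO_bracket; first exact: unit_mulk_.
  by have [] := small_Cop H k ap0 ap_lo t l.
- apply: ind_VO_bracket; first exact: unit_g'.
  by have [] := small_ap r a h k ap0 ap_lo t l.
Qed.

Lemma reduce_small l : reduce (rel_small r a h k ap t g l) = 0.
Proof.
have b0 x : bracket (inflate act) x 0 = 0 := bracket0 inflate_act_lin x.
have [hB1 hB2] := all_and2 (fun nu => small_Bop H k ap0 ap_lo t l nu).
have [hC1 hC2] := small_Cop H k ap0 ap_lo t l.
have [hA1 hA2] := small_ap r a h k ap0 ap_lo t l.
have eb x v : VO r v -> redp v = 0 -> reduce (bracket actE x v) = 0.
  move=> hv ev0; exact: (etrans (reduce_bracket x hv)
    (etrans (congr1 (bracket (inflate act) x) ev0) (b0 x))).
pose s1 := \sum_nu bracket actE (g *m k_ l *m invmx (alpha D) *m g_ nu)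
  (Bop nu (cl a h k ap t l *: Delta)).
have hs1 x : VO r (s1 x).
  rewrite /s1 fct_sumE; elim/big_ind: _ => [|u v|nu _]; [exact: VO_zero|exact: VO_add|].
  exact: VO_bracket.
have es1 : reduce s1 = 0.
  refine (etrans (@reduce_sum _ _ _ r _ _ _ _ _) _).
    by move=> nu x _; exact: VO_bracket.
  by rewrite big1 // => nu _; exact: eb.
refine (etrans (@reduceD _ _ _ r _ _ _ _) _).
- move=> x; rewrite fctE; apply: VO_add; [exact: hs1|exact: VO_bracket].
- by move=> x; exact: VO_bracket.
rewrite (eb _ _ hA1 hA2) addr0; refine (etrans (@reduceD _ _ _ r _ _ hs1 _) _).
  by move=> x; exact: VO_bracket.
by rewrite (eb _ _ hC1 hC2) addr0.
Qed.

Definition rel_coef (nu : K) : L :=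
  (r i1)%:R * - ('C(A.-1, t)%:R * (- iota nu ^+ ep) ^+ t).
Definition rel_coef_alpha : L := if t.+2 == A then - (r i1)%:R else 0.

Lemma piB_Bop nu : piB (redp (Bop nu Pp)) = rel_coef nu *: piB Zv.
Proof.
rewrite -piBZ; apply/(piB_eq H kf' hk).
- by apply: (V_redp (redEP D)); case: (VO_Bop_Pp nu).
- by apply: V_scale; exact: V_Zv.
- by have [] := Bop_Pp H fk r_h1 tA pt nu.
Qed.

Lemma piB_Cop : piB (redp (Cop Pp)) = rel_coef_alpha *: piB wZv.
Proof.
rewrite -piBZ; apply/(piB_eq H kf' hk).
- by apply: (V_redp (redEP D)); case: VO_Cop_Pp.
- by apply: V_scale; exact: V_wZv.
- by have [] := Cop_Pp H fk r_h1 tA pt.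
Qed.

Lemma hecke_relation : exists chi, [/\ T_minus_ap r ap chi, ind actE (VO r) chi
  & forall x, piB (reduce chi x) =
     \sum_nu brQ (g *m mx2 p%:R (teich nu) 0 1) (rel_coef nu *: piB Zv) x +
     brQ (g *m mx2 1 0 0 p%:R) (rel_coef_alpha *: piB wZv) x].
Proof.
exists chi; split; first exact: rel_T.
  by rewrite rel_E; apply: indVO_add; [exact: indVO_main|apply: indVO_sum => l _; exact: indVO_small].
move=> x; rewrite rel_E (@reduceD _ _ _ r); last 2 first.
- by move=> y; apply: indVO_val; exact: indVO_main.
- by move=> y; apply: indVO_val; apply: indVO_sum => l _; exact: indVO_small.
rewrite (@reduce_sum _ _ _ r); last first.
  by move=> l y _; apply: indVO_val; exact: indVO_small.
rewrite big1 => [|l _]; last exact: reduce_small.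
rewrite addr0 /rel_main /hecke_bracket (@reduceD _ _ _ r); last 2 first.
- move=> y; apply: indVO_val; apply: indVO_sum => nu _; apply: ind_VO_bracket.
    exact: unit_mulg_.
  exact: VO_Bop_Pp.
- by move=> y; apply: VO_bracket; exact: VO_Cop_Pp.
rewrite (@reduce_sum _ _ _ r); last first.
  by move=> nu y _; apply: VO_bracket; exact: VO_Bop_Pp.
have step (F : K -> G -> polyF) (C : G -> polyF) :
    piB ((\sum_nu F nu + C) x) = \sum_nu piB (F nu x) + piB (C x).
  by rewrite fctE fct_sumE piBD piB_sum.
refine (etrans (step _ _) _); apply: (congr2 +%R).
  apply: eq_bigr => nu _; rewrite -piB_Bop -piB_bracket; congr (piB _).
  exact: (congr1 (fun F => F x) (reduce_bracket _ (VO_Bop_Pp nu))).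
rewrite -piB_Cop -piB_bracket; congr (piB _).
exact: (congr1 (fun F => F x) (reduce_bracket _ VO_Cop_Pp)).
Qed.

End Relation.

(** The class y corresponds to c times the monomial of index n modulo H_k. The coefficient is part
    of the predicate so that vectors of equal index can be compared exactly ([has_weight_prop]). *)
Definition has_weight n (c : L) (y : quot (Qsoc D r k)) := exists v, [/\ V r v, y = piB v &
  inH k (fun x z => ev v x z - c * hmon k.+1 n x z)].

Lemma has_weight_prop n c c' y y' : c != 0 -> has_weight n c y -> has_weight n c' y' ->
  y' = (c' / c) *: y.
Proof.
move=> c0 [v [Vv -> hv]] [w [Vw -> hw]]; rewrite -piBZ; apply/(piB_eq H kf' hk) => //.
  exact: V_scale.
split; first by apply: V_sub => //; exact: V_scale.
apply: inH_ext (inH_lin (- (c' / c)) hv hw) => x z.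
by rewrite evB evZ; field.
Qed.

Lemma sum_delta n (F : nat -> L) (N : nat) : (n < N)%N ->
  \sum_(j < N) (j == n :> nat)%:R * F j = F n.
Proof.
move=> nN; rewrite (bigD1 (Ordinal nN)) //= eqxx mul1r big1 ?addr0 // => j.
by rewrite -(inj_eq val_inj) /= => /negPf ->; rewrite mul0r.
Qed.

Lemma has_weight_uniq n n' c c' y : (n <= A)%N -> (n' <= A)%N -> ~~ (p %| n)%N -> c != 0 ->
  has_weight n c y -> has_weight n' c' y -> n = n'.
Proof.
move=> nA n'A pn c0 [v [Vv -> hv]] [w [Vw /(piB_eq H kf' hk Vv Vw)[_ hd] hw]].
apply/eqP/negPn/negP => ne; move/eqP: c0; apply.
pose cf j : L := c * (j == n)%:R - c' * (j == n')%:R.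
have <- : cf n = c by rewrite /cf eqxx (negPf ne) mulr1 mulr0 subr0.
apply: (inH_coef_dvd (iota := iota) H kf) => //.
apply: inH_ext (inH_lin 1 hd (inH_lin (-1) hv hw)) => x z; rewrite evB.
rewrite (eq_bigr (fun j : 'I__ => c * ((j == n :> nat)%:R * hmon k.+1 j x z) -
   c' * ((j == n' :> nat)%:R * hmon k.+1 j x z))); last first.
  by move=> j _; rewrite /cf; ring.
rewrite sumrB -!mulr_sumr !(sum_delta (fun j => hmon k.+1 j x z)) ?ltnS //.
by ring.
Qed.

Lemma has_weight_Zv : has_weight 1 1 (piB Zv).
Proof.
exists Zv; split=> //; first exact: V_Zv.
apply: inH_ext (inH_zero _ _ _ _ _ _) => x z.
rewrite mul1r (ev_unit_hmon H x z kf (n := 1)) ?subrr //.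
  by rewrite (deg_gt1 H).
exact: (expn_i1 H fk).
Qed.

Lemma has_weight_wZv : has_weight A.-1 1 (piB wZv).
Proof.
exists wZv; split=> //; first exact: V_wZv.
apply: inH_ext (inH_zero _ _ _ _ _ _) => x z.
have A1 := deg_gt1 H (ltn0Sn k).
rewrite mul1r /wZv (ev_mat2 _ H) !mul0r !mul1r add0r addr0.
rewrite (ev_unit_hmon H z x kf (n := 1)) ?A1 //; last exact: (expn_i1 H fk).
rewrite /hmon; have -> : (A - A.-1 = 1)%N by rewrite -subn1 subKn // ltnW.
by rewrite subn1 mulrC subrr.
Qed.

Lemma has_weightZ n c e y : has_weight n c y -> has_weight n (e * c) (e *: y).
Proof.
move=> [v [Vv -> hv]]; exists (e *: v); split; [exact: V_scale|by rewrite piBZ|].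
by apply: inH_ext (inH_scale e hv) => x z; rewrite evZ; ring.
Qed.

End ReducedRelation.

(** * Weights of the graded piece *)

Section WeightAnalysis.
Context (p f : nat) (D : padic_data p f) (r : 'I_f -> nat) (a : nat) (h : 'I_f).
Context (H : congruent_degrees p (kF D) (Fbar D) r a h).
Context (k : nat) (fk : f = k.+2).
Context (p_gt2 : (2 < p)%N) (r_i1 : ~~ (p %| r (ordS h))%N).
Context (r_h1 : a = 1%N -> (p %| r h)%N).
Context (ap : E D) (ap0 : ap != 0) (ap_lo : 1 / 2%:R < vE ap).
Local Notation G := 'M[F D]_2.
Local Notation K := (kF D).
Local Notation L := (Fbar D).
Local Notation iota := (iota_kF D).
Local Notation polyF := {mpoly L[(f + f)%N]}.
Local Notation ev := (@ev p f K L iota).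
Local Notation B := (@B p f K L iota r a h).
Local Notation inH := (@inH p f K L iota a h).
Local Notation hmon := (@hmon p f K L iota a h).
Local Notation act := (@Vr_act p f D).
Local Notation reduce := (@Defs.reduce p f D).
Local Notation q1 := (p ^ f).-1.
Local Notation A := (deg p a k.+1).
Local Notation ep := (eps p f h k.+1).
Local Notation i1 := (ordS h).
Local Notation piB := (@piB p f D r k).
Local Notation brQ := (bracket (inflate (Qgr_act D r k))).

Let pcharL : p \in [pchar L] := cd_pchar H.
Let pp : prime p := pcharf_prime pcharL.
Let cardK : #|K| = (p ^ f)%N := cd_card H.
Let cK : #|K|.-1 = q1. Proof. by rewrite cardK. Qed.
Let kf : (k.+1 < f)%N. Proof. by rewrite fk. Qed.
Let kf' : (k < f)%N := ltnW kf.
Let hk : QsocP D r a h k := QsocE H kf'.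

Local Notation has_weight := (@has_weight p f D r a h k).
Local Notation Z1 := (piB (Zv D r h)).
Local Notation wZ1 := (piB (wZv D r h)).
Let p0 : (0 < p)%N := prime_gt0 pp.

Lemma Qgr_act_lin x (e : L) y z :
  Qgr_act D r k x (e *: y + z) = e *: Qgr_act D r k x y + Qgr_act D r k x z.
Proof.
have rep (u : quot (Qsoc D r k)) : exists v, u = piB v.
  by exists (repr (repr u)); rewrite /piB !quot_piK.
have [v ->] := rep y; have [w ->] := rep z.
by rewrite -piB_lin !(Qgr_actE H hk) Vr_act_lin piB_lin.
Qed.

Lemma inflate_Qgr_act_lin (x : G) (e : L) y z : inflate (Qgr_act D r k) x (e *: y + z) =
  e *: inflate (Qgr_act D r k) x y + inflate (Qgr_act D r k) x z.
Proof. exact: Qgr_act_lin. Qed.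

(** Asking for a single lift makes the property stable under linear combinations, so it can be
    checked on T [g, v] with v a monomial. *)
Definition null_image (chi : G -> quot (Qsoc D r k)) : Prop := exists psi0 : G -> polyF,
  [/\ ind (inflate act) (V r) psi0, (forall x, chi x = piB (psi0 x))
    & nat_Vr (r := r) (ap := ap) psi0 0].

Lemma tensor_lin (x : Pi r ap) (e c : L) : tensor x (e * c) = e *: tensor x c.
Proof. by rewrite /tensor -scalerA quot_piZ. Qed.

Lemma nat_Vr_lin (e : L) psi psi' u u' :
  nat_Vr (r := r) (ap := ap) psi u -> nat_Vr psi' u' ->
  nat_Vr (e *: psi + psi') (e *: u + u').
Proof.
move=> [s [h1 -> ->]] [s' [h1' -> ->]].
exists ([seq (e * x.1, x.2) | x <- s] ++ s'); split.
- move=> x; rewrite mem_cat => /orP[/mapP[y ys ->]|]; [exact: (h1 y)|exact: h1'].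
- rewrite big_cat big_map scaler_sumr; congr (_ + _); apply: eq_bigr => x _.
  by rewrite scalerA.
- rewrite big_cat big_map scaler_sumr; congr (_ + _); apply: eq_bigr => x _.
  by rewrite -tensor_lin.
Qed.

Lemma null_image_ext chi chi' : (forall x, chi x = chi' x) -> null_image chi -> null_image chi'.
Proof. by move=> e [psi0 [h1 h2 h3]]; exists psi0; split=> // x; rewrite -e. Qed.

Lemma null_image_lin (e : L) chi chi' : null_image chi -> null_image chi' ->
  null_image (fun x => e *: chi x + chi' x).
Proof.
move=> [u [h1 h2 h3]] [u' [h1' h2' h3']]; exists (e *: u + u'); split.
- apply: (ind_lin (@inflate_act_lin _ _ D)) => //.
  by move=> v w; exact: V_lin.
- by move=> x; rewrite h2 h2' !fctE piB_lin.
- by have := nat_Vr_lin e h3 h3'; rewrite scaler0 addr0.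
Qed.

Lemma null_image_zero : null_image (fun=> 0).
Proof.
exists 0; split.
- by apply: (ind_zero (@inflate_act_lin _ _ D)); exact: V_zero.
- by move=> x; rewrite piB0.
- by exists [::]; rewrite !big_nil.
Qed.

Lemma null_image_sum (I : Type) (s : seq I) (F : I -> G -> quot (Qsoc D r k)) :
  (forall i, null_image (F i)) -> null_image (fun x => \sum_(i <- s) F i x).
Proof.
move=> hF; elim: s => [|i s IHs].
  by apply: null_image_ext null_image_zero => x; rewrite big_nil.
by apply: null_image_ext (null_image_lin 1 (hF i) IHs) => x; rewrite big_cons scale1r.
Qed.

Lemma tensor_T chi c : T_minus_ap r ap chi -> tensor (quot_pi (T_minus_ap r ap) chi) c = 0.
Proof.
move=> hT; have -> : quot_pi (T_minus_ap r ap) chi = 0.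
  rewrite -quot_pi0; apply/quot_pi_lspan; rewrite subr0.
  by move=> N N0 Nl SN; exact: SN.
rewrite /tensor quot_piZ; set y := quot_pi _ _; suff -> : y = 0 by rewrite scaler0.
have Th0 : Theta (r := r) (ap := ap) 0.
  exists 0; last by rewrite quot_pi0.
  by apply: (ind_zero (@VE_act_lin _ _ D)); exact: VO_zero.
apply: (etrans _ (quot_pi0 _)); apply/quot_pi_lspan; rewrite subr0.
(* The additivity relation for 0 + 0 is - << 0 >>, so the symbol << 0 >> dies in the tensor
   product. *)
move=> N N0 Nl SN; rewrite -[<< _ >>]opprK -scaleN1r -[_ *: _]addr0; apply: Nl => //.
apply: SN; left; exists 0, 0; split=> //.
by rewrite addr0 subrr sub0r.
Qed.

Lemma null_image_relation t g (e : L) : (t.+1 < A)%N -> ~~ (p %| t.+1)%N -> g \in unitmx ->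
  null_image (fun x => \sum_nu brQ (g *m mx2 p%:R (teich nu) 0 1) 
       ((e * rel_coef r a h k t nu) *: Z1) x +
     brQ (g *m mx2 1 0 0 p%:R) ((e * rel_coef_alpha D r a h k t) *: wZ1) x).
Proof.
move=> tA pt gu; have [chi [hT hI hx]] := hecke_relation H fk r_h1 ap0 ap_lo tA pt gu.
have gr : null_image (fun x => piB (reduce chi x)).
  exists (reduce chi); split; [exact: ind_reduce|by []|].
  exists [:: (1, chi)]; split.
  - by move=> x; rewrite inE => /eqP ->.
  - by rewrite big_seq1 scale1r.
  - by rewrite big_seq1 tensor_T.
have bz x c y z : brQ x ((e * c) *: y) z = e *: brQ x (c *: y) z.
  by rewrite -scalerA (bracketZ inflate_Qgr_act_lin).
apply: null_image_ext (null_image_lin e gr null_image_zero) => x.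
rewrite addr0 hx scalerDr scaler_sumr; apply: (congr2 +%R); last exact: (esym (bz _ _ _ _)).
by apply: eq_bigr => nu _; exact: (esym (bz _ _ _ _)).
Qed.

(** * A single weight embedded in Q_(f-1) / Q_(f-2) *)

Section OneWeight.
Context (s : 'I_f -> nat) (m : nat) (psi : polyF -> quot (Qsoc D r k)).
Context (psi_lin : forall (e : L) u v, V s u -> V s v ->
  psi (e *: u + v) = e *: psi u + psi v).
Context (psi_eq : forall x u, x \in unitmx -> V s u ->
  psi (weight_act m x u) = Qgr_act D r k x (psi u)).
Context (psi_in : forall u, V s u -> Qgr D r k (psi u)).
Context (psi_inj : forall u, V s u -> psi u = 0 -> u = 0).
Implicit Types b : 'I_f -> nat.
Local Notation mS := (mono L s).

Let s_le : forall i, (s i <= s i)%N. Proof. by []. Qed.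
Let z_le : forall i : 'I_f, (0 <= s i)%N. Proof. by []. Qed.

Lemma psi_zero : psi 0 = 0.
Proof.
have := psi_lin (-1) (V_zero s (R := L)) (V_zero s (R := L)).
by rewrite scaler0 addr0 scaleN1r addNr.
Qed.

Lemma psiZ e u : V s u -> psi (e *: u) = e *: psi u.
Proof.
move=> hu; rewrite -{1}[e *: u]addr0 psi_lin //; last exact: V_zero.
by rewrite psi_zero addr0.
Qed.

Lemma psiD u v : V s u -> V s v -> psi (u + v) = psi u + psi v.
Proof. by move=> hu hv; rewrite -{1}[u]scale1r psi_lin // scale1r. Qed.

Lemma psi_sum (I : Type) (l : seq I) (P : pred I) (F : I -> polyF) :
  (forall i, P i -> V s (F i)) ->
  psi (\sum_(i <- l | P i) F i) = \sum_(i <- l | P i) psi (F i).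
Proof.
move=> hF; suff [] : V s (\sum_(i <- l | P i) F i) /\
    psi (\sum_(i <- l | P i) F i) = \sum_(i <- l | P i) psi (F i) by [].
elim/big_rec2: _ => [|i y1 y2 Pi [h1 h2]]; first by split; [exact: V_zero|exact: psi_zero].
have hi := hF i Pi; split; first exact: V_add.
by rewrite psiD // h2.
Qed.

Lemma V_weight_act (x : 'M[K]_2) u : V s u -> V s (weight_act (D := D) m x u).
Proof. by move=> hu; apply: V_scale; exact: V_poly_act. Qed.

Lemma psi_bracket g v x : V s v ->
  psi (bracket (inflate (weight_act m)) g v x) = brQ g (psi v) x.
Proof.
move=> hv; rewrite /bracket; case: ifP => hx; last exact: psi_zero.
by rewrite /inflate psi_eq //; exact: redF_unit.
Qed.

Lemma mS_neq0 b : (forall i, (b i <= s i)%N) -> mS b != 0.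
Proof.
move=> hb; apply/eqP => e; have := ev_mono p iota 1 1 hb.
by rewrite e ev0 rmorph1 !expr1n mulr1 => /eqP; rewrite eq_sym oner_eq0.
Qed.

Lemma weight_torus d b :
  weight_act m (mat2 1 0 0 d) (mS b) = iota d ^+ (m + total p b) *: mS b.
Proof.
rewrite /weight_act det_mat2 mul1r mulr0 subr0 exprD -scalerA; congr (_ *: _).
rewrite /Vr_act /poly_act substXY_mono /gmono /total expr_sum -mul_mpolyC rmorph_prod.
rewrite -big_split; apply: eq_bigr => i _ /=.
have z0 : (0 : L) ^+ (p ^ i) = 0 by rewrite expr0n expn_eq0 eqn0Ngt p0.
rewrite !mxE /= rmorph0 rmorph1 z0 expr1n !scale0r !scale1r add0r addr0.
by rewrite exprZn -exprM mulnC mul_mpolyC scalerAr.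
Qed.

Lemma psi_rep u : V s u -> exists2 v, B k.+1 v & psi u = piB v.
Proof.
move=> hu; have [x hx ->] := psi_in hu.
by have /(QsocE H kf)[v hv ->] := hx; exists v.
Qed.

Lemma hmon_torus d n x y : hmon k.+1 n x (d * y) = iota d ^+ (ep * n) * hmon k.+1 n x y.
Proof. by rewrite /hmon rmorphM exprMn mulrCA. Qed.

Lemma hmonS_uniq (c : nat -> L) n : inH k (fun x z =>
    \sum_(j < A.+1) c j * hmon k.+1 j x z) -> (n <= A)%N -> ~~ (p %| n)%N -> c n = 0.
Proof. by move=> h1 nA pn; apply: (inH_coef_dvd (iota := iota) H kf h1 nA pn). Qed.

Lemma ep_inj n n' : (n < q1)%N -> (n' < q1)%N -> (ep * n = ep * n' %[mod q1])%N -> n = n'.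
Proof.
move=> nq nq' e; suff : (n = n' %[mod q1])%N by rewrite !modn_small.
have aux u v : (u <= v)%N -> (ep * u = ep * v %[mod q1])%N -> (u = v %[mod q1])%N.
  move=> uv /eqP; rewrite eq_sym eqn_mod_dvd ?leq_mul // -mulnBr Gauss_dvdr ?(coprime_eps H) //.
  by move=> d; apply/eqP; rewrite eq_sym eqn_mod_dvd.
by case: (leqP n n') => [le|/ltnW le]; [exact: aux|apply/esym/aux].
Qed.

(** The vector is an eigenvector of diag(1, d) with character d^(m + total b), so an index n prime
    to p that occurs in it satisfies ep n = m + total b modulo q - 1. As A < q - 1 there is at most
    one such index, and injectivity of [psi] provides one. *)
Lemma weight_vec b : (forall i, (b i <= s i)%N) -> exists n c,
  [/\ (0 < n < A)%N, ~~ (p %| n)%N, c != 0, has_weight n c (psi (mS b))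
    & (m + total p b = ep * n %[mod q1])%N].
Proof.
move=> hb; have hV := V_mono (R := L) hb.
have [v [Vv [c hc]] ev] := psi_rep hV.
have A_lt := deg_lt_q1 H kf (ltn0Sn k).
have pA : (p %| A)%N by rewrite degS dvdn_mulr.
have tor (d : K) u : d != 0 -> (u <= A)%N -> ~~ (p %| u)%N -> c u != 0 ->
    iota d ^+ (ep * u) = iota d ^+ (m + total p b).
  move=> d0 uA pu cu.
  have du : mat2 1 0 0 d \in unitmx by apply: unit_mat2; rewrite mul1r mulr0 subr0.
  have := psi_eq du hV; rewrite weight_torus psiZ // ev (Qgr_actE H hk) -piBZ.
  have V1 : V r (iota d ^+ (m + total p b) *: v) by exact: V_scale.
  have V2 : V r (act (mat2 1 0 0 d) v) by exact: V_poly_act.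
  move=> /esym /(piB_eq H kf' hk V2 V1)[_ hd].
  pose c' j := c j * (iota d ^+ (ep * j) - iota d ^+ (m + total p b)).
  have : c' u = 0.
    apply: hmonS_uniq => //; apply: inH_ext hd => x z.
    rewrite evB evZ (ev_mat2 _ H) !mul1r !mul0r addr0 add0r !hc mulr_sumr -sumrB.
    by apply: eq_bigr => j _; rewrite hmon_torus /c'; ring.
  by move=> /eqP; rewrite mulf_eq0 (negPf cu) subr_eq0 => /eqP.
have [n [nA pn cn]] : exists n, [/\ (n <= A)%N, ~~ (p %| n)%N & c n != 0].
  apply: contrapT => Hn; move/eqP: (mS_neq0 hb); apply; apply: psi_inj => //.
  rewrite ev; apply/(piB_eq0 H kf' hk Vv); split=> //.
  apply: (@inH_ext _ _ _ _ _ _ _ _ (fun x z => \sum_(j < A.+1) c j * hmon k.+1 j x z)).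
    by move=> x z; rewrite hc.
  apply: inH_sum => j _; have jA : (j <= A)%N by rewrite -ltnS.
  case: (boolP (p %| j)%N) => pj; first by apply: inH_scale; exact: (inH_hmon_dvd _ H).
  have [cj|cj] := eqVneq (c j) 0.
    by apply: inH_ext (inH_zero _ _ _ _ _ _) => x z; rewrite cj mul0r.
  by case: Hn; exists j.
have n0 : (0 < n)%N by rewrite lt0n; apply: contraNneq pn => ->; rewrite dvdn0.
have nltA : (n < A)%N.
  by rewrite ltn_neqAle nA andbT; apply: contraNneq pn => ->.
exists n, (c n); split=> //; first by rewrite n0.
  exists v; split=> //; pose c' j := if (j == n)%N then 0 else c j.
  have nA1 : (n < A.+1)%N by [].
  apply: (@inH_ext _ _ _ _ _ _ _ _ (fun x z => \sum_(j < A.+1) c' j * hmon k.+1 j x z)).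
    move=> x z; rewrite hc (bigD1 (Ordinal nA1)) //= [X in _ = X - _](bigD1 (Ordinal nA1)) //=.
    rewrite /c' eqxx mul0r add0r [c n * _ + _]addrC addrK; apply: eq_bigr => j.
    by rewrite -(inj_eq val_inj) /= => /negPf ->.
  apply: inH_sum => j _; have jA : (j <= A)%N by rewrite -ltnS.
  rewrite /c'; case: eqP => [_|jn].
    by apply: inH_ext (inH_zero _ _ _ _ _ _) => x z; rewrite mul0r.
  case: (boolP (p %| j)%N) => pj; first by apply: inH_scale; exact: (inH_hmon_dvd _ H).
  have [cj|cj] := eqVneq (c j) 0.
    by apply: inH_ext (inH_zero _ _ _ _ _ _) => x z; rewrite cj mul0r.
  case: jn; apply: ep_inj; [exact: leq_ltn_trans A_lt|exact: leq_ltn_trans A_lt|].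
  by rewrite -cK; apply: (exp_eq_modn (iota := iota)) => d d0; rewrite !tor.
rewrite -cK; apply: (exp_eq_modn (iota := iota)) => d d0.
by rewrite tor.
Qed.

Lemma hmon_translate n x z : (n <= A)%N ->
  hmon k.+1 n x (x + z) = \sum_(j < A.+1) 'C(n, j)%:R * hmon k.+1 j x z.
Proof.
move=> nA; rewrite -(big_mkord xpredT (fun j => 'C(n, j)%:R * hmon k.+1 j x z)).
rewrite (@big_cat_nat _ _ _ n.+1) //= [X in _ = _ + X]big1_seq ?addr0; last first.
  by move=> j /andP[_]; rewrite mem_index_iota => /andP[nj _]; rewrite bin_small // mul0r.
rewrite big_mkord /hmon rmorphD !exprM (exprD_eps H) exprDn mulr_sumr.
apply: eq_bigr => j _; have jn : (j <= n)%N by rewrite -ltnS.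
have -> : (A - j = (A - n) + (n - j))%N by rewrite addnBA // subnK.
by rewrite -(mulr_natl _ 'C(n, j)) mulnDr exprD !exprM; ring.
Qed.

Lemma weight_upper b : (forall i, b i = 0%N) ->
  weight_act m (mat2 1 1 0 1) (mS b) = mS b.
Proof.
move=> b0; rewrite /weight_act det_mat2 mulr1 mulr0 subr0 rmorph1 expr1n scale1r.
rewrite /Vr_act /poly_act substXY_mono; apply: eq_bigr => i _.
have z0 : (0 : L) ^+ (p ^ i) = 0 by rewrite expr0n expn_eq0 eqn0Ngt p0.
by rewrite b0 !mxE /= rmorph0 rmorph1 z0 expr1n !scale0r !scale1r addr0.
Qed.

(** X^s is fixed by the upper unipotent, whereas translating the monomial of index n creates index 1
    with coefficient n. If n != 1 this forces p | n, which is excluded. The congruence is then the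
    torus weight of X^s. *)
Lemma weight_vec0 : exists2 c, c != 0 &
  has_weight 1 c (psi (mS (fun=> 0%N))) /\ (m = ep %[mod q1])%N.
Proof.
have hV := V_mono (R := L) z_le.
have [n [c [nA pn c0 [v [Vv ev hv]] mE]]] := weight_vec z_le.
move/andP: nA => [n0 nA]; have n1 : n = 1%N.
  have Uu : mat2 1 1 0 1 \in @unitmx K 2.
    by apply: unit_mat2; rewrite mulr1 mulr0 subr0 oner_neq0.
  have := psi_eq Uu hV; rewrite weight_upper // ev (Qgr_actE H hk).
  have V2 : V r (act (mat2 1 1 0 1) v) by exact: V_poly_act.
  move=> /esym /(piB_eq H kf' hk V2 Vv)[_ hd].
  have hU := inH_act H (mat2 1 1 0 1) hv.
  apply/eqP/negPn/negP => ne; pose cf j : L := c * ('C(n, j)%:R - (j == n)%:R).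
  have : cf 1%N = 0.
    apply: hmonS_uniq; first last.
    - by rewrite gtnNdvd // prime_gt1.
    - exact: leq_trans n0 (ltnW nA).
    apply: inH_ext (inH_lin (-1) hU (inH_lin 1 hd hv)) => x z.
    have -> : \sum_(j < A.+1) cf j * hmon k.+1 j x z =
        c * hmon k.+1 n x (x + z) - c * hmon k.+1 n x z.
      rewrite hmon_translate ?(ltnW nA) //.
      rewrite -[hmon k.+1 n x z](sum_delta (fun j => hmon k.+1 j x z) (n := n) (N := A.+1)).
        by rewrite !mulr_sumr -sumrB; apply: eq_bigr => j _; rewrite /cf; ring.
      exact: leqW.
    rewrite !mxE /= !mul1r !mul0r !addr0 evB (ev_mat2 _ H) !mul1r !mul0r !addr0.
    by ring.
  rewrite /cf bin1 eq_sym (negPf ne) subr0 => /eqP; rewrite mulf_eq0 (negPf c0) /=.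
  by apply/negP; rewrite (natr_neq0 H).
exists c => //; split; first by exists v; split=> //; rewrite -n1.
move: mE; rewrite n1 muln1 /total big1 ?addn0 //.
Qed.

Lemma has_weight_zero_vec c : c != 0 -> has_weight 1 c (psi (mS (fun=> 0%N))) ->
  psi (mS (fun=> 0%N)) = c *: Z1.
Proof.
by move=> c0 h1; rewrite (has_weight_prop H fk (oner_neq0 _) (has_weight_Zv H fk r_h1) h1) divr1.
Qed.

Lemma odd_ep : odd ep.
Proof. by rewrite oddX; move: pp p_gt2 => /even_prime[->|->] //; rewrite orbT. Qed.

(** The determinant of w is -1, and (-1)^m = (-1)^ep = -1 because p, and so [ep], is odd. *)
Lemma weight_wmat : (m = ep %[mod q1])%N ->
  weight_act m (wmat D) (mS (fun=> 0%N)) = - mS s.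
Proof.
move=> mE; rewrite /weight_act det_mat2 mul0r mul1r sub0r.
have -> : iota (-1) ^+ m = -1.
  have -> : iota (-1) ^+ m = iota (-1) ^+ ep.
    (* The exponent m may be 0, hence the shift by q - 1 to a positive one. *)
    have mq : (m + q1 = ep %[mod q1])%N by rewrite modnDr.
    have q0 : (0 < q1)%N := ltnW (q1_gt1 H).
    rewrite -(iota_exp_modn iota (-1) (m := (m + q1)%N) (n := ep)) ?cK //; last exact: (eps_gt0 H).
      by rewrite exprD -cK -[X in _ = _ * X]rmorphXn /= expf_card_pred ?rmorph1 ?mulr1 // oppr_eq0 oner_neq0.
    by rewrite addn_gt0 q0 orbT.
  by rewrite rmorphN1 -signr_odd odd_ep.
rewrite scaleN1r (act_wmat H); congr (- _); apply: eq_bigr => i _.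
by rewrite subn0 subnn !expr0 mulr1 mul1r.
Qed.

Lemma psi_top c : c != 0 -> has_weight 1 c (psi (mS (fun=> 0%N))) -> (m = ep %[mod q1])%N ->
  psi (mS s) = - c *: wZ1.
Proof.
move=> c0 hc mE; have hV := V_mono (R := L) z_le; have hVs := V_mono (R := L) s_le.
have wu : wmat D \in unitmx.
  by apply: unit_mat2; rewrite mul0r mul1r sub0r oppr_eq0 oner_neq0.
have := psi_eq wu hV; rewrite weight_wmat // (has_weight_zero_vec c0 hc).
rewrite -piBZ (Qgr_actE H hk) -[act _ _]addr0 -scaleN1r psiZ // scaleN1r.
have -> : act (wmat D) (c *: Zv D r h) = c *: wZv D r h.
  by rewrite -[c *: Zv D r h]addr0 Vr_act_lin [act _ 0]substXY0 addr0.
by rewrite addr0 piBZ => e; rewrite -[LHS]opprK e scaleNr.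
Qed.

Lemma total_eq0 b : total p b = 0%N -> forall i, b i = 0%N.
Proof.
move=> /eqP; rewrite /total sum_nat_eq0 => /forallP h0 i.
by have := h0 i; rewrite muln_eq0 expn_eq0 (gtn_eqF p0) orbF => /eqP.
Qed.

Lemma total_lt b i : (forall j, (b j <= s j)%N) -> b i != s i -> (total p b < total p s)%N.
Proof.
move=> hb ne; rewrite /total (bigD1 i) //= [X in (_ < X)%N](bigD1 i) //= -addSn leq_add //.
  by rewrite ltn_pmul2r ?expn_gt0 ?p0 // ltn_neqAle ne hb.
by apply: leq_sum => j _; rewrite leq_mul2r hb orbT.
Qed.

Definition Bw (l : K) : polyF -> polyF :=
  substXY (@Xv f _) (fun i => (- iota l) ^+ (p ^ i) *: Xv L i).
Definition Cw : polyF -> polyF := substXY (fun=> 0) (@Yv f _).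

Lemma Bw_mono l b : (forall i, (b i <= s i)%N) ->
  Bw l (mS b) = (- iota l) ^+ total p b *: mS (fun=> 0%N).
Proof.
move=> hb; rewrite /Bw substXY_mono /gmono /total expr_sum -mul_mpolyC rmorph_prod.
rewrite -big_split; apply: eq_bigr => i _ /=.
rewrite exprZn -exprM mulnC subn0 expr0 mulr1 mul_mpolyC -scalerAr -exprD.
by rewrite subnK.
Qed.

Lemma Cw_mono b : (forall i, (b i <= s i)%N) ->
  Cw (mS b) = if [forall i, b i == s i] then mS s else 0.
Proof.
move=> hb; rewrite /Cw substXY_mono; case: ifP => [/forallP e|/negbT].
  by apply: eq_bigr => i _; rewrite (eqP (e i)) subnn !expr0.
rewrite negb_forall => /existsP[i ne]; rewrite /gmono (bigD1 i) //=.
have : (0 < s i - b i)%N by rewrite subn_gt0 ltn_neqAle ne hb.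
by move=> h0; rewrite expr0n (gtn_eqF h0) !mul0r.
Qed.

Lemma V_Bw l v : V s v -> V s (Bw l v).
Proof.
apply: V_substXY => i; first exact: V_Xv.
by apply: V_scale; exact: V_Xv.
Qed.

Lemma V_Cw v : V s v -> V s (Cw v).
Proof. by apply: V_substXY => i; [exact: V_zero|exact: V_Yv]. Qed.

Lemma psi_prop b b' n c c' : (forall i, (b i <= s i)%N) -> (forall i, (b' i <= s i)%N) ->
  c != 0 -> has_weight n c (psi (mS b)) -> has_weight n c' (psi (mS b')) ->
  exists e, mS b' = e *: mS b.
Proof.
move=> hb hb' c0 h1 h2; have e := has_weight_prop H fk c0 h1 h2; exists (c' / c).
have Vb := V_mono (R := L) hb; have Vb' := V_mono (R := L) hb'.
apply/eqP; rewrite -subr_eq0; apply/eqP; apply: psi_inj.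
  by apply: V_sub => //; exact: V_scale.
rewrite addrC -scaleNr psi_lin // e scaleNr addNr //.
Qed.

(** Subtracting the weight of X^s from that of the monomial gives the congruence. Since [psi] is
    injective, vectors of equal index are proportional, and evaluation at (1, 0) or (0, 1) separates
    X^s or Y^s from the other monomials; so index 1 belongs to X^s only and index A - 1 to Y^s
    only. *)
Lemma weight_index b : (forall i, (b i <= s i)%N) -> exists n c,
  [/\ (0 < n < A)%N, ~~ (p %| n)%N, c != 0 & has_weight n c (psi (mS b))] /\
  [/\ (total p b = ep * n.-1 %[mod q1])%N, (total p b == 0%N) = (n == 1%N)
    & (n.+1 == A) = [forall i, b i == s i]].
Proof.
move=> hb; have [n [c [nA pn c0 hc mE]]] := weight_vec hb; exists n, c; split=> //.
have [c1 c10 [hc1 m1]] := weight_vec0.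
have n0 : (0 < n)%N by case/andP: nA.
have A1 := deg_gt1 H (ltn0Sn k).
split.
- apply/eqP; rewrite -(eqn_modDl m) mE -modnDml m1 modnDml -mulnS prednK //.
- apply/eqP/eqP => [t0|n1].
    have b0 : mS b = mS (fun=> 0%N) by apply: mono_ext => i; exact: total_eq0.
    rewrite b0 in hc; apply/esym/(has_weight_uniq H fk _ _ _ c10 hc1 hc) => //.
    + exact: ltnW.
    + by case/andP: nA => _ /ltnW.
    + by rewrite gtnNdvd // prime_gt1.
  apply/eqP; rewrite eqn0Ngt; apply/negP => t0; rewrite n1 in hc.
  have [e he] := psi_prop z_le hb c10 hc1 hc.
  have := congr1 (fun v => ev v 1 0) he; rewrite evZ !ev_mono // rmorph1 rmorph0 !expr1n !mul1r.
  rewrite expr0n (gtn_eqF t0) /total big1 // expr0 mulr1 => e0.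
  by move/eqP: (mS_neq0 hb); apply; rewrite he -e0 scale0r.
- have hs := psi_top c10 hc1 m1.
  have c1' : - c1 != 0 by rewrite oppr_eq0.
  have hcs : has_weight A.-1 (- c1) (psi (mS s)).
    by rewrite hs -[X in has_weight _ X _]mulr1; apply: has_weightZ; exact: (has_weight_wZv H fk r_h1).
  apply/eqP/forallP => [nE i|bs].
    apply/negPn/negP => ne; have nE' : n = A.-1 by rewrite -nE.
    rewrite nE' in hc; have [e he] := psi_prop s_le hb c1' hcs hc.
    have lt := total_lt hb ne.
    have := congr1 (fun v => ev v 0 1) he; rewrite evZ !ev_mono // rmorph1 rmorph0 !expr1n !mulr1.
    rewrite subnn expr0 mulr1 expr0n subn_eq0 leqNgt lt /= => e0.
    by move/eqP: (mS_neq0 hb); apply; rewrite he -e0 scale0r.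
  have b0 : mS b = mS s by apply: mono_ext => i; exact/eqP.
  rewrite b0 in hc; have -> : n = A.-1; last by rewrite prednK // ltnW.
  apply: (has_weight_uniq H fk _ _ pn c0 hc hcs); last exact: leq_pred.
  by case/andP: nA => _ /ltnW.
Qed.

Lemma V_weight_bracket (y : G) w (z : G) : V s w ->
  V s (bracket (inflate (weight_act (D := D) m)) y w z).
Proof. by move=> hw; rewrite /bracket; case: ifP => _; [exact: V_weight_act|exact: V_zero]. Qed.

Lemma V_hecke g v x : V s v -> V s (hecke_bracket (inflate (weight_act (D := D) m)) Bw Cw g v x).
Proof.
move=> hv; rewrite /hecke_bracket fctE fct_sumE; apply: V_add.
  by apply: V_sum => l _; apply: V_weight_bracket; exact: V_Bw.
by apply: V_weight_bracket; exact: V_Cw.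
Qed.

Lemma psi_hecke g v x : V s v ->
  psi (hecke_bracket (inflate (weight_act m)) Bw Cw g v x) =
  \sum_l brQ (g *m mx2 p%:R (teich l) 0 1) (psi (Bw l v)) x +
  brQ (g *m mx2 1 0 0 p%:R) (psi (Cw v)) x.
Proof.
move=> hv; have Vb := V_weight_bracket.
rewrite /hecke_bracket fctE fct_sumE psiD; last 2 first.
- by apply: V_sum => l _; apply: Vb; exact: V_Bw.
- by apply: Vb; exact: V_Cw.
apply: (congr2 +%R); last exact: (psi_bracket _ _ (V_Cw hv)).
refine (etrans (psi_sum _ _) _) => [l _|]; first by apply: Vb; exact: V_Bw.
by apply: eq_bigr => l _; exact: (psi_bracket _ _ (@V_Bw l v hv)).
Qed.

(** The scalar e is fixed by matching the terms indexed by nu. The alpha-terms then agree as well: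
    on both sides they vanish unless t + 2 = A, and in that case C(A - 1, t) = A - 1 = -1 modulo p
    supplies the sign found in [psi_top]. *)
Lemma null_image_hecke_mono g b : g \in unitmx -> (forall i, (b i <= s i)%N) ->
  null_image (fun x => psi (hecke_bracket (inflate (weight_act m)) Bw Cw g (mS b) x)).
Proof.
move=> gu hb; have [n [c [[nA pn c0 hc] [tE t0E nAE]]]] := weight_index hb.
have [c1 c10 [hc1 m1]] := weight_vec0.
have [n0 nltA] := andP nA; pose t := n.-1; have nE : n = t.+1 by rewrite prednK.
have tA : (t.+1 < A)%N by rewrite -nE.
have pt : ~~ (p %| t.+1)%N by rewrite -nE.
have C0 : ('C(A.-1, t)%:R : L) != 0.
  by rewrite (natr_neq0 H); apply: prime_ndvd_bin pp (cd_ap H) _; exact: ltnW.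
have r0 : ((r i1)%:R : L) != 0 by rewrite (natr_neq0 H).
have Vb := V_mono (R := L) hb; have V0 := V_mono (R := L) z_le.
pose e : L := - c1 / ((r i1)%:R * 'C(A.-1, t)%:R).
apply: null_image_ext (null_image_relation e tA pt gu) => x.
refine (etrans _ (esym (psi_hecke g x Vb))); apply: (congr2 +%R).
  apply: eq_bigr => nu _; congr (brQ _ _ x).
  rewrite Bw_mono // psiZ // (has_weight_zero_vec c10 hc1) scalerA; congr (_ *: _).
  (* For nu = 0 congruent exponents are not enough: both must be zero or both positive, hence the
     case distinction. The sign moves inside the power because [ep] is odd. *)
  have -> : (- iota nu) ^+ total p b = (- iota nu ^+ ep) ^+ t.
    have [t0|t0] := posnP (total p b).
      have : n == 1%N by rewrite -t0E t0.
      by rewrite nE eqSS => /eqP t0'; rewrite t0 t0'.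
    have tpos : (0 < t)%N.
      by rewrite lt0n; apply: contraTneq t0 => t0; rewrite -leqNgt leqn0 t0E nE t0.
    have -> : - iota nu ^+ ep = (- iota nu) ^+ ep.
      by rewrite [in RHS]exprNn -signr_odd odd_ep mulN1r.
    rewrite -exprM -rmorphN; apply: iota_exp_modn => //; last by rewrite cK.
    by rewrite muln_gt0 (eps_gt0 H).
  by rewrite /e /rel_coef; field; rewrite C0 r0.
congr (brQ _ _ x); rewrite Cw_mono // -nAE nE /rel_coef_alpha.
case: eqP => [tE2|_]; last by rewrite mulr0 scale0r psi_zero.
rewrite (psi_top c10 hc1 m1); congr (_ *: _).
have CE : 'C(A.-1, t)%:R = -1 :> L.
  have -> : A.-1 = t.+1 by rewrite -tE2.
  rewrite binSn -[-1]add0r; apply/eqP; rewrite -subr_eq opprK natr1 tE2.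
  by rewrite -(dvdn_pcharf pcharL) degS dvdn_mulr.
by rewrite /e CE; field; rewrite ?r0 ?oppr_eq0 ?oner_neq0.
Qed.

Lemma null_image_hecke g v : g \in unitmx -> V s v ->
  null_image (fun x => psi (hecke_bracket (inflate (weight_act m)) Bw Cw g v x)).
Proof.
move=> gu hv; suff [] : V s v /\
    null_image (fun x => psi (hecke_bracket (inflate (weight_act m)) Bw Cw g v x)) by [].
move: v hv; apply: V_ind => [|e u v [Vu hu] [Vv hv]|b hb]; last first.
- by split; [exact: V_mono|exact: null_image_hecke_mono].
- have Vw : V s (e *: u + v) by exact: V_lin.
  apply: conj; first exact: Vw.
  apply: null_image_ext (null_image_lin e hu hv) => x.
  refine (etrans (congr2 (fun y z => e *: y + z) (psi_hecke g x Vu) (psi_hecke g x Vv))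
    (etrans _ (esym (psi_hecke g x Vw)))).
  rewrite scalerDr scaler_sumr addrACA -big_split; congr (_ + _).
    apply: eq_bigr => l _ /=; rewrite /Bw substXY_lin psi_lin; [|exact: V_Bw|exact: V_Bw].
    by rewrite (bracket_lin inflate_Qgr_act_lin).
  by rewrite /Cw substXY_lin psi_lin ?(bracket_lin inflate_Qgr_act_lin) //; exact: V_Cw.
- split; first exact: V_zero.
  apply: null_image_ext null_image_zero => x.
  refine (etrans _ (esym (psi_hecke g x (@V_zero _ _ s)))).
  rewrite big1 => [|l _]; rewrite ?/Bw ?/Cw substXY0 psi_zero (bracket0 inflate_Qgr_act_lin) //.
  by rewrite add0r.
Qed.

Lemma null_image_hecke_sum (l : seq (G * polyF)) :
  (forall y, y \in l -> y.1 \in unitmx /\ V s y.2) ->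
  null_image (fun x => psi ((\sum_(y <- l) hecke_bracket (inflate (weight_act m)) Bw Cw y.1 y.2) x)).
Proof.
move=> hl; set S := fun l : seq (G * polyF) =>
  \sum_(y <- l) hecke_bracket (inflate (weight_act m)) Bw Cw y.1 y.2.
suff [] : (forall x, V s (S l x)) /\ null_image (fun x => psi (S l x)) by [].
elim: l hl => [|y l IHl] hl.
  split=> [x|]; first by rewrite /S big_nil; exact: V_zero.
  by apply: null_image_ext null_image_zero => x; rewrite /S big_nil (psi_zero : psi ((0 : G -> _) x) = 0).
have [yu Vy] := hl y (mem_head _ _).
have [Vl gl] := IHl (fun z hz => hl z (mem_behead (s := y :: l) hz)).
have Sx x : S (y :: l) x = hecke_bracket (inflate (weight_act m)) Bw Cw y.1 y.2 x + S l x.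
  by rewrite /S big_cons.
split=> [x|]; first by rewrite Sx; apply: V_add; [exact: V_hecke|exact: Vl].
apply: null_image_ext (null_image_lin 1 (null_image_hecke yu Vy) gl) => x; rewrite Sx.
by refine (etrans _ (esym (psiD _ (Vl x)))); [rewrite scale1r|exact: V_hecke].
Qed.

End OneWeight.
End WeightAnalysis.

(** * From single weights to the graded piece *)

Lemma wd_inj (p f : nat) (D : padic_data p f) (U : lmodType (Fbar D))
    (rho : 'M[kF D]_2 -> U -> U) (W : U -> Prop) (dec : weight_decomposition rho W)
    (j : 'I_(wd_size dec)) u : V (wd_s j) u -> wd_map j u = 0 -> u = 0.
Proof.
move=> Vu u0; pose w i := if i == j then u else 0.
have wd0 i : wd_map i 0 = 0 :> U.
  have V0 := V_zero (wd_s i) (R := Fbar D).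
  by have := wd_linear (-1) V0 V0; rewrite scaler0 addr0 scaleN1r addNr.
have Vw i : V (wd_s i) (w i) by rewrite /w; case: eqP => [->|_] //; exact: V_zero.
have := wd_direct Vw _ j; rewrite /w eqxx; apply.
by apply: big1 => i _; case: eqP => [->|_].
Qed.

Section Conclusion.
Context (p f : nat) (D : padic_data p f) (r : 'I_f -> nat) (a : nat) (h : 'I_f).
Context (H : congruent_degrees p (kF D) (Fbar D) r a h).
Context (k : nat) (fk : f = k.+2).
Context (ap : E D).
Local Notation G := 'M[F D]_2.
Implicit Type psi : G -> quot (Qsoc D r k).

Lemma null_image_semisimple_hecke (dec : weight_decomposition (Qgr_act D r k) (Qgr D r k)) phi psi :
  (2 < p)%N -> ~~ (p %| r (ordS h))%N -> (a = 1%N -> (p %| r h)%N) ->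
  ap != 0 -> 1 / 2%:R < vE ap ->
  semisimple_hecke dec phi psi -> null_image ap psi.
Proof.
move=> p2 r1 rh ap0 ap1 [phi_ [psi_ [_ hT _ hpsi]]].
apply: (@null_image_ext _ _ _ _ _ _ (fun x => \sum_j wd_map j (psi_ j x))) => [x|]; first by rewrite hpsi.
apply: null_image_sum => j; have [l [hl _ ->]] := hT j.
apply: (null_image_hecke_sum H fk p2 r1 rh ap0 ap1) => //.
- by move=> e u v; exact: wd_linear.
- by move=> x u; exact: wd_equivariant.
- exact: wd_in.
- exact: wd_inj.
- exact: hl.
Qed.

(* A lift of psi with zero image differs from any other lift by a function with
   values in Q_k, whose image lies in F_k by definition. *)
Lemma null_image_nat_gr psi y : null_image ap psi -> nat_gr D r ap k psi y -> y = 0.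
Proof.
move=> [psi0 [i0 e0 n0]] [phi' [t [_ e1 [psi1 [i1 e2 n1]] ->]]].
have kf : (k < f)%N by rewrite fk; exact: leqnSn.
have hk := QsocE H kf; pose d := (-1) *: psi0 + psi1.
have dx x : d x = psi1 x - psi0 x by rewrite /d !fctE scaleN1r addrC.
have hd : ind (inflate (@Vr_act _ _ D)) (V r) d.
  by apply: (ind_lin (@inflate_act_lin _ _ D)) => // u v; exact: V_lin.
have nd : nat_Vr d t by have := nat_Vr_lin (-1) n0 n1; rewrite scaler0 add0r.
apply: (etrans _ (quot_pi0 _)); apply/quot_pi_lspan; rewrite subr0 => N _ _; apply.
exists (fun x => quot_pi (Vstar_plus_Xr r) (d x)); last by exists d.
case: hd => d1 d2 d3 [s hs]; split.
- by move=> g gu; rewrite d1 // quot_pi0.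
- by move=> n x g xK gu; rewrite d2 // [RHS](Q_actE H).
- move=> g; apply/(quot_pi_eq0 (Qsoc_zero hk) (Qsoc_lin hk)).
  by rewrite dx quot_piB quot_piB -e2 -e1 e0 subrr.
- exists s => g dg; apply: hs; apply: contraNneq dg => ->.
  by rewrite quot_pi0.
Qed.

End Conclusion.

Theorem theorem10p2 (p f : nat) (D : padic_data p f)
    (k r : 'I_f -> nat) (h : 'I_f) (ah : nat) (ap : E D) :
  prime p -> (2 < p)%N -> (2 <= f)%N ->
  (forall i, r i = (k i - 2)%N) ->
  (forall i, (p ^ f <= r i)%N) ->
  (\sum_(i < f) r i * p ^ i = ah * p ^ h %[mod p ^ f - 1])%N ->
  (1 <= ah <= p - 1)%N ->
  ~~ (p %| r (ordS h))%N ->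
  (ah = 1%N -> (p %| r h)%N) ->
  ap != 0 -> 1 / 2%:R < vE ap < 1 ->
  forall (dec : weight_decomposition (Qgr_act D r (f - 2)) (Qgr D r (f - 2)))
         (phi psi : 'M[F D]_2 -> quot (Qsoc D r (f - 2))),
    ind (inflate (Qgr_act D r (f - 2))) (Qgr D r (f - 2)) phi ->
    semisimple_hecke dec phi psi ->
    forall y : quot (Ffil D r ap (f - 2)),
      nat_gr D r ap (f - 2) psi y -> y = 0.
Proof.
move=> p_pr p2 f2 _ hr tot /andP[ah0 ahp] r1 rh ap0 /andP[ap1 _] dec phi psi _ hT y.
have fk : f = (f - 2).+2 by rewrite -addn2 subnK.
have H : congruent_degrees p (kF D) (Fbar D) r ah h.
  split=> //; [exact: Fbar_char|exact: card_kF| |by rewrite -subn1].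
  by rewrite -[p]prednK ?ltnS -?subn1 // prime_gt0.
exact: (null_image_nat_gr H fk (null_image_semisimple_hecke H fk p2 r1 rh ap0 ap1 hT)).
Qed.
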